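(* Let $m\geq 2$ and $d\geq 1$ be integers, let $s>\frac{(m-1)d}{2}+\frac12$, and let $\sigma$ be a (positive, finite) measure on $\mathbb{R}^{md}$ supported in the unit ball $\mathbb{B}^{md}(0,1)$ whose Fourier transform satisfies $|\widehat{\mathrm{d}\sigma}(\xi)|\lesssim (1+|\xi|)^{-s}$ for $\xi\in\mathbb{R}^{md}$. For Schwartz functions $f_1,\dots,f_m$ on $\mathbb{R}^d$, writing $\mathrm{F}=(f_1,\dots,f_m)$ and $y=(y_1,\dots,y_m)\in(\mathbb{R}^d)^m$, define \[ \mathrm{M}_\sigma(\mathrm{F})(x)=\sup_{t>0}\Big|\int \prod_{i=1}^m f_i(x-ty_i)\,\mathrm{d}\sigma(y)\Big|,\qquad x\in\mathbb{R}^d. \] Then there is a constant $C$ such that \[ \|\mathrm{M}_\sigma(\mathrm{F})\|_{L^{2/m}(\mathbb{R}^d)}\le C\prod_{i=1}^m\|f_i\|_{L^2(\mathbb{R}^d)}. \]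
   Context: $\mathbb{B}^n(x,R)$ denotes the ball in $\mathbb{R}^n$ of radius $R$ centered at $x$. $\widehat{\mathrm{d}\sigma}$ is the Fourier transform of $\sigma$. *)

(* Defs.v *)
From HB Require Import structures.
From mathcomp Require Import all_boot all_order all_algebra.
From mathcomp Require Import all_classical all_reals all_analysis.
From mathcomp Require Import complex.
Set Implicit Arguments. Unset Strict Implicit. Unset Printing Implicit Defensive.
Import Order.TTheory GRing.Theory Num.Theory.
Local Open Scope classical_set_scope.
Local Open Scope ring_scope.

Section Defs.
Variable R : realType.

(* R^d is modelled as d.-tuple R (product Borel sigma-algebra, provided by
   mathcomp-analysis); the same point seen as a row vector of the normed
   space 'rV[R]_d (used for differentiability). *)
Definition tuple_rV (d : nat) (x : d.-tuple R) : 'rV[R]_d := \row_j tnth x j.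

Definition tnorm (m d : nat) (y : m.-tuple (d.-tuple R)) : R :=
  Num.sqrt (\sum_(i < m) \sum_(j < d) (tnth (tnth y i) j) ^+ 2).
Definition tdot (m d : nat) (y xi : m.-tuple (d.-tuple R)) : R :=
  \sum_(i < m) \sum_(j < d) tnth (tnth y i) j * tnth (tnth xi i) j.

Definition cabs (z : R[i]) : R := Num.sqrt (complex.Re z ^+ 2 + complex.Im z ^+ 2).

Definition Cintegral d (T : measurableType d) (mu : {measure set T -> \bar R})
  (g : T -> R[i]) : R[i] :=
  (Rintegral mu setT (fun y => complex.Re (g y)) +i*
   Rintegral mu setT (fun y => complex.Im (g y)))%C.

Definition fourier_measure (m d : nat)
  (sigma : {measure set (m.-tuple (d.-tuple R)) -> \bar R})
  (xi : m.-tuple (d.-tuple R)) : R[i] :=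
  Cintegral sigma (fun y => (cos (2 * pi * tdot y xi) +i* (- sin (2 * pi * tdot y xi)))%C).

(* d-dimensional Lebesgue measure on the Borel sets of R^d: the measure that
   gives every closed box its volume (this determines it uniquely). *)
Definition is_lebesgue_measure (d : nat) (lam : {measure set (d.-tuple R) -> \bar R}) :=
  forall a b : d.-tuple R, (forall j, tnth a j <= tnth b j) ->
    lam [set x | forall j, tnth a j <= tnth x j <= tnth b j] =
    (\prod_(j < d) (tnth b j - tnth a j))%:E.

Definition pderiv (d : nat) (j : 'I_d) (f : 'rV[R]_d -> R) : 'rV[R]_d -> R :=
  fun x => 'D_(delta_mx 0 j) f x.
Definition iter_pderiv (d : nat) (js : seq 'I_d) (f : 'rV[R]_d -> R) :=
  foldr (@pderiv d) f js.

Definition is_schwartz (d : nat) (f : 'rV[R]_d -> R) : Prop :=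
  forall js : seq 'I_d,
    (forall x, differentiable (iter_pderiv js f) x) /\
    (forall alpha : 'I_d -> nat, exists C : R, forall x : 'rV[R]_d,
       `| (\prod_(j < d) (x 0 j) ^+ alpha j) * iter_pderiv js f x | <= C).

Definition is_schwartzC (d : nat) (f : 'rV[R]_d -> R[i]) : Prop :=
  is_schwartz (fun x => complex.Re (f x)) /\ is_schwartz (fun x => complex.Im (f x)).

Definition max_op (m d : nat)
  (sigma : {measure set (m.-tuple (d.-tuple R)) -> \bar R})
  (F : 'I_m -> 'rV[R]_d -> R[i]) (x : d.-tuple R) : \bar R :=
  ereal_sup [set (cabs (Cintegral sigma (fun y =>
        \prod_(i < m) F i (tuple_rV x - t *: tuple_rV (tnth y i)))))%:E
     | t in [set t : R | 0 < t]].

Definition eLnorm d (T : measurableType d) (mu : {measure set T -> \bar R})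
  (p : R) (g : T -> \bar R) : \bar R :=
  ((\int[mu]_x (`|g x| `^ p)) `^ p^-1)%E.

End Defs.

(* Main.v *)
(* The supremum over t > 0 is discretized: one restricts to a box of size L, to finitely
   many times and to the points of a fine grid, and reaches the general case by Riemann sums
   and monotone convergence.

   A time t is attached to the dyadic cells of side l with l/24 < t <= l/12; by the one-third
   trick a translate of the dyadic grid puts x well inside its cell.  On that cell each f_i
   is replaced by a trigonometric polynomial with cell Fourier coefficients b_i, so that the
   average becomes sum_n prod_i b_i(n_i) sigma^(t n / l) e(sum_i n_i . x / l).  The zero mode
   is a product of cell averages, controlled by the dyadic maximal function.  For the other
   modes, the decay of sigma^ with s > (m-1)d/2 + 1/2, Cauchy-Schwarz on the fibres of
   n |-> sum_i n_i and the regularity of sigma^ in t (finite differences, since sigma lives in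
   the unit ball) bound the conditional mean square of the supremum over the times of one
   generation by sum_(n <> 0) prod_i |b_i(n_i)|^2 w(n_i)^(-e).

   Summing over generations, sum_(n <> 0) |b(n)|^2 w(n)^(-e) is a square function bounded on
   L^2 by martingale differences.  A Lenglart-type domination inequality turns the conditional
   bound into a bound for the power 1/m, and Hoelder separates the factors. *)
Require Import Defs.
From HB Require Import structures.
From mathcomp Require Import all_boot all_order all_algebra.
From mathcomp Require Import all_classical all_reals all_analysis.
From mathcomp Require Import complex.
From mathcomp Require Import measurable_realfun ring lra zify.
Set Implicit Arguments. Unset Strict Implicit. Unset Printing Implicit Defensive.
Import Order.TTheory GRing.Theory Num.Theory.
Import numFieldNormedType.Exports.
Local Open Scope ring_scope.

(** * Squared moduli and unit characters *)

Section ComplexBasics.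
Import ComplexField.Normc.
Variable R : realType.
Local Notation C := R[i].
Implicit Types z w : C.

(** The threshold on [s] adds two costs. A fibre of n |-> sum_i n_i has (m-1)d free integer
    coordinates, so summing the squares of w^(-s) over it asks for 2s > (m-1)d. At frequency size Y
    a supremum over times costs about one more factor Y in mean square, as a maximum over Y times
    would: this is the extra 1/2. What is left of [s] pays for three things: the convergence of the
    fibre sums, the sum over dyadic blocks of frequencies, and a small power of w, without which the
    coefficients could not be summed over the generations. The exponent 2/m may be below 1, where
    neither duality nor the triangle inequality is at hand; hence sums of squares are compared only
    after the concave power 1/m. The supremum is linearised: each grid point carries one selected
    time, and all constants are independent of the selection, the box, the mesh and the frequency
    cut-off. The cut-off must stay free because it is chosen from the sup and Lipschitz bounds of
    the f_i. All Fourier analysis takes place on finite cells, so Plancherel is the orthogonality of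
    roots of unity. *)

Definition nsq z : R := complex.Re z ^+ 2 + complex.Im z ^+ 2.
Definition cis (t : R) : C := (cos t +i* sin t)%C.

Lemma cReD z w : complex.Re (z + w) = complex.Re z + complex.Re w.
Proof. by case: z w => a b [c d]. Qed.
Lemma cImD z w : complex.Im (z + w) = complex.Im z + complex.Im w.
Proof. by case: z w => a b [c d]. Qed.
Lemma cReB z w : complex.Re (z - w) = complex.Re z - complex.Re w.
Proof. by case: z w => a b [c d]. Qed.
Lemma cImB z w : complex.Im (z - w) = complex.Im z - complex.Im w.
Proof. by case: z w => a b [c d]. Qed.
Lemma cReM z w : complex.Re (z * w) =
  complex.Re z * complex.Re w - complex.Im z * complex.Im w.
Proof. by case: z w => a b [c d]. Qed.
Lemma cImM z w : complex.Im (z * w) =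
  complex.Re z * complex.Im w + complex.Im z * complex.Re w.
Proof. by case: z w => a b [c d]. Qed.
Lemma Re_sum (I : Type) (r : seq I) (P : pred I) (F : I -> C) :
  complex.Re (\sum_(i <- r | P i) F i) = \sum_(i <- r | P i) complex.Re (F i).
Proof. by apply: (big_morph (@complex.Re R) cReD). Qed.
Lemma Im_sum (I : Type) (r : seq I) (P : pred I) (F : I -> C) :
  complex.Im (\sum_(i <- r | P i) F i) = \sum_(i <- r | P i) complex.Im (F i).
Proof. by apply: (big_morph (@complex.Im R) cImD). Qed.
Lemma complex_ext z w : complex.Re z = complex.Re w ->
  complex.Im z = complex.Im w -> z = w.
Proof. by case: z w => a b [c d] /= -> ->. Qed.

Lemma cabsE z : cabs z = normc z. Proof. by case: z. Qed.
Lemma cabs_ge0 z : 0 <= cabs z. Proof. exact: sqrtr_ge0. Qed.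
Lemma nsq_ge0 z : 0 <= nsq z. Proof. by rewrite addr_ge0 ?sqr_ge0. Qed.
Lemma sqr_cabs z : cabs z ^+ 2 = nsq z.
Proof. by rewrite sqr_sqrtr ?nsq_ge0. Qed.
Lemma cabsM z w : cabs (z * w) = cabs z * cabs w.
Proof. by rewrite !cabsE normcM. Qed.
Lemma cabsD z w : cabs (z + w) <= cabs z + cabs w.
Proof. by rewrite !cabsE le_normcD. Qed.
Lemma cabsN z : cabs (- z) = cabs z.
Proof. by rewrite !cabsE normcN. Qed.
Lemma cabsB z w : cabs (z - w) <= cabs z + cabs w.
Proof. by rewrite -(cabsN w) cabsD. Qed.
Lemma cabs0 : cabs (0 : C) = 0. Proof. by rewrite cabsE normc0. Qed.
Lemma cabs1 : cabs (1 : C) = 1. Proof. by rewrite cabsE normc1. Qed.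
Lemma cabs_sum (I : Type) (r : seq I) (P : pred I) (F : I -> C) :
  cabs (\sum_(i <- r | P i) F i) <= \sum_(i <- r | P i) cabs (F i).
Proof.
elim/big_rec2: _ => [|i y x _ h]; first by rewrite cabs0.
by apply: (le_trans (cabsD _ _)); rewrite lerD2l.
Qed.
Lemma cabs_prod (I : Type) (r : seq I) (P : pred I) (F : I -> C) :
  cabs (\prod_(i <- r | P i) F i) = \prod_(i <- r | P i) cabs (F i).
Proof. exact: (big_morph _ cabsM cabs1). Qed.
Lemma nsqM z w : nsq (z * w) = nsq z * nsq w.
Proof. by rewrite -!sqr_cabs cabsM exprMn. Qed.
Lemma nsq0 : nsq 0 = 0. Proof. by rewrite /nsq /= expr0n addr0. Qed.
Lemma nsqN z : nsq (- z) = nsq z.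
Proof. by rewrite -!sqr_cabs cabsN. Qed.
Lemma cabsX z n : cabs (z ^+ n) = cabs z ^+ n.
Proof. by elim: n => [|n IH]; rewrite ?expr0 ?cabs1 // !exprS cabsM IH. Qed.
Lemma cabs_Re z : `|complex.Re z| <= cabs z.
Proof. by rewrite -sqrtr_sqr ler_wsqrtr // lerDl sqr_ge0. Qed.
Lemma cabs_Im z : `|complex.Im z| <= cabs z.
Proof. by rewrite -sqrtr_sqr ler_wsqrtr // lerDr sqr_ge0. Qed.
Lemma cabs_leD z : cabs z <= `|complex.Re z| + `|complex.Im z|.
Proof.
rewrite -(@ger0_norm _ (_ + _)) ?addr_ge0 // -sqrtr_sqr ler_wsqrtr //.
rewrite sqrrD !real_normK ?num_real // -addrA [X in _ <= _ + X]addrC addrA.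
by rewrite lerDl mulrn_wge0 // mulr_ge0.
Qed.
Lemma cabs_real (x : R) : cabs (x%:C)%C = `|x|.
Proof. by rewrite /cabs /= expr0n addr0 sqrtr_sqr. Qed.
Lemma nsqD_le z w : nsq (z + w) <= 2 * nsq z + 2 * nsq w.
Proof.
rewrite /nsq cReD cImD.
have := sqr_ge0 (complex.Re z - complex.Re w).
have := sqr_ge0 (complex.Im z - complex.Im w). nra.
Qed.

Lemma cisD s t : cis (s + t) = cis s * cis t.
Proof. by apply: complex_ext; rewrite ?cReM ?cImM /= ?cosD ?sinD // addrC. Qed.
Lemma cis0 : cis 0 = 1. Proof. by rewrite /cis cos0 sin0. Qed.
Lemma cabs_cis t : cabs (cis t) = 1.
Proof. by rewrite /cabs /= cos2Dsin2 sqrtr1. Qed.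
Lemma cis_sum (I : Type) (r : seq I) (P : pred I) (F : I -> R) :
  cis (\sum_(i <- r | P i) F i) = \prod_(i <- r | P i) cis (F i).
Proof. exact: (big_morph _ cisD cis0). Qed.
Lemma cisMn t n : cis (t *+ n) = cis t ^+ n.
Proof. by elim: n => [|n IH]; rewrite ?mulr0n ?cis0 // mulrS exprS cisD IH. Qed.
Lemma cis2pi : cis (2 * pi) = 1.
Proof. by rewrite /cis mulr_natl cos2pi sin2pi. Qed.
Lemma cis2pi_nat n : cis (2 * pi * n%:R) = 1.
Proof. by rewrite mulr_natr cisMn cis2pi expr1n. Qed.
Lemma conjc_cis t : conjc (cis t) = cis (- t).
Proof. by rewrite /cis cosN sinN. Qed.
Lemma conjcM z w : conjc (z * w) = conjc z * conjc w.
Proof. by rewrite rmorphM. Qed.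
Lemma nsqE z : (nsq z)%:C%C = z * conjc z.
Proof.
by case: z => a b; apply: complex_ext; rewrite ?cReM ?cImM /nsq /=; ring.
Qed.

Lemma sin_norm_le (t : R) : `|sin t| <= `|t|.
Proof.
wlog t0 : t / 0 <= t.
  move=> H; case: (leP 0 t) => [/H //|/ltW t0].
  by rewrite -normrN -sinN -[leRHS]normrN; apply: H; rewrite oppr_ge0.
have [c _] : exists2 c : R, c \in `[0, t] & sin t - sin 0 = cos c * (t - 0).
  apply: MVT_segment => //.
  by apply: continuous_subspaceT; exact: continuous_sin.
by rewrite sin0 !subr0 => ->; rewrite normrM ler_piMl // cos_max.
Qed.
Lemma nsq_cis_sub1 t : nsq (cis t - 1) = (2 * sin (t / 2)) ^+ 2.
Proof.
have -> : cis t - 1 = cis (t / 2 + t / 2) - 1 by congr (cis _ - _); lra.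
rewrite /nsq /cis /= cosD sinD subr0 -!expr2 cos2sin2.
transitivity (4 * sin (t/2)^+2 * (sin (t/2)^+2 + cos (t/2) ^+2)); first by ring.
by rewrite cos2sin2; ring.
Qed.
Lemma cis_sub1 t : cabs (cis t - 1) <= `|t|.
Proof.
rewrite -[leLHS]ger0_norm ?cabs_ge0 // -sqrtr_sqr sqr_cabs nsq_cis_sub1 sqrtr_sqr.
have -> : `|t| = 2 * `|t / 2| by rewrite normrM [`|2^-1|]ger0_norm // mulrCA divff ?mulr1.
by rewrite normrM ger0_norm // ler_wpM2l // sin_norm_le.
Qed.
End ComplexBasics.

(** * Sums of roots of unity *)

Section Dft.
Variable R : realType.
Local Notation C := R[i].

Lemma cis_neq1 (t : R) : 0 < t < 2 * pi -> cis t != 1.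
Proof.
move=> /andP[t0 t1]; apply/eqP => h.
have := nsq_cis_sub1 t; rewrite h subrr nsq0 => /esym/eqP.
rewrite sqrf_eq0 mulf_eq0 pnatr_eq0 /= => /eqP s0.
have: 0 < sin (t / 2) by apply: sin_gt0_pi; lra.
by rewrite s0 ltxx.
Qed.

(** The summands are the powers of an s-th root of unity z, and z differs from 1 when a and b are
    distinct residues; multiplying the geometric sum by z - 1 then gives 0. *)
Lemma dft1 (s a b : nat) : (a < s)%N -> (b < s)%N ->
  \sum_(r < s) cis (2 * pi * ((a%:R - b%:R) * r%:R / s%:R) : R) =
  if a == b then s%:R else 0.
Proof.
move=> ha hb.
have s0 : (0 < s%:R :> R) by rewrite ltr0n; case: s ha hb.
set z : C := cis (2 * pi * ((a%:R - b%:R) / s%:R)).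
have -> : \sum_(r < s) cis (2 * pi * ((a%:R - b%:R) * r%:R / s%:R) : R) =
          \sum_(r < s) z ^+ r.
  by apply: eq_bigr => r _; rewrite -cisMn -mulr_natr; congr cis; ring.
have [ab|ab] := eqVneq a b.
  rewrite /z ab; under eq_bigr do rewrite ?subrr ?mul0r ?mulr0 ?cis0 ?expr1n.
  by rewrite sumr_const card_ord.
have zs : z ^+ s = 1.
  rewrite -cisMn -[X in cis X]mulr_natr.
  have -> : 2 * pi * ((a%:R - b%:R) / s%:R) * s%:R = 2 * pi * a%:R + - (2 * pi * b%:R) :> R.
    by field; rewrite gt_eqF.
  by rewrite cisD -conjc_cis !cis2pi_nat conjc1 mulr1.
have z1 : z != 1.
  have key (c e : nat) : (c < e)%N -> (e < s)%N ->
     cis (2 * pi * ((e%:R - c%:R) / s%:R) : R) != 1.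
    move=> ce es; apply: cis_neq1; have p0 := @pi_gt0 R.
    have : (c%:R < e%:R :> R) by rewrite ltr_nat.
    have : (e%:R < s%:R :> R) by rewrite ltr_nat.
    have : (0 <= c%:R :> R) by [].
    move=> h1 h2 h3; rewrite mulr_gt0 ?divr_gt0 ?subr_gt0 ?mulr_gt0 //=.
    by rewrite gtr_pMr ?mulr_gt0 // ltr_pdivrMr // mul1r; lra.
  case: (ltngtP a b) ab => // hab _; last exact: key.
  apply/negP => /eqP h; have := key _ _ hab hb.
  have -> : 2 * pi * ((b%:R - a%:R) / s%:R) = - (2 * pi * ((a%:R - b%:R) / s%:R)) :> R by ring.
  by rewrite -conjc_cis -/z h conjc1 eqxx.
apply: (mulfI (x := z - 1)); first by rewrite subr_eq0.
by rewrite -subrX1 zs subrr mulr0.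
Qed.

Lemma sum_ord_cell (V : nmodType) (P s q : nat) (f : nat -> V) :
  (0 < s)%N -> (s %| P)%N -> (q < P %/ s)%N ->
  \sum_(y < P | (y %/ s)%N == q) f y = \sum_(r < s) f (q * s + r)%N.
Proof.
move=> s0 sP qP.
have hb (r : 'I_s) : (q * s + r < P)%N.
  have := ltn_ord r; have : (q.+1 * s <= P)%N.
    by rewrite -(divnK sP) leq_mul2r qP orbT.
  by rewrite mulSn; lia.
have hm (y : 'I_P) : (y %% s < s)%N by rewrite ltn_mod.
rewrite (reindex_onto (fun r : 'I_s => Ordinal (hb r)) (fun y : 'I_P => Ordinal (hm y))) /=.
  apply: eq_bigl => r /=; rewrite divnMDl // divn_small // addn0 eqxx /=.
  by apply/eqP/val_inj => /=; rewrite modnMDl modn_small.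
by move=> y /eqP yq; apply/val_inj => /=; rewrite -yq -divn_eq.
Qed.

End Dft.

(** * Convergent weighted sums over integer frequencies *)

Section RealSums.
Variable R : realType.

(* An index u < N.*2.+1 encodes the integer frequency u - N; zf is its real value
   and zab its absolute value. *)
Definition zab (N u : nat) : nat := ((u - N) + (N - u))%N.
Definition zf (N u : nat) : R := u%:R - N%:R.
Lemma zabE N u : `|zf N u| = (zab N u)%:R.
Proof.
rewrite /zf /zab; case: (leqP N u) => h.
  by rewrite -natrB // ger0_norm //; congr (_%:R); lia.
by rewrite distrC -natrB ?(ltnW h) // ger0_norm //; congr (_%:R); lia.
Qed.

(** Discrete comparison with the integral of x^(-1-b): each term is at most an increment of the
    primitive -x^(-b)/b. The bounds exp x >= 1 + x and ln(1 + x) <= x replace the mean value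
    theorem. *)
Lemma powR_telescope (b : R) (k : nat) : 0 < b -> (0 < k)%N ->
  (1 + k%:R) `^ (- (1 + b)) <=
   b^-1 * (k%:R `^ (- b) - (1 + k%:R) `^ (- b)).
Proof.
move=> b0 k0.
have k1 : 0 < (k%:R : R) by rewrite ltr0n.
have K1 : 0 < (1 + k%:R : R) by lra.
rewrite ler_pdivlMl // lerBrDr.
have -> : (1 + k%:R) `^ (- (1 + b)) = (1 + k%:R) `^ (- b) / (1 + k%:R) :> R.
  have -> : - (1 + b) = - b + - 1 by ring.
  by rewrite powRD ?(gt_eqF K1) ?implybT // powR_inv1 // ltW.
have -> : b * ((1 + k%:R) `^ (- b) / (1 + k%:R)) + (1 + k%:R) `^ (- b) =
   (1 + k%:R) `^ (- b) * (1 + b / (1 + k%:R)) :> R by field; rewrite gt_eqF.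
have -> : k%:R `^ (- b) = (1 + k%:R) `^ (- b) * (k%:R / (1 + k%:R)) `^ (- b) :> R.
  by rewrite -powRM ?ltW ?divr_gt0 // mulrC divfK // gt_eqF.
rewrite ler_pM2l ?powR_gt0 //.
rewrite /powR gt_eqF ?divr_gt0 //.
apply: le_trans (expR_ge1Dx _); rewrite lerD2l mulNr -mulrN ler_pM2l //.
have -> : k%:R / (1 + k%:R) = 1 + (- (1 + k%:R)^-1) :> R by field; rewrite gt_eqF.
rewrite lerNr; apply: le_ln1Dx.
by rewrite ltrN2 invf_lt1 // ltrDl.
Qed.

Lemma sum_half (b : R) (N : nat) : 0 < b ->
  \sum_(k < N.+1) (1 + k%:R) `^ (- (1 + b)) <= 1 + b^-1.
Proof.
move=> b0.
rewrite big_ord_recl /= addr0 powR1 lerD2l.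
apply: (@le_trans _ _ (\sum_(i < N) b^-1 * ((1 + i%:R) `^ (- b) - (1 + (i.+1)%:R) `^ (- b)))).
  apply: ler_sum => i _; apply: (le_trans (powR_telescope b0 _)) => //=.
  have e1 : i.+1%:R = 1 + i%:R :> R by rewrite -natr1 addrC.
  by rewrite (_ : bump 0 i = i.+1) // e1.
rewrite -mulr_sumr ler_piMr ?invr_ge0 ?(ltW b0) //.
have := @telescope_sumr R 0 N (fun i => - ((1 + i%:R) `^ (- b))) isT.
rewrite big_mkord => h.
under eq_bigr do rewrite addrC -[X in _ + X]opprK.
by rewrite h addr0 powR1 opprK addrC gerBl powR_ge0.
Qed.

Lemma sum1d_bound (a : R) : 1 < a ->
  exists S : R, 0 < S /\ forall N, \sum_(u < N.*2.+1) (1 + (zab N u)%:R) `^ (- a) <= S.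
Proof.
move=> a1; have b0 : 0 < a - 1 by rewrite subr_gt0.
exists (2 * (1 + (a - 1)^-1)); split; first by rewrite mulr_gt0 ?addr_gt0 ?invr_gt0.
move=> N; have hs := sum_half N b0.
rewrite addrCA subrr addr0 in hs.
rewrite -(big_mkord predT (fun u => (1 + (zab N u)%:R) `^ (- a))).
(* Indices 0..N encode the frequencies -N..0 and the later ones the positive frequencies; each half
   is dominated by the one-sided sum. *)
rewrite (@big_cat_nat _ _ _ N.+1) //=; last by lia.
rewrite [2 * _]mulr_natl mulr2n lerD //.
  rewrite big_nat_rev big_mkord; apply: le_trans hs.
  apply: ler_sum => i _; have hi := ltn_ord i.
  by rewrite (_ : zab _ _ = i) // /zab; lia.
rewrite -{1}(add0n N.+1) big_addn (_ : (N.*2.+1 - N.+1 = N)%N); last by lia.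
apply: le_trans hs; rewrite big_mkord [leRHS]big_ord_recl /=.
rewrite ler_wpDl ?powR_ge0 //; apply: ler_sum => i _.
by rewrite (_ : zab _ _ = bump 0 i) // /zab /bump; lia.
Qed.
End RealSums.

(** * Concavity of the power 1/m *)

Section Powers.
Variable R : realType.

Lemma bernoulli (u : R) (n : nat) : 0 <= u -> 1 + n%:R * (u - 1) <= u ^+ n.
Proof.
move=> u0; elim: n => [|n IH]; first by rewrite mul0r addr0.
rewrite exprS; apply: le_trans (ler_wpM2l u0 IH).
have := mulr_ge0 (ler0n R n) (sqr_ge0 (u - 1)); rewrite -natr1; nra.
Qed.

Lemma powR_invn_exp (x : R) (m : nat) : 0 <= x -> (0 < m)%N ->
  (x `^ (m%:R^-1)) ^+ m = x.
Proof.
move=> x0 m0.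
by rewrite -powR_mulrn ?powR_ge0 // -powRrM mulVf ?pnatr_eq0 -?lt0n // powRr1.
Qed.

(** Concavity of t |-> t^(1/m): the graph lies below its tangent at [y]. Bernoulli for u =
    (x/y)^(1/m) gives this without derivatives. *)
Lemma powR_invn_tangent (m : nat) (x y : R) : (0 < m)%N -> 0 <= x -> 0 < y ->
  x `^ (m%:R^-1) <= y `^ (m%:R^-1) * (1 + m%:R^-1 * (x / y - 1)).
Proof.
move=> m0 x0 y0; have r0 : 0 <= x / y by rewrite divr_ge0 // ltW.
have m0' : 0 < (m%:R : R) by rewrite ltr0n.
have -> : x `^ m%:R^-1 = y `^ m%:R^-1 * (x / y) `^ m%:R^-1.
  by rewrite -powRM ?(ltW y0) // mulrCA mulfV ?mulr1 // gt_eqF.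
rewrite ler_pM2l ?powR_gt0 //.
have := bernoulli m (powR_ge0 (x / y) m%:R^-1); rewrite powR_invn_exp // => h.
by rewrite -lerBlDl ler_pdivlMl // lerBrDl.
Qed.

Lemma powR_invn_div (m : nat) (x y : R) : (0 < m)%N -> 0 < x -> x <= y ->
  y `^ (m%:R^-1) / y <= x `^ (m%:R^-1) / x.
Proof.
move=> m0 x0 xy; have y0 := lt_le_trans x0 xy.
rewrite ler_pdivrMr // mulrAC -mulrA.
apply: (le_trans (powR_invn_tangent m0 (ltW y0) x0)).
rewrite ler_pM2l ?powR_gt0 // -lerBrDl ler_piMl //.
  by rewrite subr_ge0 ler_pdivlMr // mul1r.
by rewrite invf_le1 ?ltr0n // ler1n.
Qed.

Lemma powR_invnD (m : nat) (x y : R) : (0 < m)%N -> 0 <= x -> 0 <= y ->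
  (x + y) `^ (m%:R^-1) <= x `^ (m%:R^-1) + y `^ (m%:R^-1).
Proof.
move=> m0 x0 y0.
have [->|xn] := eqVneq x 0; first by rewrite add0r lerDr powR_ge0.
have [->|yn] := eqVneq y 0; first by rewrite addr0 lerDl powR_ge0.
have xp : 0 < x by rewrite lt_neqAle eq_sym xn.
have yp : 0 < y by rewrite lt_neqAle eq_sym yn.
have hp : 0 < x + y by rewrite addr_gt0.
have h1 : (x + y) `^ m%:R^-1 / (x + y) * x <= x `^ m%:R^-1.
  by rewrite -ler_pdivlMr // powR_invn_div // lerDl.
have h2 : (x + y) `^ m%:R^-1 / (x + y) * y <= y `^ m%:R^-1.
  by rewrite -ler_pdivlMr // powR_invn_div // lerDr.
apply: le_trans (lerD h1 h2); rewrite -mulrDr divfK // gt_eqF //.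
Qed.


Lemma powR_prod (I : Type) (r : seq I) (P : pred I) (F : I -> R) (a : R) :
  (forall i, 0 <= F i) ->
  (\prod_(i <- r | P i) F i) `^ a = \prod_(i <- r | P i) F i `^ a.
Proof.
move=> F0; elim: r => [|i r IH]; first by rewrite !big_nil powR1.
by rewrite !big_cons; case: ifP => // _; rewrite powRM ?IH ?prodr_ge0.
Qed.

(* Generalized Hoelder, by AM-GM applied to the quotients U i x / S i. *)
Lemma sum_prod_powR (X : finType) (m : nat) (U : 'I_m -> X -> R) (S : 'I_m -> R) :
  (0 < m)%N -> (forall i x, 0 <= U i x) -> (forall i, 0 < S i) ->
  (forall i, \sum_x U i x <= S i) ->
  \sum_x \prod_i U i x `^ (m%:R^-1) <= \prod_i S i `^ (m%:R^-1).
Proof.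
move=> m0 U0 S0 US; have m0' : 0 < (m%:R : R) by rewrite ltr0n.
set K := \prod_i S i `^ _; have K0 : 0 < K by rewrite prodr_gt0 // => i _; rewrite powR_gt0.
apply: (@le_trans _ _ (\sum_x K * (m%:R^-1 * \sum_i U i x / S i))).
  apply: ler_sum => x _.
  have V0 i : 0 <= U i x / S i by rewrite divr_ge0 // ltW.
  have -> : \prod_i U i x `^ m%:R^-1 = K * (\prod_i (U i x / S i)) `^ m%:R^-1.
    rewrite powR_prod // /K -big_split /=; apply: eq_bigr => i _.
    by rewrite -powRM ?(ltW (S0 _)) // mulrC divfK // gt_eqF.
  rewrite ler_pM2l // -(@ler_pXn2r _ m) ?nnegrE ?powR_ge0 //; last first.
    by rewrite mulr_ge0 ?invr_ge0 ?sumr_ge0.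
  rewrite powR_invn_exp ?prodr_ge0 //.
  have := (leif_AGM (A := 'I_m) (E := fun i => U i x / S i) (fun i _ => V0 i)).1.
  by rewrite card_ord [X in X <= _ -> _](_ : _ = \prod_i (U i x / S i)) ?[_ / m%:R]mulrC //.
rewrite -mulr_sumr -mulr_sumr ler_piMr ?(ltW K0) // ler_pdivrMl // mulr1.
rewrite exchange_big /=; apply: (@le_trans _ _ (\sum_(i < m) 1)); last first.
  by rewrite sumr_const card_ord.
by apply: ler_sum => i _; rewrite -mulr_suml ler_pdivrMr // mul1r.
Qed.

End Powers.

(** * Averages over the classes of a labelling *)

Section Cavg.
Variables (X : finType) (K : eqType) (F : fieldType).
Implicit Types (c : X -> K) (f h : X -> F).

Definition csize c x : nat := #|[pred y | c y == c x]|.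
(** Conditional expectation of [f] given the label [c], for the counting measure. The values lie in
    a field because real and complex functions are both averaged. *)
Definition cavg c f x : F := (\sum_(y | c y == c x) f y) / (csize c x)%:R.

Lemma csize_gt0 c x : (0 < csize c x)%N.
Proof. by apply/card_gt0P; exists x; rewrite inE. Qed.
Lemma csize_cls c x y : c x = c y -> csize c x = csize c y.
Proof. by move=> h; apply: eq_card => z; rewrite !inE h. Qed.
Lemma cavg_cls c f x y : c x = c y -> cavg c f x = cavg c f y.
Proof. by move=> h; rewrite /cavg (csize_cls h) h. Qed.
Lemma eq_cavg c f h x : (forall y, c y = c x -> f y = h y) -> cavg c f x = cavg c h x.
Proof. by move=> fh; congr (_ / _); apply: eq_bigr => y /eqP; apply: fh. Qed.
Lemma cavgD c f h x : cavg c (fun y => f y + h y) x = cavg c f x + cavg c h x.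
Proof. by rewrite /cavg big_split mulrDl. Qed.
Lemma cavgN c f x : cavg c (fun y => - f y) x = - cavg c f x.
Proof. by rewrite /cavg sumrN mulNr. Qed.
Lemma cavgB c f h x : cavg c (fun y => f y - h y) x = cavg c f x - cavg c h x.
Proof. by rewrite cavgD cavgN. Qed.
Lemma cavg_pull c (u : X -> F) f x : (forall y, c y = c x -> u y = u x) ->
  cavg c (fun y => u y * f y) x = u x * cavg c f x.
Proof.
move=> hu; rewrite /cavg mulrA mulr_sumr; congr (_ / _).
by apply: eq_bigr => y /eqP /hu ->.
Qed.
Lemma cavgZ c a f x : cavg c (fun y => a * f y) x = a * cavg c f x.
Proof. exact: (@cavg_pull _ (fun=> a)). Qed.
Lemma cavg_sum (I : Type) (r : seq I) (P : pred I) c (f : I -> X -> F) x :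
  cavg c (fun y => \sum_(i <- r | P i) f i y) x = \sum_(i <- r | P i) cavg c (f i) x.
Proof. by rewrite /cavg exchange_big mulr_suml. Qed.

Hypothesis char0 : forall n : nat, (0 < n)%N -> n%:R != 0 :> F.

Lemma cavg_const c a x : cavg c (fun=> a) x = a.
Proof.
rewrite /cavg sumr_const -[a *+ _]mulr_natl mulrAC mulfV ?mul1r //.
by apply/char0/csize_gt0.
Qed.
(** Both sides sum f y * h x over the pairs in a common class, divided by the class size, which is
    symmetric in the pair. *)
Lemma cavg_adj c f h : \sum_x cavg c f x * h x = \sum_x f x * cavg c h x.
Proof.
rewrite (eq_bigr (fun x => \sum_y (if c y == c x then f y * h x / (csize c x)%:R else 0))).
  rewrite exchange_big /=; apply: eq_bigr => y _.
  rewrite /cavg mulrA mulr_sumr mulr_suml -big_mkcond /=.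
  rewrite (eq_bigl (fun x => c x == c y)); last by move=> x; rewrite eq_sym.
  by apply: eq_bigr => x /eqP /csize_cls ->.
move=> x _; rewrite /cavg -big_mkcond /= mulrAC mulr_suml mulr_suml.
by apply: eq_bigr => y _.
Qed.
Lemma sum_cavg c f : \sum_x cavg c f x = \sum_x f x.
Proof.
transitivity (\sum_x cavg c f x * 1); first by apply: eq_bigr => x _; rewrite mulr1.
rewrite (cavg_adj c f (fun=> 1)); apply: eq_bigr => x _.
by rewrite cavg_const mulr1.
Qed.
(** Adjointness moves the finer average onto the indicator of a coarser class, which it leaves
    unchanged. *)
Lemma cavg_tower c c' f x : (forall y z, c' y = c' z -> c y = c z) ->
  cavg c (cavg c' f) x = cavg c f x.
Proof.
move=> cc.
rewrite [in LHS]/cavg [in RHS]/cavg; congr (_ / _).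
rewrite [RHS]big_mkcond.
transitivity (\sum_y cavg c' f y * (c y == c x)%:R).
  by rewrite big_mkcond; apply: eq_bigr => y _; case: eqP => _; rewrite ?mulr1 ?mulr0.
rewrite cavg_adj; apply: eq_bigr => y _.
transitivity (f y * (c y == c x)%:R); last by case: eqP => _; rewrite ?mulr1 ?mulr0.
congr (_ * _); transitivity (cavg c' (fun=> (c y == c x)%:R) y); last exact: cavg_const.
by apply: eq_cavg => z /cc ->.
Qed.
Lemma cavg_id c f x : cavg c (fun y => cavg c f y) x = cavg c f x.
Proof. by apply: cavg_tower. Qed.
End Cavg.

Section CavgReal.
Variables (R : realType) (X : finType) (K : eqType).
Implicit Types (c : X -> K) (f h : X -> R).

Lemma char0R (n : nat) : (0 < n)%N -> n%:R != 0 :> R.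
Proof. by rewrite pnatr_eq0 lt0n. Qed.
Lemma ler_cavg c f h x : (forall y, c y = c x -> f y <= h y) -> cavg c f x <= cavg c h x.
Proof.
by move=> fh; rewrite ler_wpM2r ?invr_ge0 //; apply: ler_sum => y /eqP /fh.
Qed.
Lemma cavg_ge0 c f x : (forall y, 0 <= f y) -> 0 <= cavg c f x.
Proof. by move=> f0; rewrite divr_ge0 // sumr_ge0. Qed.
(** The gap between the two sides is a variance. *)
Lemma cavg_sqr c f x : cavg c f x ^+ 2 <= cavg c (fun y => f y ^+ 2) x.
Proof.
set a := cavg c f x.
have : 0 <= cavg c (fun y => (f y - a) ^+ 2) x by apply: cavg_ge0 => y; rewrite sqr_ge0.
have -> : cavg c (fun y => (f y - a) ^+ 2) x =
   cavg c (fun y => f y ^+ 2 + (- (2 * a) * f y + a ^+ 2)) x.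
  by apply: eq_cavg => y _; ring.
rewrite cavgD cavgD cavgZ cavg_const -/a; last exact: char0R.
suff -> : - (2 * a) * a + a ^+ 2 = - a ^+ 2 by rewrite subr_ge0.
by ring.
Qed.
End CavgReal.

(** * Martingale differences, maximal function and domination *)

Section Filtration.
Variables (R : realType) (X : finType) (K : eqType) (cls : nat -> X -> K).
Hypothesis nested : forall g x y, cls g.+1 x = cls g.+1 y -> cls g x = cls g y.
Implicit Types (f h : X -> R).
Let E g f := cavg (cls g) f.

Lemma nested_le g g' x y : (g <= g')%N -> cls g' x = cls g' y -> cls g x = cls g y.
Proof.
move/subnKC <-; elim: (g' - g)%N => [|k IH]; first by rewrite addn0.
by rewrite addnS => /nested /IH.
Qed.

(** Pythagoras: E g f is the orthogonal projection of E g.+1 f, so their inner product is the energy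
    of E g f. *)
Lemma martingale_diff_step g f :
  \sum_x (E g.+1 f x - E g f x) ^+ 2 =
  \sum_x (E g.+1 f x) ^+ 2 - \sum_x (E g f x) ^+ 2.
Proof.
have h : \sum_x E g.+1 f x * E g f x = \sum_x (E g f x) ^+ 2.
  rewrite /E cavg_adj ?(@char0R) //.
  transitivity (\sum_x f x * cavg (cls g) f x).
    apply: eq_bigr => x _; congr (_ * _).
    rewrite -[RHS](cavg_const (@char0R R) (cls g.+1) _ x).
    by apply: eq_cavg => y /nested hy; apply: cavg_cls.
  rewrite -cavg_adj.
  transitivity (\sum_x cavg (cls g) (cavg (cls g) f) x * f x).
    by apply: eq_bigr => x _; rewrite cavg_id //; apply: char0R.
  rewrite cavg_adj; apply: eq_bigr => x _; by rewrite expr2.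
rewrite -sumrB.
transitivity (\sum_x ((E g.+1 f x) ^+ 2 + (E g f x) ^+ 2 - 2 * (E g.+1 f x * E g f x))).
  by apply: eq_bigr => x _; ring.
rewrite !sumrB big_split /=.
rewrite (_ : \sum_i 2 * _ = 2 * \sum_x (E g.+1 f x * E g f x)) ?mulr_sumr // -mulr_sumr h; ring.
Qed.

Lemma martingale_diff_sum G f :
  \sum_(g < G) \sum_x (E g.+1 f x - E g f x) ^+ 2 <= \sum_x f x ^+ 2.
Proof.
rewrite (eq_bigr _ (fun (g : 'I_G) _ => martingale_diff_step g f)).
have := @telescope_sumr R 0 G (fun g => \sum_x (E g f x) ^+ 2) isT.
rewrite big_mkord => ->.
apply: (@le_trans _ _ (\sum_x E G f x ^+ 2)).
  by rewrite lerBlDr lerDl sumr_ge0 // => x _; rewrite sqr_ge0.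
rewrite -[leRHS](sum_cavg (@char0R R) (cls G)); apply: ler_sum => x _; exact: cavg_sqr.
Qed.

Lemma sum_cls_cavg g (u f : X -> R) : (forall x y, cls g x = cls g y -> u x = u y) ->
  \sum_x u x * E g f x = \sum_x u x * f x.
Proof.
move=> hu; transitivity (\sum_x E g f x * u x).
  by apply: eq_bigr => x _; rewrite mulrC.
rewrite cavg_adj; apply: eq_bigr => x _; rewrite mulrC; congr (_ * _).
rewrite -[RHS](cavg_const (@char0R R) (cls g) _ x).
by apply: eq_cavg => y; apply: hu.
Qed.

Fixpoint runmax (a : nat -> X -> R) g x :=
  if g is g'.+1 then Num.max (runmax a g' x) (a g x) else a 0%N x.

Lemma le_runmax a g g' x : (g' <= g)%N -> a g' x <= runmax a g x.
Proof.
elim: g => [|g IH]; first by rewrite leqn0 => /eqP ->.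
rewrite leq_eqVlt => /predU1P[->|h] /=; rewrite le_max ?lexx ?orbT //.
by rewrite IH.
Qed.
Lemma runmax_cls f g x y : cls g x = cls g y ->
  runmax (fun g => E g f) g x = runmax (fun g => E g f) g y.
Proof.
elim: g => [|g IH] h /=; first exact: cavg_cls.
by rewrite (IH (nested h)) /E (cavg_cls _ h).
Qed.
Lemma runmax_ge0 f g x : (forall x, 0 <= f x) -> 0 <= runmax (fun g => E g f) g x.
Proof. by move=> f0; apply: le_trans (le_runmax _ _ (leq0n g)); apply: cavg_ge0. Qed.

(** No stopping times: the increment of the running maximum M is constant on the classes of its
    generation, so pairing it with the average of f is pairing it with f. With the pointwise bound
    M_(g+1)^2 <= M_g^2 + 2 (M_(g+1) - M_g) E_(g+1) f, induction yields |M|^2 <= 2 <M, f>. *)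
Lemma doob_maximal G f : (forall x, 0 <= f x) ->
  \sum_x runmax (fun g => E g f) G x ^+ 2 <= 4 * \sum_x f x ^+ 2.
Proof.
move=> f0; set M := runmax _.
have key : \sum_x M G x ^+ 2 <= \sum_x 2 * (M G x * f x).
  rewrite -mulr_sumr; elim: G => [|G IH].
    have <- : \sum_x M 0%N x * E 0%N f x = \sum_x M 0%N x * f x.
      by apply: sum_cls_cavg => x y; apply: runmax_cls.
    rewrite mulr_sumr; apply: ler_sum => x _; rewrite -expr2 /M /=.
    by rewrite ler_peMl ?sqr_ge0 // ler1n.
  have h : \sum_x (M G.+1 x - M G x) * E G.+1 f x = \sum_x (M G.+1 x - M G x) * f x.
    apply: sum_cls_cavg => x y hxy; rewrite /M (runmax_cls _ hxy).
    by rewrite (runmax_cls _ (nested hxy)).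
  have -> : 2 * (\sum_x M G.+1 x * f x) =
    2 * (\sum_x M G x * f x) + 2 * \sum_x (M G.+1 x - M G x) * E G.+1 f x.
    by rewrite h -mulrDr -big_split; congr (_ * _); apply: eq_bigr => x _; rewrite -[RHS]mulrDl [M G x + _]addrC subrK.
  apply: le_trans (lerD IH (lexx _)).
  rewrite mulr_sumr -big_split; apply: ler_sum => x _ /=.
  have M0 : 0 <= M G x by apply: runmax_ge0.
  have a0 : 0 <= E G.+1 f x by apply: cavg_ge0.
  have -> : M G.+1 x = Num.max (M G x) (E G.+1 f x) by [].
  move: (M G x) (E G.+1 f x) M0 a0 => p a p0 a0.
  case: (leP p a) => pa; last by nra.
  by have := sqr_ge0 (a - p); nra.
(* The weights are chosen so that half of |M|^2 is absorbed on the left, which leaves the constant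
   4. *)
have h2 : \sum_x 2 * (M G x * f x) <= \sum_x (2 * f x ^+ 2 + 2^-1 * M G x ^+ 2).
  apply: ler_sum => x _; have := sqr_ge0 (2 * f x - M G x); nra.
move: (le_trans key h2); rewrite big_split /= -!mulr_sumr; lra.
Qed.

(* Summing W^p against the concave tangent at V replaces w_g by its average over
   cells on which the partial sum V_g is constant; no adaptedness of w is needed. *)
Lemma domination_powR (m G : nat) (v w : nat -> X -> R) : (0 < m)%N ->
  (forall g x y, cls g x = cls g y -> v g x = v g y) ->
  (forall g x, 0 < v g x) -> (forall g x, 0 <= w g x) ->
  (forall g x, (g < G)%N -> E g (w g) x <= v g x) ->
  \sum_x (\sum_(g < G) w g x) `^ (m%:R^-1) <=
  2 * \sum_x (\sum_(g < G) v g x) `^ (m%:R^-1).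
Proof.
move=> m0 vm v0 w0 hE; set p : R := m%:R^-1.
have p0 : 0 < p by rewrite invr_gt0 ltr0n.
pose V n x := \sum_(g < n) v g x.
have V0 n x : 0 < V n.+1 x.
  by rewrite /V big_ord_recr /= ltr_wpDl // sumr_ge0 // => i _; apply: ltW.
have Vge0 n x : 0 <= V n x by rewrite sumr_ge0 // => i _; apply: ltW.
have Vm g x y : cls g x = cls g y -> V g.+1 x = V g.+1 y.
  move=> h; apply: eq_bigr => i _; apply: vm; apply: nested_le h.
  by rewrite -ltnS.
(* Up to the factor p, the derivative of t^p at V n.+1. It is constant on the classes of generation
   n, so [w] can be averaged against it, and nonincreasing in n, so it dominates the slope at the
   final V. *)
pose phi n x := V n.+1 x `^ p / V n.+1 x.
have phi0 n x : 0 <= phi n x by rewrite divr_ge0 ?powR_ge0.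
have step g x : p * (phi g x * v g x) <= V g.+1 x `^ p - V g x `^ p.
  have := powR_invn_tangent m0 (Vge0 g x) (V0 g x); rewrite -/p.
  have -> : V g x / V g.+1 x - 1 = - v g x / V g.+1 x.
    rewrite -[X in _ - X](divff (x := V g.+1 x)) ?gt_eqF // -mulrBl.
    by congr (_ / _); rewrite /V big_ord_recr /=; ring.
  by rewrite /phi => h; rewrite lerBrDr -lerBrDl; apply: le_trans h _;
    rewrite le_eqVlt; apply/orP; left; apply/eqP; field; rewrite gt_eqF.
case: G hE => [|G] hE.
  rewrite big1 ?mulr_ge0 ?sumr_ge0 // => [x _|x _]; first by rewrite powR_ge0.
  by rewrite big_ord0 powR0 // gt_eqF.
have W0 x : 0 <= \sum_(g < G.+1) w g x by rewrite sumr_ge0.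
(* Tangent at the final V; its negative term is dropped, and this loss produces the factor 2 of the
   conclusion. *)
apply: (@le_trans _ _ (\sum_x (V G.+1 x `^ p + p * \sum_(g < G.+1) phi g x * w g x))).
  apply: ler_sum => x _; apply: (le_trans (powR_invn_tangent m0 (W0 x) (V0 G x))).
  rewrite -/p mulrDr mulr1 lerD2l mulrBr mulrBr lerBlDr.
  apply: ler_wpDr; first by rewrite mulr1 mulr_ge0 ?powR_ge0 // ltW.
  rewrite mulrCA ler_pM2l // mulr_suml mulr_sumr; apply: ler_sum => g _.
  rewrite mulrCA mulrC ler_wpM2r // ?powR_invn_div //.
  rewrite /V -!(big_mkord predT (fun g => v g x)).
  rewrite [leRHS](@big_cat_nat _ _ _ g.+1) //= lerDl sumr_ge0 // => i _; exact: ltW.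
rewrite big_split /= mulr_natl mulr2n lerD2l -mulr_sumr exchange_big /=.
apply: (@le_trans _ _ (p * \sum_(g < G.+1) \sum_x phi g x * v g x)).
  rewrite ler_pM2l //; apply: ler_sum => g _.
  rewrite -(sum_cls_cavg (g := g) (u := phi g) (w g)); last first.
    by move=> x y /Vm h; rewrite /phi h.
  by apply: ler_sum => x _; rewrite ler_wpM2l // hE.
rewrite exchange_big /= mulr_sumr; apply: ler_sum => x _.
rewrite mulr_sumr; apply: (@le_trans _ _ (\sum_(g < G.+1) (V g.+1 x `^ p - V g x `^ p))).
  by apply: ler_sum => g _; apply: step.
have := @telescope_sumr R 0 G.+1 (fun g => V g x `^ p) isT.
by rewrite big_mkord => ->; rewrite gerBl powR_ge0.
Qed.
End Filtration.

(** * Characters on the cells of a finite grid *)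

Section Cells.
Variables (R : realType) (d P : nat).
Local Notation C := R[i].
Local Notation X := {ffun 'I_d -> 'I_P}.

Definition cell (s : nat) (x : X) : {ffun 'I_d -> nat} := [ffun j => (x j %/ s)%N].
Definition phase (s : nat) (k : 'I_d -> R) (y : X) : R :=
  2 * pi * \sum_j k j * (y j)%:R / s%:R.

Lemma char0C (n : nat) : (0 < n)%N -> n%:R != 0 :> C.
Proof. by rewrite pnatr_eq0 lt0n. Qed.

Lemma cell_sum_prod (F : comNzSemiRingType) (s : nat) (phi : 'I_d -> nat -> F) x :
  (0 < s)%N -> (s %| P)%N ->
  \sum_(y | cell s y == cell s x) \prod_j phi j (y j) =
  \prod_j \sum_(r < s) phi j (x j %/ s * s + r)%N.
Proof.
move=> s0 sP.
have xP j : (x j %/ s < P %/ s)%N by rewrite ltn_divLR // divnK.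
transitivity (\prod_j \sum_(u < P | (u %/ s == x j %/ s)%N) phi j u).
  rewrite bigA_distr_big_dep; apply: eq_bigl => y; apply/eqP/familyP => [h j|h].
    by move/ffunP: h => /(_ j); rewrite !ffunE unfold_in => ->.
  by apply/ffunP => j; rewrite !ffunE; apply/eqP/h.
by apply: eq_bigr => j _; rewrite (@sum_ord_cell F P s).
Qed.

Lemma cell_csize (s : nat) x : (0 < s)%N -> (s %| P)%N ->
  (csize (cell s) x)%:R = (s%:R : C) ^+ d.
Proof.
move=> s0 sP; have := cell_sum_prod (F := R[i]) (fun _ _ => 1) x s0 sP.
under [X in _ = X -> _]eq_bigr do rewrite sumr_const card_ord.
rewrite [X in _ = X -> _]prodr_const card_ord => <-.
under [RHS]eq_bigr do rewrite big1_eq.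
by rewrite sumr_const.
Qed.

Lemma cell_avg_prod (s : nat) (phi : 'I_d -> nat -> C) x :
  (0 < s)%N -> (s %| P)%N ->
  cavg (cell s) (fun y : X => \prod_j phi j (y j)) x =
  \prod_j ((\sum_(r < s) phi j (x j %/ s * s + r)%N) / s%:R).
Proof.
move=> s0 sP; rewrite /cavg cell_csize // cell_sum_prod //.
by rewrite big_split /= prodr_const card_ord exprVn.
Qed.

(** The average factors over the coordinates into the sums of [dft1]; the offset of the cell drops
    out because it is a multiple of [s]. *)
Lemma cell_orth (s : nat) (a b : {ffun 'I_d -> nat}) x :
  (0 < s)%N -> (s %| P)%N -> (forall j, (a j < s)%N) -> (forall j, (b j < s)%N) ->
  cavg (cell s) (fun y : X => cis (phase s (fun j => (a j)%:R - (b j)%:R) y)) x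
   = (a == b)%:R.
Proof.
move=> s0 sP ha hb.
have sR : (s%:R : R) != 0 by rewrite pnatr_eq0 -lt0n.
pose phi j (u : nat) : C := cis (2 * pi * (((a j)%:R - (b j)%:R) * u%:R / s%:R)).
transitivity (cavg (cell s) (fun y : X => \prod_j phi j (y j)) x).
  by apply: eq_cavg => y _; rewrite /phi /phase mulr_sumr cis_sum.
rewrite cell_avg_prod //.
have h j : (\sum_(r < s) phi j (x j %/ s * s + r)%N) / s%:R = (a j == b j)%:R.
  have -> : \sum_(r < s) phi j (x j %/ s * s + r)%N =
     \sum_(r < s) cis (2 * pi * (((a j)%:R - (b j)%:R) * r%:R / s%:R) : R).
    apply: eq_bigr => r _; rewrite /phi; set q := (x j %/ s)%N.
    have -> : 2 * pi * (((a j)%:R - (b j)%:R) * (q * s + r)%:R / s%:R) =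
      2 * pi * (a j * q)%:R + (- (2 * pi * (b j * q)%:R) +
       2 * pi * (((a j)%:R - (b j)%:R) * r%:R / s%:R)) :> R.
      by rewrite natrD !natrM; field.
    by rewrite !cisD -conjc_cis !cis2pi_nat conjc1 !mul1r.
  by rewrite dft1 //; case: eqP => _; rewrite ?mul0r // mulfV // char0C.
under eq_bigr do rewrite h.
have [->|ab] := eqVneq a b; first by rewrite big1 // => j _; rewrite eqxx.
have [j hj] : exists j, a j != b j.
  apply/existsP; apply: contraNT ab; rewrite negb_exists => /forallP ab.
  by apply/eqP/ffunP => j; apply/eqP; have := ab j; rewrite negbK.
by rewrite (bigD1 j) //= (negPf hj) mul0r.
Qed.

Lemma cavg_real (K : eqType) (c : X -> K) (f : X -> R) x :
  ((cavg c f x)%:C)%C = cavg c (fun y => (f y)%:C%C) x.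
Proof. by rewrite /cavg fmorph_div rmorph_sum rmorph_nat. Qed.
Lemma Re_cavg (K : eqType) (c : X -> K) (f : X -> C) x :
  complex.Re (cavg c f x) = cavg c (fun y => complex.Re (f y)) x.
Proof.
rewrite /cavg; have -> : ((csize c x)%:R : C)^-1 = (((csize c x)%:R^-1 : R)%:C)%C.
  by rewrite fmorphV rmorph_nat.
by rewrite cReM /= mulr0 subr0 Re_sum.
Qed.
Lemma Im_cavg (K : eqType) (c : X -> K) (f : X -> C) x :
  complex.Im (cavg c f x) = cavg c (fun y => complex.Im (f y)) x.
Proof.
rewrite /cavg; have -> : ((csize c x)%:R : C)^-1 = (((csize c x)%:R^-1 : R)%:C)%C.
  by rewrite fmorphV rmorph_nat.
by rewrite cImM /= mulr0 add0r Im_sum.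
Qed.
Lemma nsq_cavg (K : eqType) (c : X -> K) (f : X -> C) x :
  nsq (cavg c f x) <= cavg c (fun y => nsq (f y)) x.
Proof.
rewrite /nsq Re_cavg Im_cavg.
apply: le_trans (lerD (cavg_sqr _ _ _) (cavg_sqr _ _ _)) _.
by rewrite -cavgD.
Qed.

(* Orthogonality of characters on a cell followed by a Schur test on the fibres of [eta]. *)
Lemma cell_L2 (I : finType) (eta : I -> {ffun 'I_d -> nat}) (k : I -> 'I_d -> R)
  (c : 'I_d -> R) (s : nat) (B : I -> C) (beta om : I -> R) (S : R) x :
  (0 < s)%N -> (s %| P)%N -> (forall i j, (eta i j < s)%N) ->
  (forall i j, k i j = (eta i j)%:R - c j) ->
  (forall i, cabs (B i) <= beta i * om i) -> (forall i, 0 <= om i) ->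
  (forall v, \sum_(i | eta i == v) om i ^+ 2 <= S) ->
  cavg (cell s) (fun y : X => nsq (\sum_i B i * cis (phase s (k i) y))) x <=
   S * \sum_i beta i ^+ 2.
Proof.
move=> s0 sP etas kE hB om0 hS.
have -> : cavg (cell s) (fun y : X => nsq (\sum_i B i * cis (phase s (k i) y))) x =
    \sum_i \sum_(i' | eta i' == eta i) complex.Re (B i * conjc (B i')).
  apply: complexI; rewrite cavg_real.
  transitivity (cavg (cell s) (fun y : X => \sum_i \sum_i' (B i * conjc (B i')) *
      cis (phase s (fun j => (eta i j)%:R - (eta i' j)%:R) y)) x).
    apply: eq_cavg => y _; rewrite nsqE rmorph_sum /= mulr_suml.
    apply: eq_bigr => i _; rewrite mulr_sumr; apply: eq_bigr => i' _.
    rewrite conjcM mulrACA; congr (_ * _).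
    rewrite conjc_cis -cisD; congr cis; rewrite /phase -mulrN -mulrDr; congr (_ * _).
    by rewrite -sumrN -big_split; apply: eq_bigr => j _ /=; rewrite !kE; ring.
  rewrite cavg_sum.
  have -> : \sum_i cavg (cell s) (fun y : X => \sum_i' (B i * conjc (B i')) *
      cis (phase s (fun j => (eta i j)%:R - (eta i' j)%:R) y)) x =
      \sum_i \sum_(i' | eta i' == eta i) B i * conjc (B i').
    apply: eq_bigr => i _; rewrite cavg_sum [RHS]big_mkcond; apply: eq_bigr => i' _.
    rewrite cavgZ cell_orth // eq_sym; case: eqP => _; by rewrite ?mulr1 ?mulr0.
  (* The double sum is Hermitian, hence equal to its conjugate; this is why its imaginary part
     vanishes. *)
  have sym : \sum_i \sum_(i' | eta i' == eta i) B i * conjc (B i') =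
     conjc (\sum_i \sum_(i' | eta i' == eta i) B i * conjc (B i')).
    rewrite rmorph_sum /=.
    rewrite (eq_bigr (fun i => \sum_i' if eta i' == eta i then B i * conjc (B i') else 0));
      last by move=> i _; rewrite -big_mkcond.
    rewrite exchange_big /=; apply: eq_bigr => i _; rewrite rmorph_sum -big_mkcond /=.
    rewrite (eq_bigl (fun i' => eta i' == eta i)); last by move=> i'; rewrite eq_sym.
    by apply: eq_bigr => i' _; rewrite conjcM conjcK mulrC.
  apply: complex_ext => /=.
    by rewrite Re_sum; apply: eq_bigr => i _; rewrite Re_sum.
  by move: sym; case: (\sum_i _) => a b [] /= /eqP; rewrite -addr_eq0 -mulr2n mulrn_eq0 => /eqP.
have b0 i : 0 <= beta i ^+ 2 by rewrite sqr_ge0.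
(* Crossed AM-GM: 2 |B_i| |B_i'| <= (beta_i om_i')^2 + (beta_i' om_i)^2, so that each beta_i meets
   the sum of om^2 over its own fibre. *)
pose T := \sum_i \sum_(i' | eta i' == eta i) (beta i * om i') ^+ 2.
have TE : T = \sum_i \sum_(i' | eta i' == eta i) (beta i' * om i) ^+ 2.
  rewrite /T (eq_bigr (fun i => \sum_i' if eta i' == eta i then (beta i * om i') ^+ 2 else 0));
    last by move=> i _; rewrite -big_mkcond.
  rewrite exchange_big /=; apply: eq_bigr => i _; rewrite -big_mkcond /=.
  by apply: eq_bigl => i'; rewrite eq_sym.
apply: (@le_trans _ _ T).
  suff h : 2 * (\sum_i \sum_(i' | eta i' == eta i) complex.Re (B i * conjc (B i'))) <= T + T.
    by lra.
  rewrite {2}TE /T -big_split mulr_sumr.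
  apply: ler_sum => i _ /=; rewrite -big_split mulr_sumr; apply: ler_sum => i' _ /=.
  have h1 : complex.Re (B i * conjc (B i')) <= cabs (B i) * cabs (B i').
    apply: le_trans (ler_norm _) _; apply: le_trans (cabs_Re _) _.
    by rewrite cabsM ler_wpM2l ?cabs_ge0 // /cabs /=; case: (B i') => p q /=; rewrite sqrrN.
  have h2 : cabs (B i) * cabs (B i') <= (beta i * om i) * (beta i' * om i').
    by apply: ler_pM; rewrite ?cabs_ge0.
  have := sqr_ge0 (beta i * om i' - beta i' * om i); nra.
rewrite /T mulr_sumr; apply: ler_sum => i _.
under eq_bigr do rewrite exprMn.
by rewrite -mulr_sumr mulrC ler_wpM2r.
Qed.
End Cells.

(** * Fourier coefficients on a cell *)

Section Bessel.
Variables (R : realType) (d P N s : nat).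
Local Notation C := R[i].
Local Notation X := {ffun 'I_d -> 'I_P}.
Local Notation freq := {ffun 'I_d -> 'I_(N.*2.+1)}.
Hypotheses (s0 : (0 < s)%N) (sP : (s %| P)%N) (Ns : (N.*2 < s)%N).

Definition em (n : freq) (y : X) : C := cis (phase s (fun j => - zf R N (n j)) y).
Definition wt (n : freq) : nat := (\sum_j zab N (n j)).+1.
Definition coef (f : X -> C) (n : freq) (x : X) : C :=
  cavg (cell s) (fun y => f y * em n y) x.

(** With g the partial Fourier sum, sum |b|^2 = <f, g> <= (|f|^2 + |g|^2) / 2, and |g|^2 <= sum
    |b|^2 because [N.*2 < s] keeps the frequencies distinct modulo [s]. *)
Lemma cell_bessel (f : X -> C) x :
  \sum_n nsq (coef f n x) <= cavg (cell s) (fun y => nsq (f y)) x.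
Proof.
pose b n := coef f n x.
pose g (y : X) := \sum_n b n * cis (phase s (fun j => zf R N (n j)) y).
have hg : cavg (cell s) (fun y => nsq (g y)) x <= \sum_n nsq (b n).
  have -> : \sum_n nsq (b n) = 1 * \sum_n cabs (b n) ^+ 2.
    by rewrite mul1r; apply: eq_bigr => n _; rewrite sqr_cabs.
  apply: (@cell_L2 R d P _ (fun n : freq => [ffun j => n j : nat])
    (fun n j => zf R N (n j)) (fun=> N%:R) s b (fun n => cabs (b n)) (fun=> 1) 1 x s0 sP) =>
    // [i j|i j|i|v]; rewrite ?ffunE ?mulr1 //.
    by apply: leq_trans Ns; rewrite ltn_ord.
  rewrite (eq_bigr (fun=> 1)); last by move=> i _; rewrite expr1n.
  have [i0 hi0|h] := pickP (fun i : freq => [ffun j => i j : nat] == v); last first.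
    by rewrite big_pred0 ?ler01.
  rewrite (big_pred1 i0) // => i /=; rewrite -(eqP hi0).
  apply/eqP/eqP => [/ffunP h|->//]; apply/ffunP => j; apply/val_inj.
  by have := h j; rewrite !ffunE.
have e : (\sum_n nsq (b n))%:C%C = cavg (cell s) (fun y => f y * conjc (g y)) x.
  rewrite rmorph_sum /=; under eq_bigr do rewrite nsqE {1}/b /coef mulrC -cavgZ.
  rewrite -cavg_sum; apply: eq_cavg => y _.
  rewrite /g rmorph_sum mulr_sumr; apply: eq_bigr => n _.
  transitivity (f y * (conjc (b n) * cis (- phase s (fun j => zf R N (n j)) y))).
    rewrite mulrCA; congr (_ * (_ * cis _)).
    by rewrite /phase -mulrN -sumrN; congr (_ * _); apply: eq_bigr => j _; rewrite !mulNr.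
  by congr (_ * _); rewrite -conjc_cis; symmetry; apply: conjcM.
move/(congr1 (@complex.Re R)): e; rewrite Re_cavg [LHS]/= => hb.
have h2 : cavg (cell s) (fun y => complex.Re (f y * conjc (g y))) x <=
   cavg (cell s) (fun y => 2^-1 * nsq (f y) + 2^-1 * nsq (g y)) x.
  apply: ler_cavg => y _; rewrite /nsq cReM.
  case: (f y) (g y) => p q [u v] /=.
  have := sqr_ge0 (p - u); have := sqr_ge0 (q - v); lra.
rewrite cavgD !cavgZ -hb in h2.
by move: h2 hg; rewrite /b; lra.
Qed.

Lemma wt_gt0 n : 0 < ((wt n)%:R : R). Proof. by rewrite ltr0n. Qed.

Lemma norm_phase (n : freq) (K : R) (z : 'I_d -> R) :
  (forall j, `|z j| <= K) -> 0 <= K ->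
  `| \sum_j (- zf R N (n j)) * z j | <= (wt n)%:R * K.
Proof.
move=> zK K0; apply: le_trans (ler_norm_sum _ _ _) _.
apply: (@le_trans _ _ (\sum_j (zab N (n j))%:R * K)).
  by apply: ler_sum => j _; rewrite normrM normrN zabE ler_wpM2l.
by rewrite -mulr_suml -natr_sum ler_wpM2r // ler_nat.
Qed.

(** A function with mean zero on the cells of side s' does not see a multiplier that is constant on
    them. [u] freezes the character at the lower corner of each such cell, at distance at most 2 pi
    wt(n) s'/s from [em n]. *)
Lemma coef_gain (s' : nat) (h : X -> C) n x : (0 < s')%N -> (s' %| s)%N ->
  (forall y, cavg (cell s') h y = 0) ->
  nsq (coef h n x) <= (2 * pi * (wt n)%:R * (s'%:R / s%:R)) ^+ 2 *
     cavg (cell s) (fun y => nsq (h y)) x.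
Proof.
move=> s'0 s's h0.
have sR : 0 < (s%:R : R) by rewrite ltr0n.
pose u (y : X) : C := cis (2 * pi * \sum_j (- zf R N (n j)) * ((y j %/ s') * s')%:R / s%:R).
have refine (y z : X) : cell s' y = cell s' z -> cell s y = cell s z.
  move/ffunP => yz; apply/ffunP => j; have := yz j; rewrite !ffunE => yzj.
  by rewrite -(divnK s's) mulnC !divnMA yzj.
have hu : cavg (cell s) (fun y => h y * u y) x = 0.
  rewrite -(cavg_tower (@char0C R) _ _ refine).
  transitivity (cavg (cell s) (fun _ : X => 0 : C) x); last exact/cavg_const/char0C.
  apply: eq_cavg => y _; transitivity (cavg (cell s') (fun y => u y * h y) y).
    by apply: eq_cavg => z _; rewrite mulrC.
  rewrite cavg_pull ?h0 ?mulr0 // => z /ffunP zy; congr cis; congr (_ * _).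
  by apply: eq_bigr => j _; have := zy j; rewrite !ffunE => ->.
have -> : coef h n x = cavg (cell s) (fun y => h y * (em n y - u y)) x.
  rewrite -[LHS]subr0 -hu /coef -cavgB; apply: eq_cavg => y _; by rewrite mulrBr.
apply: le_trans (nsq_cavg _ _ _) _; rewrite -cavgZ; apply: ler_cavg => y _.
rewrite nsqM mulrC ler_wpM2r ?nsq_ge0 //.
have K0 : 0 <= 2 * pi * (wt n)%:R * (s'%:R / s%:R) :> R.
  by rewrite !mulr_ge0 ?invr_ge0 ?pi_ge0.
rewrite -sqr_cabs ler_pXn2r ?nnegrE ?cabs_ge0 //.
set a := 2 * pi * \sum_j (- zf R N (n j)) * ((y j %/ s') * s')%:R / s%:R.
have -> : em n y - u y = cis a * (cis (phase s (fun j => - zf R N (n j)) y - a) - 1).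
  by rewrite mulrBr -cisD mulr1 [a + _]addrC subrK.
rewrite cabsM cabs_cis mul1r; apply: le_trans (cis_sub1 _) _.
rewrite /phase /a -mulrBr normrM ger0_norm ?mulr_ge0 ?pi_ge0 // -mulrA.
rewrite ler_wpM2l ?mulr_ge0 ?pi_ge0 // -sumrB.
under eq_bigr do rewrite -!mulrA -mulrBr.
apply: norm_phase; last by rewrite divr_ge0.
move=> j.
rewrite -mulrBl normrM [`|_^-1|]ger0_norm ?invr_ge0 ?ler0n // ler_wpM2r ?invr_ge0 //.
rewrite {1}(divn_eq (y j) s') natrD addrC addKr ger0_norm // ler_nat ltnW // ltn_mod //.
Qed.

Lemma coef_em0 (n : freq) x : n != [ffun=> inord N] -> cavg (cell s) (em n) x = 0.
Proof.
move=> n0.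
have := @cell_orth R d P s [ffun=> N] [ffun j => n j : nat] x s0 sP.
have -> : ([ffun=> N] == [ffun j => n j : nat] :> {ffun 'I_d -> nat}) = false.
  apply/negP => /eqP/ffunP h; move/negP: n0; apply; apply/eqP/ffunP => j.
  by apply/val_inj; have := h j; rewrite !ffunE /= inordK // -addnn; lia.
move=> H; rewrite -[RHS]H => [|j|j]; rewrite ?ffunE.
- apply: eq_cavg => y _; congr cis; congr (_ * _); apply: eq_bigr => j _.
  by rewrite !ffunE /zf opprB.
- by move: Ns; rewrite -addnn; lia.
- by apply: leq_trans Ns; rewrite ltn_ord.
Qed.
End Bessel.

(** * Summable weights and the gain for functions of mean zero *)

Section WeightedBessel.
Variables (R : realType) (d : nat).

Lemma prod_le_wt N (n : {ffun 'I_d -> 'I_(N.*2.+1)}) (a : R) : 0 <= a ->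
  (wt n)%:R `^ (- (d%:R * a)) <= \prod_j (1 + (zab N (n j))%:R) `^ (- a).
Proof.
move=> a0; have -> : (wt n)%:R `^ (- (d%:R * a)) = \prod_(j < d) (wt n)%:R `^ (- a) :> R.
  by rewrite prodr_const card_ord -powR_mulrn ?powR_ge0 // -powRrM -mulNr mulrC mulrN mulNr.
apply: ler_prod => j _; rewrite powR_ge0 /=.
have w0 : 0 < ((wt n)%:R : R) by rewrite ltr0n.
have z0 : 0 < 1 + (zab N (n j))%:R :> R by rewrite ltr_pwDl.
rewrite !powRN lef_pV2 ?posrE ?powR_gt0 //.
rewrite ge0_ler_powR // ?nnegrE ?addr_ge0 //.
by rewrite -natr1 addrC lerD2r ler_nat (bigD1 j) //= leq_addr.
Qed.

(** As wt(n) dominates every 1 + |n_j|, its power -a is at most a product of d one-dimensional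
    weights of exponent a/d > 1. *)
Lemma sum_wt_bound (a : R) : d%:R < a -> (0 < d)%N -> exists S : R, 0 < S /\
  forall N, \sum_(n : {ffun 'I_d -> 'I_(N.*2.+1)}) (wt n)%:R `^ (- a) <= S.
Proof.
move=> da d0; have d0' : 0 < (d%:R : R) by rewrite ltr0n.
have a1 : 1 < a / d%:R by rewrite ltr_pdivlMr // mul1r.
have [S [S0 hS]] := sum1d_bound a1; exists (S ^+ d); split; first by rewrite exprn_gt0.
move=> N; apply: (@le_trans _ _ (\prod_(j < d) \sum_(u < N.*2.+1) (1 + (zab N u)%:R) `^ (- (a / d%:R)))).
  rewrite bigA_distr_bigA /=; apply: ler_sum => n _.
  have -> : - a = - (d%:R * (a / d%:R)) by rewrite mulrCA mulfV ?mulr1 ?gt_eqF.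
  by apply: prod_le_wt; rewrite ltW // (lt_trans _ a1).
rewrite -[X in S ^+ X](card_ord d) -prodr_const; apply: ler_prod => j _.
by rewrite hS andbT sumr_ge0 // => u _; rewrite powR_ge0.
Qed.

(* Frequencies below (s/s')^k are damped by the mean-zero gain, the others by the weight. *)
Lemma weighted_gain (e : R) : 0 < e -> e <= 1 -> (0 < d)%N ->
  exists g C : R, [/\ 0 < g, 0 < C & forall (P N s s' : nat) (h : {ffun 'I_d -> 'I_P} -> R[i]) x,
   (0 < s)%N -> (s %| P)%N -> (N.*2 < s)%N -> (0 < s')%N -> (s' %| s)%N ->
   (forall y, cavg (cell s') h y = 0) ->
   \sum_(n : {ffun 'I_d -> 'I_(N.*2.+1)}) nsq (coef s h n x) * (wt n)%:R `^ (- e) <=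
   C * (s'%:R / s%:R) `^ g * cavg (cell s) (fun y => nsq (h y)) x].
Proof.
move=> e0 e1 d0.
(* In the exponent [q], 2 compensates the factor wt^2 of [coef_gain] and 2d leaves a convergent sum
   over the frequencies. *)
pose q : R := 2 + 2 * d%:R.
have q0 : 0 < q by rewrite /q ltr_wpDr // mulr_ge0.
have [S [S0 hS]] : exists S : R, 0 < S /\ forall N, 
   \sum_(n : {ffun 'I_d -> 'I_(N.*2.+1)}) (wt n)%:R `^ (- (2 * d%:R)) <= S.
  by apply: sum_wt_bound => //; rewrite ltr_pMl ?ltr0n // ltr1n.
pose g := e / q; have g0 : 0 < g by rewrite divr_gt0.
have p0 := @pi_gt0 R.
exists g, (1 + (2 * pi) ^+ 2 * S); split => //.
  by rewrite ltr_wpDr // mulr_ge0 ?sqr_ge0 ?ltW.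
move=> P N s s' h x s0 sP Ns s'0 s's h0.
set A := cavg (cell s) _ x; have A0 : 0 <= A by apply: cavg_ge0 => y; rewrite nsq_ge0.
set rho : R := s'%:R / s%:R.
have rho0 : 0 < rho by rewrite divr_gt0 ?ltr0n.
have rho1 : rho <= 1 by rewrite ler_pdivrMr ?ltr0n // mul1r ler_nat dvdn_leq.
pose th := rho `^ (- q^-1); have th0 : 0 < th by rewrite powR_gt0.
(* Two cases at th = rho^(-1/q). Above it, w^(-e) is at most th^(-e) = rho^g; below it, rho * w^q <=
   1, so the second term alone is at least 1. *)
have wtb (w : R) : 1 <= w -> w `^ (- e) <= rho `^ g + rho^-1 * w `^ (- q).
  move=> w1; have w0 : 0 < w by lra.
  have [tw|wth] := leP th w.
    apply: ler_wpDr; first by rewrite mulr_ge0 ?powR_ge0 // invr_ge0 ltW.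
    have -> : rho `^ g = th `^ (- e) by rewrite /th -powRrM /g; congr (_ `^ _); field; rewrite gt_eqF.
    rewrite !powRN lef_pV2 ?posrE ?powR_gt0 //.
    by rewrite ge0_ler_powR ?nnegrE // ltW.
  apply: ler_wpDl; first by rewrite powR_ge0.
  apply: (@le_trans _ _ 1).
    by rewrite -(powRr0 w) ler_powR // oppr_le0 ltW.
  have wq0 := powR_gt0 q w0; have rw0 : 0 < rho * w `^ q by exact: mulr_gt0.
  rewrite powRN -invfM invf_ge1 //.
  have : w `^ q <= th `^ q by apply: ge0_ler_powR; rewrite ?nnegrE ltW.
  rewrite /th -powRrM mulNr mulVf ?(gt_eqF q0) // powR_inv1 ?(ltW rho0) // => hw.
  by rewrite -ler_pdivlMl // mulr1.
apply: (@le_trans _ _ (\sum_(n : {ffun 'I_d -> 'I_(N.*2.+1)})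
   (rho `^ g * nsq (coef s h n x) + (2 * pi) ^+ 2 * rho * A * (wt n)%:R `^ (- (2 * d%:R))))).
  apply: ler_sum => n _; have w0 : 0 < ((wt n)%:R : R) by exact: wt_gt0.
  have w1 : 1 <= ((wt n)%:R : R) by rewrite ler1n.
  apply: le_trans (ler_wpM2l (nsq_ge0 _) (wtb _ w1)) _.
  rewrite mulrDr [X in X + _]mulrC lerD2l.
  have hg := coef_gain s0 n x s'0 s's h0; rewrite -/A -/rho in hg.
  have hq : 0 <= rho^-1 * (wt n)%:R `^ (- q) by rewrite mulr_ge0 ?powR_ge0 // invr_ge0 ltW.
  apply: le_trans (ler_wpM2r hq hg) _.
  have -> : (wt n)%:R `^ (- q) = (wt n)%:R `^ (- (2 * d%:R)) / (wt n)%:R ^+ 2 :> R.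
    rewrite /q opprD addrC powRD ?(gt_eqF w0) ?implybT //; congr (_ * _).
    by rewrite powRN powR_mulrn // ltW.
  by rewrite le_eqVlt; apply/orP; left; apply/eqP; field; rewrite !gt_eqF.
have -> : (1 + (2 * pi) ^+ 2 * S) * rho `^ g * A =
   rho `^ g * A + (2 * pi) ^+ 2 * S * rho `^ g * A by ring.
rewrite big_split /= -mulr_sumr -mulr_sumr lerD //.
  by rewrite ler_wpM2l ?powR_ge0 // cell_bessel.
have hr : rho <= rho `^ g.
  rewrite -{1}(powRr1 (ltW rho0)) ger_powR ?rho0 ?rho1 //.
  rewrite /g ler_pdivrMr // mul1r; apply: le_trans e1 _; have := ler0n R d; rewrite /q; lra.
have -> : (2 * pi) ^+ 2 * S * rho `^ g * A = (2 * pi) ^+ 2 * A * (S * rho `^ g) by ring.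
have -> : (2 * pi) ^+ 2 * rho * A = (2 * pi) ^+ 2 * A * rho by ring.
rewrite -[leLHS]mulrA; apply: ler_wpM2l; first by rewrite mulr_ge0 ?sqr_ge0.
rewrite mulrC; apply: ler_pM; rewrite ?(ltW rho0) ?hS //.
by rewrite sumr_ge0 // => n _; rewrite powR_ge0.
Qed.
End WeightedBessel.

(** * The square function over generations *)

Section SquareFunction.
Variable R : realType.

Lemma cauchy_schwarz (I : finType) (P : pred I) (a b : I -> R) :
  (\sum_(i | P i) a i * b i) ^+ 2 <=
  (\sum_(i | P i) a i ^+ 2) * (\sum_(i | P i) b i ^+ 2).
Proof.
set A := \sum_(i | P i) a i ^+ 2; set B := \sum_(i | P i) b i ^+ 2.
set c := \sum_(i | P i) _.
have A0 : 0 <= A by rewrite sumr_ge0 // => i _; rewrite sqr_ge0.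
have h : 0 <= \sum_(i | P i) (A * b i - c * a i) ^+ 2.
  by rewrite sumr_ge0 // => i _; rewrite sqr_ge0.
have e : \sum_(i | P i) (A * b i - c * a i) ^+ 2 = A * (A * B - c ^+ 2).
  transitivity (A ^+ 2 * B - 2 * A * c * c + c ^+ 2 * A); last by ring.
  rewrite (eq_bigr (fun i => A ^+ 2 * b i ^+ 2 - 2 * A * c * (a i * b i) + c ^+ 2 * a i ^+ 2)).
    by rewrite big_split sumrB /= -!mulr_sumr.
  by move=> i _; ring.
have [A1|A1] := eqVneq A 0.
  suff -> : c = 0 by rewrite expr0n /= A1 mul0r.
  apply: big1 => i Pi; suff -> : a i = 0 by rewrite mul0r.
  have := psumr_eq0P (P := P) (F := fun i => a i ^+ 2) (fun i _ => sqr_ge0 _) A1 Pi.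
  by move/eqP; rewrite sqrf_eq0 => /eqP.
by move: h; rewrite e pmulr_rge0 ?subr_ge0 // lt_neqAle eq_sym A1.
Qed.

Lemma nsq_sum_weight (I : finType) (P : pred I) (z : I -> R[i]) (rho : I -> R) :
  (forall i, 0 < rho i) ->
  nsq (\sum_(i | P i) z i) <=
  (\sum_(i | P i) rho i) * (\sum_(i | P i) nsq (z i) / rho i).
Proof.
move=> r0; have sr i : 0 < Num.sqrt (rho i) by rewrite sqrtr_gt0.
apply: (@le_trans _ _ ((\sum_(i | P i) Num.sqrt (rho i) * (cabs (z i) / Num.sqrt (rho i))) ^+ 2)).
  rewrite -sqr_cabs ler_pXn2r ?nnegrE ?cabs_ge0 ?sumr_ge0 //; last first.
    by move=> i _; rewrite mulr_ge0 ?divr_ge0 ?cabs_ge0 // ltW.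
  apply: le_trans (cabs_sum _ _ _) _; apply: ler_sum => i _.
  by rewrite mulrCA mulfV ?mulr1 // gt_eqF.
apply: le_trans (cauchy_schwarz _ _ _) _.
rewrite le_eqVlt; apply/orP; left; apply/eqP; congr (_ * _); apply: eq_bigr => i _.
  by rewrite sqr_sqrtr // ltW.
by rewrite exprMn exprVn sqr_cabs sqr_sqrtr // ltW.
Qed.

Lemma geom_sum (r : R) n : 0 <= r -> r < 1 -> \sum_(j < n) r ^+ j <= (1 - r)^-1.
Proof.
move=> r0 r1; have h : 0 < 1 - r by rewrite subr_gt0.
rewrite -[leRHS]mul1r ler_pdivlMr // mulrC.
have -> : (1 - r) * (\sum_(j < n) r ^+ j) = 1 - r ^+ n.
  by rewrite -opprB mulNr -subrX1 opprB.
by rewrite gerBl exprn_ge0.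
Qed.
Lemma sum_ord_ge (V : nmodType) (F : nat -> V) g n : (g <= n)%N ->
  \sum_(j < n | (g <= j)%N) F j = \sum_(g <= j < n) F j.
Proof.
move=> gn; rewrite -(big_mkord (fun j => (g <= j)%N) F).
rewrite (@big_cat_nat _ _ _ g) //= big_nat_cond big_pred0 ?add0r; last by move=> j; apply/negP; lia.
rewrite big_nat_cond [RHS]big_nat_cond; apply: eq_bigl => j.
by apply/idP/idP; lia.
Qed.
Lemma geom_sum_ge (r : R) n g : 0 <= r -> r < 1 -> (g <= n)%N ->
  \sum_(j < n | (g <= j)%N) r ^+ (j - g) <= (1 - r)^-1.
Proof.
move=> r0 r1 gn; apply: le_trans (geom_sum (n - g) r0 r1).
rewrite (sum_ord_ge (fun j => r ^+ (j - g))) // -{1}(add0n g) big_addn big_mkord.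
by under eq_bigr do rewrite addnK.
Qed.
Lemma geom_sum_le (r : R) n j : 0 <= r -> r < 1 ->
  \sum_(g < n | (g <= j)%N) r ^+ (j - g) <= (1 - r)^-1.
Proof.
move=> r0 r1; apply: le_trans (geom_sum j.+1 r0 r1).
rewrite -(big_mkord (fun g => (g <= j)%N) (fun g => r ^+ (j - g))).
rewrite -(big_mkord predT (fun j => r ^+ j)).
apply: (@le_trans _ _ (\sum_(0 <= g < j.+1 | (g <= j)%N) r ^+ (j - g))).
  case: (leqP n j.+1) => nj.
    rewrite [leRHS](@big_cat_nat _ _ _ n) //= lerDl sumr_ge0 // => i _; exact: exprn_ge0.
  rewrite (@big_cat_nat _ _ _ j.+1) ?(ltnW nj) //=.
  rewrite [X in _ + X]big_nat_cond [X in _ + X]big_pred0 ?addr0 //.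
  by move=> g; apply/negP; lia.
rewrite big_nat_rev /= add0n big_nat_cond [leRHS]big_nat_cond.
rewrite le_eqVlt; apply/orP; left; apply/eqP; apply: eq_big => [g|g h].
  by apply/idP/idP; lia.
by congr (_ ^+ _); lia.
Qed.

Lemma cell_refine d P s s' (y z : {ffun 'I_d -> 'I_P}) : (s' %| s)%N ->
  cell s' y = cell s' z -> cell s y = cell s z.
Proof.
move=> s's /ffunP yz; apply/ffunP => j; have := yz j; rewrite !ffunE => yzj.
by rewrite -(divnK s's) mulnC !divnMA yzj.
Qed.
Lemma cavg_cell1 d P (f : {ffun 'I_d -> 'I_P} -> R[i]) x : cavg (cell 1) f x = f x.
Proof.
rewrite -[RHS](cavg_const (@char0C R) (cell 1) (f x) x); apply: eq_cavg => y /ffunP yx.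
congr f; apply/ffunP => j; apply/val_inj; have := yx j; by rewrite !ffunE !divn1.
Qed.

(** At generation g only the differences D j with j >= g are seen by the nonzero frequencies, and D
    j, of mean zero on the cells of generation j, gains a power of s_j / s_g <= 2^(-(j-g)). The
    double sum is then geometric, and the energies of the D j add up to at most that of f. [G0] is
    the generation of single points, [G] bounds those whose coefficients are taken. *)
Lemma square_function (d : nat) (e : R) : 0 < e -> e <= 1 -> (0 < d)%N ->
  exists C : R, 0 < C /\ forall (P N G G0 : nat) (s : nat -> nat)
    (f : {ffun 'I_d -> 'I_P} -> R[i]),
   (G <= G0)%N -> (forall g, 0 < s g)%N -> (forall g, s g %| P)%N ->
   (forall g, s g.+1 %| s g)%N -> (forall g, (g < G0)%N -> (s g.+1).*2 <= s g)%N ->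
   s G0 = 1%N -> (forall g, (g < G)%N -> (N.*2 < s g)%N) ->
   \sum_(g < G) \sum_x \sum_(n : {ffun 'I_d -> 'I_(N.*2.+1)} | n != [ffun=> inord N])
      nsq (coef (s g) f n x) * (wt n)%:R `^ (- e) <= C * \sum_x nsq (f x).
Proof.
move=> e0 e1 d0; have [gm [C [gm0 C0 hgain]]] := @weighted_gain R d e e0 e1 d0.
(* Half of the gain 2^(-gm) per generation is spent on the Cauchy-Schwarz weights r^(j-g); the other
   half makes the sum over g converge. *)
pose r : R := 2^-1 `^ (gm / 2).
have r0 : 0 < r by rewrite powR_gt0.
have r1 : r < 1.
  have h1 : (2^-1 : R) < 1 by rewrite invf_lt1 // ltr1n.
  have g2 : 0 < gm / 2 by rewrite divr_gt0.
  have := @gt0_ltr_powR R (gm / 2) g2 2^-1 1; rewrite powR1 !nnegrE => H; exact: H.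
have K0 : 0 < (1 - r)^-1 by rewrite invr_gt0 subr_gt0.
exists ((1 - r)^-1 * C * (1 - r)^-1); split; first by rewrite !mulr_gt0.
move=> P N G G0 s f GG0 s0 sP sd s2 sG0 Ns.
pose E j := cavg (cell (s j)) f.
pose D j y := E j.+1 y - E j y.
have nest g (x y : {ffun 'I_d -> 'I_P}) : cell (s g.+1) x = cell (s g.+1) y -> cell (s g) x = cell (s g) y.
  exact: cell_refine.
have sdd g j : (g <= j)%N -> (s j %| s g)%N.
  by move/subnKC <-; elim: (j - g)%N => [|k IH]; rewrite ?addn0 // addnS (dvdn_trans (sd _)).
have sratio g j : (g <= j)%N -> (j <= G0)%N -> (s j)%:R / (s g)%:R <= (2^-1 : R) ^+ (j - g).
  move=> gj jG; rewrite ler_pdivrMr ?ltr0n //.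
  move: jG; rewrite -(subnKC gj) addKn; elim: (j - g)%N => [|k IH] jG; first by rewrite addn0 mul1r.
  rewrite addnS exprS -mulrA; have := IH _; rewrite addnS in jG; rewrite ltnW // => /(_ isT) h.
  have h2 : ((s (g + k).+1).*2%:R <= (s (g + k))%:R :> R) by rewrite ler_nat s2.
  by rewrite -muln2 natrM in h2; lra.
have Dm j y : (j < G0)%N -> cavg (cell (s j)) (D j) y = 0.
  move=> jG; rewrite /D cavgB /E.
  have -> := cavg_tower (@char0C R) f y (nest j).
  by have -> := cavg_id (@char0C R) (cell (s j)) f y; rewrite subrr.
pose A j := \sum_x nsq (D j x).
have hA : \sum_(j < G0) A j <= \sum_x nsq (f x).
  have hp (h : {ffun 'I_d -> 'I_P} -> R) := martingale_diff_sum nest G0 h.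
  have := lerD (hp (fun x => complex.Re (f x))) (hp (fun x => complex.Im (f x))).
  rewrite -[X in _ <= X -> _]big_split; apply: le_trans.
  rewrite le_eqVlt; apply/orP; left; apply/eqP; rewrite -big_split; apply: eq_bigr => j _.
  rewrite /A -[RHS]big_split; apply: eq_bigr => x _; rewrite /nsq /D /E /=.
  by rewrite !cReB !cImB !Re_cavg !Im_cavg.
(* As s G0 = 1, f is its own average of generation G0 and telescopes down to E g f, which is
   constant on the cell and so has no nonzero frequency. *)
have split_f g (n : {ffun 'I_d -> 'I_(N.*2.+1)}) x : (g < G)%N -> n != [ffun=> inord N] ->
    coef (s g) f n x = \sum_(j < G0 | (g <= j)%N) coef (s g) (D j) n x.
  move=> gG n0.
  transitivity (cavg (cell (s g)) (fun y => \sum_(j < G0 | (g <= j)%N) D j y * em R (s g) n y +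
      E g y * em R (s g) n y) x).
    apply: eq_cavg => y _; rewrite -mulr_suml -mulrDl; congr (_ * _).
    have gG0 : (g <= G0)%N by apply: leq_trans (ltnW gG) GG0.
    rewrite (sum_ord_ge (fun j => D j y)) // /D.
    rewrite (telescope_sumr (fun j => E j y) gG0) subrK /E sG0.
    by rewrite cavg_cell1.
  rewrite cavgD cavg_sum (cavg_pull (u := E g)); last by move=> y; apply: cavg_cls.
  by rewrite coef_em0 ?Ns ?mulr0 ?addr0.
have point g x : (g < G)%N ->
   \sum_(n : {ffun 'I_d -> 'I_(N.*2.+1)} | n != [ffun=> inord N])
      nsq (coef (s g) f n x) * (wt n)%:R `^ (- e) <=
   (1 - r)^-1 * C * \sum_(j < G0 | (g <= j)%N) r ^+ (j - g) * cavg (cell (s g)) (fun y => nsq (D j y)) x.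
  move=> gG; have gG0 : (g <= G0)%N by apply: leq_trans (ltnW gG) GG0.
  apply: (@le_trans _ _ (\sum_(n : {ffun 'I_d -> 'I_(N.*2.+1)} | n != [ffun=> inord N])
    (1 - r)^-1 * \sum_(j < G0 | (g <= j)%N) nsq (coef (s g) (D j) n x) / r ^+ (j - g) * (wt n)%:R `^ (- e))).
    apply: ler_sum => n n0; rewrite -mulr_suml mulrA ler_wpM2r ?powR_ge0 // split_f //.
    apply: le_trans (nsq_sum_weight _ _ (rho := fun j : 'I_G0 => r ^+ (j - g)) _) _.
      by move=> j; rewrite exprn_gt0.
    apply: ler_wpM2r; last exact: geom_sum_ge (ltW r0) r1 gG0.
    by rewrite sumr_ge0 // => j _; rewrite divr_ge0 ?nsq_ge0 // exprn_ge0 // ltW.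
  rewrite -mulr_sumr -mulrA ler_pM2l // exchange_big /= mulr_sumr; apply: ler_sum => j gj.
  apply: (@le_trans _ _ ((r ^+ (j - g))^-1 * (C * ((s j)%:R / (s g)%:R) `^ gm *
      cavg (cell (s g)) (fun y => nsq (D j y)) x))).
    have jG := ltn_ord j.
    have := hgain P N (s g) (s j) (D j) x (s0 g) (sP g) (Ns g gG) (s0 j) (sdd _ _ gj) (fun y => Dm j y jG).
    move=> h; rewrite -(ler_pM2l (x := (r ^+ (j - g))^-1)) ?invr_gt0 ?exprn_gt0 // in h.
    apply: le_trans h; rewrite mulr_sumr [leRHS](bigID (fun n => n != [ffun=> inord N])) /=.
    apply: ler_wpDr.
      by rewrite sumr_ge0 // => n _; rewrite !mulr_ge0 ?invr_ge0 ?exprn_ge0 ?powR_ge0 ?nsq_ge0 // ltW.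
    by apply: ler_sum => n _; rewrite mulrA [_^-1 * _]mulrC.
  have : 0 <= cavg (cell (s g)) (fun y => nsq (D j y)) x.
    by apply: cavg_ge0 => y; apply: nsq_ge0.
  move: (cavg (cell (s g)) (fun y => nsq (D j y)) x) => a a0.
  rewrite !mulrA; apply: ler_wpM2r => //.
  rewrite [_^-1 * C]mulrC -mulrA ler_pM2l // ler_pdivrMl ?exprn_gt0 // -exprD addnn -mul2n exprM.
  have -> : r ^+ 2 = 2^-1 `^ gm.
    by rewrite -powR_mulrn ?powR_ge0 // /r -powRrM divfK.
  have -> : (2^-1 `^ gm) ^+ (j - g) = (2^-1 ^+ (j - g)) `^ gm :> R.
    by rewrite -powR_mulrn ?powR_ge0 // -powRrM mulrC powRrM powR_mulrn ?invr_ge0.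
  apply: ge0_ler_powR; rewrite ?nnegrE ?exprn_ge0 ?invr_ge0 ?divr_ge0 ?(ltW gm0) //.
  by apply: sratio => //; apply: ltnW.
apply: (@le_trans _ _ (\sum_(g < G) \sum_x (1 - r)^-1 * C * \sum_(j < G0 | (g <= j)%N) r ^+ (j - g) * cavg (cell (s g)) (fun y => nsq (D j y)) x)).
  by apply: ler_sum => g _; apply: ler_sum => x _; apply: point.
have -> : \sum_(g < G) \sum_x (1 - r)^-1 * C * \sum_(j < G0 | (g <= j)%N) r ^+ (j - g) * cavg (cell (s g)) (fun y => nsq (D j y)) x =
  (1 - r)^-1 * C * \sum_(j < G0) (\sum_(g < G | (g <= j)%N) r ^+ (j - g)) * A j.
  rewrite -[RHS]/(_ * _) [in RHS]mulr_sumr.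
  transitivity (\sum_(g < G) \sum_(j < G0 | (g <= j)%N) (1 - r)^-1 * C * (r ^+ (j - g) * A j)).
    apply: eq_bigr => g _; under eq_bigr do rewrite mulr_sumr.
    rewrite exchange_big /=; apply: eq_bigr => j _.
    by rewrite -mulr_sumr -mulr_sumr sum_cavg // => n; apply: char0R.
  rewrite (eq_bigr (fun g : 'I_G => \sum_(j < G0) if (g <= j)%N then (1 - r)^-1 * C * (r ^+ (j - g) * A j) else 0)).
    rewrite exchange_big /=; apply: eq_bigr => j _; rewrite -big_mkcond /=.
    by rewrite -mulr_sumr -mulr_suml.
  by move=> g _; rewrite -big_mkcond.
rewrite -!mulrA ler_pM2l // ler_pM2l //.
apply: (@le_trans _ _ (\sum_(j < G0) (1 - r)^-1 * A j)); last first.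
  by rewrite -mulr_sumr ler_pM2l.
apply: ler_sum => j _; rewrite ler_wpM2r ?geom_sum_le ?(ltW r0) //.
by rewrite sumr_ge0 // => x _; rewrite nsq_ge0.
Qed.
End SquareFunction.

(** * Tuples of frequencies and the fibres of their sum *)

Section MultiFrequencies.
Variables (R : realType).

Definition Wt (m d N : nat) (n : {ffun 'I_m -> {ffun 'I_d -> 'I_(N.*2.+1)}}) : nat :=
  (\sum_i \sum_j zab N (n i j)).+1.

Lemma wt_le_Wt m d N (n : {ffun 'I_m -> {ffun 'I_d -> 'I_(N.*2.+1)}}) i :
  (wt (n i) <= Wt n)%N.
Proof. by rewrite ltnS (bigD1 i) //= leq_addr. Qed.

Lemma sum_Wt_bound (q d : nat) (a : R) : (0 < q)%N -> (0 < d)%N -> (q * d)%:R < a ->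
  exists S : R, 0 < S /\ forall N,
  \sum_(n : {ffun 'I_q -> {ffun 'I_d -> 'I_(N.*2.+1)}}) (Wt n)%:R `^ (- a) <= S.
Proof.
move=> q0 d0 qda; have q0' : 0 < (q%:R : R) by rewrite ltr0n.
have aq : d%:R < a / q%:R by rewrite ltr_pdivlMr // mulrC -natrM.
have [S [S0 hS]] := sum_wt_bound aq d0; exists (S ^+ q); split; first by rewrite exprn_gt0.
move=> N; apply: (@le_trans _ _ (\prod_(i < q) \sum_(u : {ffun 'I_d -> 'I_(N.*2.+1)})
   (wt u)%:R `^ (- (a / q%:R)))).
  rewrite bigA_distr_bigA /=; apply: ler_sum => n _.
  have -> : (Wt n)%:R `^ (- a) = \prod_(i < q) (Wt n)%:R `^ (- (a / q%:R)) :> R.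
    rewrite prodr_const card_ord -powR_mulrn ?powR_ge0 // -powRrM.
    by congr (_ `^ _); field; rewrite gt_eqF.
  apply: ler_prod => i _; rewrite powR_ge0 /=.
  rewrite !powRN lef_pV2 ?posrE ?powR_gt0 ?ltr0n //.
  apply: ge0_ler_powR; rewrite ?nnegrE ?ler0n ?ler_nat ?wt_le_Wt //.
  by rewrite (le_trans _ (ltW aq)).
rewrite -[X in S ^+ X](card_ord q) -prodr_const; apply: ler_prod => i _.
by rewrite hS andbT sumr_ge0 // => u _; rewrite powR_ge0.
Qed.

(** Sum of the indices rather than of the frequencies: the two differ by the constant m N, and the
    indices are natural numbers that can be kept below the cell side, as [cell_L2] requires. *)
Definition fsum m d N (n : {ffun 'I_m -> {ffun 'I_d -> 'I_(N.*2.+1)}}) : {ffun 'I_d -> nat} :=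
  [ffun j => (\sum_i n i j)%N].

(* On a fibre of [fsum] the first frequency is determined by the others. *)
Lemma fiber_bound (q d : nat) (a : R) : (0 < q)%N -> (0 < d)%N -> (q * d)%:R < a ->
  exists S : R, 0 < S /\ forall N v,
  \sum_(n : {ffun 'I_q.+1 -> {ffun 'I_d -> 'I_(N.*2.+1)}} | fsum n == v)
    (Wt n)%:R `^ (- a) <= S.
Proof.
move=> q0 d0 qda; have [S [S0 hS]] := sum_Wt_bound q0 d0 qda; exists S; split => // N v.
have a0 : 0 <= a by rewrite (le_trans _ (ltW qda)).
pose rest (n : {ffun 'I_q.+1 -> {ffun 'I_d -> 'I_(N.*2.+1)}}) :=
  [ffun i : 'I_q => n (lift ord0 i)].
apply: (@le_trans _ _ (\sum_(n | fsum n == v) (Wt (rest n))%:R `^ (- a))).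
  apply: ler_sum => n _; rewrite !powRN lef_pV2 ?posrE ?powR_gt0 ?ltr0n //.
  apply: ge0_ler_powR; rewrite ?nnegrE ?ler0n // ler_nat ltnS big_ord_recl.
  apply: leq_trans (leq_addl _ _); rewrite leq_eqVlt; apply/orP; left; apply/eqP.
  by apply: eq_bigr => i _; rewrite ffunE.
apply: le_trans (hS N).
rewrite -(big_imset (h := rest) (fun n' => (Wt n')%:R `^ (- a))) /=.
  rewrite big_mkcond; apply: ler_sum => n' _; case: ifP => // _; exact: powR_ge0.
move=> n n' hn hn' /ffunP hr.
have {hn hn'} e : fsum n = fsum n' by rewrite (eqP (hn : fsum n == v)) (eqP (hn' : fsum n' == v)).
have hl i : n (lift ord0 i) = n' (lift ord0 i) by have := hr i; rewrite !ffunE.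
apply/ffunP => i; case: (unliftP ord0 i) => [k ->|->]; first exact: hl.
apply/ffunP => j; apply/val_inj; move/ffunP: e => /(_ j).
rewrite !ffunE !big_ord_recl /=; under [in X in _ = (_ + X)%N -> _]eq_bigr do rewrite -hl.
by move/addIn.
Qed.
End MultiFrequencies.

(** * Recovering a value from nearby times *)

Section NearReproducing.
Variable R : realType.

Lemma sum_stride (F : nat -> R) (k n : nat) : (0 < k)%N -> (forall u, 0 <= F u) ->
  \sum_(r < n) F (k * r)%N <= \sum_(u < k * n) F u.
Proof.
move=> k0 F0; elim: n => [|n IH]; first by rewrite muln0 !big_ord0.
rewrite big_ord_recr /=.
rewrite -(big_mkord predT F) (@big_cat_nat _ _ _ (k * n)%N) //=; last by rewrite leq_mul2l leqnSn orbT.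
rewrite big_mkord lerD // mulnS addnC big_ltn; last by rewrite -addn1 leq_add2l.
by rewrite lerDl sumr_ge0.
Qed.

(* The identity 1 = (1 - (1 - z)^K) + (1 - z)^K with z close to 1 recovers H(a) from
   its values at the shifted times a + k r, and r can be averaged over [r0, 2 r0). *)
Lemma near_reproducing (K : nat) : exists D : R, 0 < D /\
  forall (H : nat -> R[i]) (a r0 : nat) (err : R), (0 < r0)%N -> 0 <= err ->
  (forall r, (r <= r0.*2)%N ->
     cabs (\sum_(k < K.+1) (-1) ^+ k * ('C(K, k))%:R * H (a + k * r)%N) <= err) ->
  nsq (H a) <= D * (r0%:R^-1 * \sum_(u < K * r0.*2) nsq (H (a + u)%N) + err ^+ 2).
Proof.
pose c : R := \sum_(k < K) ('C(K, k.+1))%:R ^+ 2.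
have c0 : 0 <= c by rewrite sumr_ge0 // => k _; rewrite sqr_ge0.
pose D : R := (2 * c * K%:R + 2); exists D; split.
  by rewrite /D ltr_wpDl // !mulr_ge0.
move=> H a r0 err r00 err0 hH.
have r0R : 0 < (r0%:R : R) by rewrite ltr0n.
have one r : (r <= r0.*2)%N ->
   nsq (H a) <= 2 * c * (\sum_(k < K) nsq (H (a + k.+1 * r)%N)) + 2 * err ^+ 2.
  (* The term k = 0 is H a itself; the other terms are estimated by Cauchy-Schwarz. *)
  move=> /hH; rewrite big_ord_recl /= expr0 mul1r bin0 mul1r mul0n addn0.
  set T := \sum_(_ < _) _ => hT.
  have -> : H a = - T + (H a + T) by ring.
  apply: le_trans (nsqD_le _ _) _; rewrite -mulrA lerD // ler_pM2l ?ltr0n //; last first.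
    by rewrite -sqr_cabs ler_pXn2r ?nnegrE ?cabs_ge0.
  rewrite nsqN; apply: (@le_trans _ _ ((\sum_(k < K) ('C(K, k.+1))%:R * cabs (H (a + k.+1 * r)%N)) ^+ 2)).
    rewrite -sqr_cabs ler_pXn2r ?nnegrE ?cabs_ge0 ?sumr_ge0 //; last first.
      by move=> k _; rewrite mulr_ge0 ?cabs_ge0.
    apply: le_trans (cabs_sum _ _ _) _; apply: ler_sum => k _.
    rewrite !cabsM cabsX cabsN cabs1 expr1n mul1r ler_wpM2r ?cabs_ge0 //.
    by rewrite -(rmorph_nat (real_complex R)) cabs_real ger0_norm.
  apply: le_trans (cauchy_schwarz _ _ _) _.
  by under [X in _ * X <= _]eq_bigr do rewrite sqr_cabs.
have avg : r0%:R * nsq (H a) <= \sum_(r < r0) (2 * c * (\sum_(k < K) nsq (H (a + k.+1 * r)%N)) + 2 * err ^+ 2).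
  rewrite mulr_natl -[X in _ *+ X](card_ord r0) -sumr_const; apply: ler_sum => r _.
  by apply: one; rewrite (leq_trans (ltnW (ltn_ord r))) // -addnn leq_addr.
rewrite -(ler_pM2l r0R); apply: le_trans avg _.
rewrite big_split /= -mulr_sumr sumr_const card_ord -[_ *+ r0]mulr_natl.
pose T := \sum_(u < K * r0.*2) nsq (H (a + u)%N); rewrite -/T.
(* For fixed k the offsets k.+1 * r are distinct, so the sum over r is part of the sum over all
   offsets. *)
have hT : \sum_(r < r0) \sum_(k < K) nsq (H (a + k.+1 * r)%N) <= K%:R * T.
  rewrite exchange_big /= mulr_natl -[X in _ *+ X](card_ord K) -sumr_const.
  apply: ler_sum => k _.
  apply: (le_trans (sum_stride (F := fun u => nsq (H (a + u)%N)) _ _ _)) => // [u|].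
    exact: nsq_ge0.
  rewrite /T -!(big_mkord predT (fun u => nsq (H (a + u)%N))).
  rewrite [leRHS](@big_cat_nat _ _ _ (k.+1 * r0)%N) //=.
    by rewrite lerDl sumr_ge0 // => u _; rewrite nsq_ge0.
  by apply: leq_mul; rewrite ?ltn_ord // -addnn leq_addr.
have T0 : 0 <= T by rewrite sumr_ge0 // => u _; rewrite nsq_ge0.
have -> : r0%:R * (D * (r0%:R^-1 * T + err ^+ 2)) = D * (T + r0%:R * err ^+ 2).
  by field; rewrite gt_eqF.
have h1 := ler_wpM2l (mulr_ge0 (ler0n R 2) c0) hT.
have h2 : 0 <= r0%:R * err ^+ 2 by rewrite mulr_ge0 ?sqr_ge0.
have h4 := mulr_ge0 (mulr_ge0 c0 (ler0n R K)) h2.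
rewrite /D; lra.
Qed.
End NearReproducing.

(** * The supremum over times on one cell, by dyadic frequency blocks *)

Section LocalMaximal.
Variable R : realType.

Lemma nat_between (x : R) : 1 <= x -> exists n : nat, x <= n%:R <= 2 * x.
Proof.
move=> x1; exists (Num.truncn x).+1.
have x0 : 0 <= x by lra.
by have /andP[h1 h2] := truncn_itv x0; rewrite ltW //= -natr1; lra.
Qed.

Lemma pow2_powR_lt1 (dl : R) : 0 < dl -> (2 : R) `^ (- dl) < 1.
Proof.
move=> dl0; rewrite powRN invf_lt1 ?powR_gt0 //.
have := @gt0_ltr_powR R dl dl0 1 2; rewrite powR1 !nnegrE => H; apply: H => //.
by rewrite ltr1n.
Qed.
Lemma pow2_powR_geom (dl : R) n : 0 < dl ->
  \sum_(l < n) (2 ^ l)%:R `^ (- dl) <= (1 - 2 `^ (- dl))^-1.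
Proof.
move=> dl0; apply: le_trans (geom_sum n (powR_ge0 2 (- dl)) (pow2_powR_lt1 dl0)).
apply: ler_sum => l _; rewrite natrX -(powR_mulrn l (ler0n R 2)).
by rewrite -(powR_mulrn l (powR_ge0 2 _)) -!powRrM [l%:R * _]mulrC lexx.
Qed.
End LocalMaximal.

Section Blocks.
Variables (R : realType) (q d N M P side K : nat) (s A0 A1 th kap dl S S' md D : R).
Local Notation Mf := {ffun 'I_q.+1 -> {ffun 'I_d -> 'I_(N.*2.+1)}}.
Local Notation X := {ffun 'I_d -> 'I_P}.
Variables (sh : R -> Mf -> R[i]) (x : X) (a : X -> nat) (B : Mf -> R[i]) (beta : Mf -> R).
Hypotheses (A00 : 0 <= A0) (A10 : 0 <= A1) (th0 : 0 < th) (S0 : 0 < S) (S'0 : 0 < S').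
Hypotheses (thE : 2 * s - 1 - (q * d)%:R = 4 * th) (kapE : kap = th / 2) (dlE : dl = th / 2).
Hypothesis mdE : md = (q.+1 * d)%:R.
Hypothesis hS : forall v, \sum_(n : Mf | fsum n == v)
    (Wt n)%:R `^ (- ((q * d)%:R + 2 * th)) <= S.
Hypothesis hS' : \sum_(n : Mf) (Wt n)%:R `^ (- (2 * md)) <= S'.
Hypothesis hK : dl + 2 * kap + 2 * md <= 2 * K%:R * dl.
Hypothesis D0 : 0 < D.
Hypothesis hD : forall (H : nat -> R[i]) (a r0 : nat) (err : R), (0 < r0)%N -> 0 <= err ->
  (forall r, (r <= r0.*2)%N ->
     cabs (\sum_(k < K.+1) (-1) ^+ k * ('C(K, k))%:R * H (a + k * r)%N) <= err) ->
  nsq (H a) <= D * (r0%:R^-1 * \sum_(u < K * r0.*2) nsq (H (a + u)%N) + err ^+ 2).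
Let Wmax := \max_(n : Mf) Wt n.
Hypothesis MR : Wmax%:R `^ (1 + dl) <= M%:R.
Hypotheses (side0 : (0 < side)%N) (sideP : (side %| P)%N) (Nside : (q.+1 * N.*2 < side)%N).
Hypothesis h1 : forall u n, 24^-1 <= u -> cabs (sh u n) <= A0 * (Wt n)%:R `^ (- s).
Hypothesis h2 : forall u r n, 0 <= r ->
     cabs (\sum_(k < K.+1) (-1) ^+ k * ('C(K, k))%:R * sh (u + k%:R * r) n) <=
     A1 * (2 * pi * r * (Wt n)%:R) ^+ K.
Hypotheses (aM : forall y, (M <= 24 * a y)%N) (aM' : forall y, (a y <= M)%N).
Hypotheses (beta0 : forall n, 0 <= beta n).
Hypothesis hB : forall n, cabs (B n) <= beta n * (Wt n)%:R `^ kap.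

Let p0 := @pi_gt0 R.
Let Y l : R := (2 ^ l)%:R.
Let Y1 l : 1 <= Y l. Proof. by rewrite ler1n expn_gt0. Qed.
Let Y0 l : 0 < Y l. Proof. by rewrite (lt_le_trans _ (Y1 l)). Qed.
Let blk (n : Mf) := trunc_log 2 (Wt n).
Let blkl (n : Mf) : Y (blk n) <= (Wt n)%:R. Proof. by rewrite ler_nat trunc_logP. Qed.
Let blku (n : Mf) : (Wt n)%:R <= 2 * Y (blk n).
Proof. by rewrite -natrM ler_nat -expnS ltnW // trunc_log_ltn. Qed.
Let L := (trunc_log 2 Wmax).+1.
Let WWmax (n : Mf) : (Wt n <= Wmax)%N. Proof. exact: leq_bigmax. Qed.
Let blkL (n : Mf) : (blk n < L)%N. Proof. by rewrite ltnS leq_trunc_log. Qed.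
Let Wmax0 : (0 < Wmax)%N.
Proof. by apply: leq_trans (WWmax [ffun=> [ffun=> ord0]]). Qed.
Let dl0 : 0 < dl. Proof. by rewrite dlE divr_gt0. Qed.
Let YM l : (l < L)%N -> Y l `^ (1 + dl) <= M%:R.
Proof.
move=> lL; apply: le_trans MR; apply: ge0_ler_powR; rewrite ?nnegrE ?ler0n //.
  by rewrite addr_ge0 // ltW.
rewrite ler_nat; apply: leq_trans (trunc_logP (p := 2) isT Wmax0).
by rewrite leq_pexp2l.
Qed.
Let Wpos (n : Mf) : (0 : R) < (Wt n)%:R. Proof. by rewrite ltr0n. Qed.
Let ph (n : Mf) (y : X) : R[i] := cis (phase side (fun j => \sum_i zf R N (n i j)) y).
Let H l w y := \sum_(n | blk n == l) B n * sh (w%:R / M%:R) n * ph n y.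
Let b2 l := \sum_(n | blk n == l) beta n ^+ 2.
Let b20 l : 0 <= b2 l. Proof. by rewrite sumr_ge0 // => n _; rewrite sqr_ge0. Qed.
Let Mpos : 0 < (M%:R : R).
Proof. by apply: lt_le_trans MR; rewrite powR_gt0 // ltr0n. Qed.
Let MN0 : (0 < M)%N. Proof. by rewrite -(ltr0n R). Qed.

(** One block at one time, the same for all y. Here om = A0 Wt^(kap - s), and [thE] splits its
    square into Y^(-(1+th)) and a weight that is summable on the fibres. *)
Let fixed l w : (M <= 24 * w)%N ->
   cavg (cell side) (fun y => nsq (H l w y)) x <= A0 ^+ 2 * Y l `^ (- (1 + th)) * S * b2 l.
Proof.
move=> Mw.
pose B' (n : Mf) := if blk n == l then B n * sh (w%:R / M%:R) n else 0.
pose bt (n : Mf) := if blk n == l then beta n else 0.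
pose om (n : Mf) := if blk n == l then A0 * (Wt n)%:R `^ (kap - s) else 0.
have -> : b2 l = \sum_n bt n ^+ 2.
  rewrite /b2 big_mkcond; apply: eq_bigr => n _; rewrite /bt.
  by case: ifP; rewrite ?expr0n.
have -> : cavg (cell side) (fun y => nsq (H l w y)) x =
   cavg (cell side) (fun y => nsq (\sum_n B' n * cis (phase side (fun j => \sum_i zf R N (n i j)) y))) x.
  apply: eq_cavg => y _; congr nsq; rewrite /H big_mkcond; apply: eq_bigr => n _.
  by rewrite /B'; case: ifP => // _; rewrite mul0r.
apply: (@cell_L2 R d P _ (@fsum q.+1 d N) _ (fun=> (q.+1 * N)%:R) _ _ bt om) => //.
- move=> n j; rewrite ffunE; apply: leq_ltn_trans Nside.
  rewrite -[X in (_ <= X * _)%N]card_ord -sum_nat_const; apply: leq_sum => i _.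
  by rewrite -ltnS.
- move=> n j; rewrite ffunE natr_sum /zf sumrB; congr (_ - _).
  by rewrite sumr_const card_ord natrM mulr_natl.
- move=> n; rewrite /B' /bt /om; case: ifP => _; last by rewrite cabs0 mul0r.
  have hu : (24 : R)^-1 <= w%:R / M%:R.
    by rewrite ler_pdivlMr // mulrC ler_pdivrMr // mulrC -natrM ler_nat.
  have hp := ler_pM (cabs_ge0 _) (cabs_ge0 _) (hB n) (h1 n hu).
  rewrite cabsM; apply: le_trans hp _.
  by rewrite powRD ?(gt_eqF (Wpos n)) ?implybT // le_eqVlt; apply/orP; left; apply/eqP; ring.
- by move=> n; rewrite /om; case: ifP => // _; rewrite mulr_ge0 ?powR_ge0.
- move=> v; apply: (@le_trans _ _ (\sum_(n | fsum n == v) A0 ^+ 2 * Y l `^ (- (1 + th)) *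
    (Wt n)%:R `^ (- ((q * d)%:R + 2 * th)))); last first.
    rewrite -mulr_sumr; apply: ler_wpM2l; last exact: hS.
    by rewrite mulr_ge0 ?sqr_ge0 ?powR_ge0.
  apply: ler_sum => n _; rewrite /om; case: ifP => [/eqP hl|_]; last first.
    by rewrite expr0n !mulr_ge0 ?sqr_ge0 ?powR_ge0.
  rewrite exprMn -mulrA ler_wpM2l ?sqr_ge0 //.
  rewrite -powR_mulrn ?powR_ge0 // -powRrM.
  have -> : (kap - s) * 2 = - (1 + th) + - ((q * d)%:R + 2 * th).
    by rewrite kapE; move: thE; lra.
  rewrite powRD ?(gt_eqF (Wpos n)) ?implybT // ler_wpM2r ?powR_ge0 //.
  rewrite !powRN lef_pV2 ?posrE ?powR_gt0 // -hl //.
  by apply: ge0_ler_powR; rewrite ?nnegrE ?ler0n // addr_ge0 // ltW.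
Qed.

Let EE : R := A1 ^+ 2 * (16 * pi) ^+ (2 * K) * 2 `^ (2 * kap + 2 * md) * S'.
Let EE0 : 0 <= EE.
Proof.
have h16 : 0 <= 16 * pi :> R by rewrite mulr_ge0 ?ltW.
by rewrite /EE !mulr_ge0 ?sqr_ge0 ?exprn_ge0 ?powR_ge0 ?(ltW S'0).
Qed.
(** Bound for the K-th time difference of block l: time steps up to 4 Y^(-(1+dl)) and frequencies up
    to 2Y give 2 pi * 4 * 2 = 16 pi times Y^(-dl), to the power K. *)
Let err l := A1 * (16 * pi * Y l `^ (- dl)) ^+ K * \sum_(n | blk n == l) cabs (B n).

(** The crude Cauchy-Schwarz over the block loses Y^(2 kap + 2 md); the K differences win back Y^(-2
    K dl), and [hK] is exactly this balance. *)
Let err_bound l : Y l `^ dl * err l ^+ 2 <= EE * b2 l.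
Proof.
have md0 : 0 <= md by rewrite mdE.
pose c := \sum_(n | blk n == l) (Wt n)%:R `^ (2 * kap).
have kap0 : 0 < kap by rewrite kapE divr_gt0.
have hc : c <= (2 * Y l) `^ (2 * kap + 2 * md) * S'.
  apply: (@le_trans _ _ (\sum_(n | blk n == l) (2 * Y l) `^ (2 * kap + 2 * md) * (Wt n)%:R `^ (- (2 * md)))).
    apply: ler_sum => n /eqP hl.
    have -> : (Wt n)%:R `^ (2 * kap) = (Wt n)%:R `^ (2 * kap + 2 * md) * (Wt n)%:R `^ (- (2 * md)).
      by rewrite -powRD ?(gt_eqF (Wpos n)) ?implybT // addrK.
    rewrite ler_wpM2r ?powR_ge0 //; apply: ge0_ler_powR; rewrite ?nnegrE ?ler0n //.
    - by rewrite addr_ge0 ?mulr_ge0 // ltW.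
    - by rewrite mulr_ge0 // ltW.
    - by rewrite -hl; apply: blku.
  rewrite -mulr_sumr ler_wpM2l ?powR_ge0 //; apply: le_trans hS'.
  rewrite [leRHS](bigID (fun n => blk n == l)) /= lerDl sumr_ge0 // => n _; exact: powR_ge0.
have hs : (\sum_(n | blk n == l) cabs (B n)) ^+ 2 <= b2 l * c.
  apply: (@le_trans _ _ ((\sum_(n | blk n == l) beta n * (Wt n)%:R `^ kap) ^+ 2)).
    rewrite ler_pXn2r ?nnegrE ?sumr_ge0 // => [|n _|n _]; rewrite ?cabs_ge0 ?mulr_ge0 ?powR_ge0 //.
    exact: ler_sum.
  apply: le_trans (cauchy_schwarz _ _ _) _; rewrite -/(b2 l) ler_wpM2l //.
  rewrite /c le_eqVlt; apply/orP; left; apply/eqP; apply: eq_bigr => n _.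
  by rewrite -powR_mulrn ?powR_ge0 // -powRrM mulrC.
rewrite /err exprMn exprMn -exprM [(K * 2)%N]mulnC.
have hY : Y l `^ dl * (Y l `^ (- dl)) ^+ (2 * K) * Y l `^ (2 * kap + 2 * md) <= 1.
  rewrite -powR_mulrn ?powR_ge0 // -powRrM -!powRD ?(gt_eqF (Y0 l)) ?implybT //.
  rewrite -[leRHS](powRr0 (Y l)) ler_powR // natrM; move: hK; lra.
have := le_trans hs (ler_wpM2l (b20 l) hc) => {hs hc}.
set T := (\sum_(_ | _) _) ^+ 2 => hT.
rewrite exprMn powRM ?(ltW (Y0 l)) // in hT *.
have F0 : 0 <= A1 ^+ 2 * (16 * pi) ^+ (2 * K) * (Y l `^ (- dl)) ^+ (2 * K) * Y l `^ dl.
  by rewrite !mulr_ge0 ?sqr_ge0 ?exprn_ge0 ?powR_ge0 ?mulr_ge0 ?(ltW p0).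
have h3 := ler_wpM2l F0 hT.
have G0 : 0 <= EE * b2 l by rewrite mulr_ge0.
have h4 := ler_wpM2l G0 hY.
move: h3 h4; rewrite /EE mulr1.
set y1 := Y l `^ dl; set y2 := (Y l `^ (- dl)) ^+ _; set y3 := Y l `^ _; set z := _ ^+ (2 * K).
set w := 2 `^ _ => h3 h4.
apply: le_trans (le_trans h3 _); last apply: le_trans h4.
  by rewrite le_eqVlt; apply/orP; left; apply/eqP; ring.
by rewrite le_eqVlt; apply/orP; left; apply/eqP; ring.
Qed.

(** The selected time depends on y, so [fixed] does not apply to it. A window of r0 ~ M / Y^(1+dl)
    steps is short against the oscillation of the block, so [hD] bounds the value at the selected
    time by a mean over the window. Enlarging the window to all times costs U / r0 ~ Y^(1+dl);
    together with the weight Y^dl this is cancelled by Y^(-(1+th)), since 2 dl = th. *)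
Let block_sup l : (l < L)%N ->
  Y l `^ dl * cavg (cell side) (fun y => nsq (H l (a y) y)) x <=
  D * ((1 + 4 * K%:R) * (A0 ^+ 2 * S) + EE) * b2 l.
Proof.
move=> lL; have hYM := YM lL.
have Yp := powR_gt0 (1 + dl) (Y0 l).
have hx1 : 1 <= M%:R / Y l `^ (1 + dl) by rewrite ler_pdivlMr // mul1r.
have [r0 /andP[r0l r0u]] := nat_between hx1.
have r0p : 0 < (r0%:R : R) by apply: lt_le_trans r0l; rewrite divr_gt0.
have r00 : (0 < r0)%N by rewrite -(ltr0n R).
have err0 : 0 <= err l.
  rewrite /err !mulr_ge0 ?exprn_ge0 ?mulr_ge0 ?powR_ge0 ?(ltW p0) // sumr_ge0 // => n _.
  exact: cabs_ge0.
have r0M : r0%:R <= 2 * M%:R :> R.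
  apply: le_trans r0u _; rewrite ler_pM2l // ler_pdivrMr // ler_peMr ?(ltW Mpos) //.
  by rewrite -[leLHS](powRr0 (Y l)) ler_powR // addr_ge0 // (ltW dl0).
(* A range of times containing the window of every y. The windows only go forward in time, so they
   stay where the decay of [sh] holds. *)
pose U := (M + K * r0.*2)%N.
have UR : U%:R <= (1 + 4 * K%:R) * M%:R :> R.
  rewrite /U natrD natrM -muln2 natrM mulrDl mul1r lerD2l.
  have := ler_wpM2l (ler0n R K) r0M; nra.
have pt y : nsq (H l (a y) y) <=
   D * (r0%:R^-1 * \sum_(w < U | (M <= 24 * w)%N) nsq (H l w y) + err l ^+ 2).
  apply: (le_trans (hD (H := fun w => H l w y) (a := a y) r00 err0 _)) => [r hr|].
    rewrite (_ : \sum_(k < K.+1) _ = \sum_(n | blk n == l) B n * ph n y *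
      \sum_(k < K.+1) (-1) ^+ k * ('C(K, k))%:R * sh ((a y)%:R / M%:R + k%:R * (r%:R / M%:R)) n); last first.
      under [RHS]eq_bigr do rewrite mulr_sumr.
      rewrite exchange_big /=; apply: eq_bigr => k _; rewrite /H mulr_sumr; apply: eq_bigr => n _.
      have -> : (a y + k * r)%:R / M%:R = (a y)%:R / M%:R + k%:R * (r%:R / M%:R) :> R.
        by rewrite natrD natrM mulrDl mulrA.
      by ring.
    apply: le_trans (cabs_sum _ _ _) _; rewrite /err [leRHS]mulrC mulr_suml; apply: ler_sum => n /eqP hl.
    rewrite !cabsM cabs_cis mulr1 ler_wpM2l ?cabs_ge0 //.
    have rM0 : 0 <= r%:R / M%:R :> R by rewrite divr_ge0.
    apply: le_trans (h2 _ _ rM0) _; rewrite ler_wpM2l //.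
    have pz : 0 <= 2 * pi * (r%:R / M%:R) * (Wt n)%:R :> R by rewrite !mulr_ge0 ?(ltW p0).
    have pz' : 0 <= 16 * pi * Y l `^ (- dl) by rewrite !mulr_ge0 ?powR_ge0 ?(ltW p0).
    rewrite lerXn2r ?nnegrE //.
    have hr' : r%:R <= 4 * (M%:R / Y l `^ (1 + dl)) :> R.
      have : (r%:R <= (r0.*2)%:R :> R) by rewrite ler_nat.
      by rewrite -muln2 natrM; move: r0u; lra.
    have hr2 : r%:R / M%:R <= 4 / Y l `^ (1 + dl) :> R.
      rewrite ler_pdivrMr //; apply: le_trans hr' _.
      by rewrite le_eqVlt; apply/orP; left; apply/eqP; ring.
    have hW : (Wt n)%:R <= 2 * Y l by rewrite -hl; apply: blku.
    have hm : r%:R / M%:R * (Wt n)%:R <= 4 / Y l `^ (1 + dl) * (2 * Y l) by apply: ler_pM.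
    have e1 : 4 / Y l `^ (1 + dl) * (2 * Y l) = 8 * Y l `^ (- dl).
      rewrite powRN powRD ?(gt_eqF (Y0 l)) ?implybT // powRr1 ?(ltW (Y0 l)) //.
      by field; rewrite !gt_eqF ?powR_gt0.
    rewrite e1 in hm; rewrite -!mulrA.
    have p20 : 0 <= 2 * pi :> R by rewrite mulr_ge0 // ltW.
    by have := ler_wpM2l p20 hm; rewrite -!mulrA; lra.
  rewrite ler_pM2l // lerD2r ler_pM2l ?invr_gt0 //.
  rewrite -(big_mkord predT (fun u => nsq (H l (a y + u) y))).
  rewrite (_ : \sum_(0 <= u < K * r0.*2 | predT u) nsq (H l (a y + u) y) =
    \sum_(a y <= w < a y + K * r0.*2) nsq (H l w y)); last first.
    rewrite -{2}(add0n (a y)) big_addn addKn; apply: eq_bigr => u _; by rewrite addnC.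
  rewrite -(big_mkord (fun w => (M <= 24 * w)%N) (fun w => nsq (H l w y))).
  rewrite [leRHS](@big_cat_nat _ _ _ (a y)) //=; last by rewrite /U (leq_trans (aM' y)) // leq_addr.
  apply: ler_wpDl; first by rewrite sumr_ge0 // => w _; rewrite nsq_ge0.
  rewrite [leRHS](@big_cat_nat _ _ _ (a y + K * r0.*2)) ?leq_addr //=; last by rewrite leq_add2r.
  apply: ler_wpDr; first by rewrite sumr_ge0 // => w _; rewrite nsq_ge0.
  rewrite [leRHS]big_nat_cond [leLHS]big_nat_cond le_eqVlt; apply/orP; left; apply/eqP.
  apply: eq_bigl => w; case: (leqP (a y) w) => //= hw.
  by rewrite (leq_trans (aM y)) ?andbT // leq_mul2l hw orbT.
have havg : cavg (cell side) (fun y => nsq (H l (a y) y)) x <=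
   D * (r0%:R^-1 * (U%:R * (A0 ^+ 2 * Y l `^ (- (1 + th)) * S * b2 l)) + err l ^+ 2).
  apply: le_trans (ler_cavg (fun y _ => pt y)) _.
  rewrite cavgZ cavgD cavgZ cavg_sum cavg_const; last exact: char0R.
  rewrite ler_pM2l // lerD2r ler_pM2l ?invr_gt0 //.
  have F0 : 0 <= A0 ^+ 2 * Y l `^ (- (1 + th)) * S * b2 l.
    by rewrite !mulr_ge0 ?sqr_ge0 ?powR_ge0 ?(ltW S0).
  rewrite mulr_natl -[X in _ *+ X](card_ord U) -sumr_const big_mkcond /=.
  by apply: ler_sum => w _; case: ifP => // /fixed.
apply: (le_trans (ler_wpM2l (powR_ge0 _ _) havg)).
rewrite [leLHS]mulrCA -[leRHS]mulrA ler_pM2l // [leLHS]mulrDr [leRHS]mulrDl.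
apply: lerD; last exact: err_bound.
have Ur : U%:R / r0%:R <= (1 + 4 * K%:R) * Y l `^ (1 + dl).
  rewrite ler_pdivrMr //; apply: le_trans UR _.
  rewrite -mulrA ler_wpM2l ?addr_ge0 ?mulr_ge0 //.
  by rewrite -ler_pdivrMl // mulrC.
have hY : Y l `^ dl * Y l `^ (1 + dl) * Y l `^ (- (1 + th)) = 1.
  rewrite -!powRD ?(gt_eqF (Y0 l)) ?implybT // -[RHS](powRr0 (Y l)); congr (_ `^ _).
  by rewrite dlE; lra.
have G0 : 0 <= Y l `^ dl * (A0 ^+ 2 * Y l `^ (- (1 + th)) * S * b2 l).
  by rewrite !mulr_ge0 ?sqr_ge0 ?powR_ge0 ?(ltW S0).
have h3 := ler_wpM2l G0 Ur.
apply: le_trans (le_trans h3 _); first by rewrite le_eqVlt; apply/orP; left; apply/eqP; ring.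
rewrite le_eqVlt; apply/orP; left; apply/eqP.
transitivity ((1 + 4 * K%:R) * (A0 ^+ 2 * S) * b2 l * (Y l `^ dl * Y l `^ (1 + dl) * Y l `^ (- (1 + th)))).
  by ring.
by rewrite hY mulr1.
Qed.

(** Cauchy-Schwarz over the blocks with the summable weights Y^(-dl); their inverses are the factors
    Y^dl that [block_sup] affords. *)
Lemma blocks_sup :
  cavg (cell side) (fun y => nsq (\sum_n B n * sh ((a y)%:R / M%:R) n * ph n y)) x <=
  (1 - 2 `^ (- dl))^-1 * (D * ((1 + 4 * K%:R) * (A0 ^+ 2 * S) + EE)) * \sum_n beta n ^+ 2.
Proof.
have part (V : nmodType) (F : Mf -> V) : \sum_n F n = \sum_(l < L) \sum_(n | blk n == l) F n.
  rewrite (partition_big (fun n => Ordinal (blkL n)) predT) //.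
have G0 : 0 < (1 - 2 `^ (- dl))^-1 :> R by rewrite invr_gt0 subr_gt0 pow2_powR_lt1.
apply: (@le_trans _ _ (cavg (cell side) (fun y => (1 - 2 `^ (- dl))^-1 *
   \sum_(l < L) Y l `^ dl * nsq (H l (a y) y)) x)).
  apply: ler_cavg => y _; rewrite (part R[i]).
  apply: le_trans (nsq_sum_weight _ _ (rho := fun l : 'I_L => Y l `^ (- dl)) _) _.
    by move=> l; rewrite powR_gt0.
  under [X in _ * X <= _]eq_bigr do rewrite powRN invrK mulrC.
  apply: ler_wpM2r; last exact: pow2_powR_geom.
  by rewrite sumr_ge0 // => l _; rewrite mulr_ge0 ?powR_ge0 ?nsq_ge0.
rewrite cavgZ cavg_sum -mulrA ler_pM2l // (part R) mulr_sumr; apply: ler_sum => l _.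
by rewrite cavgZ; apply: block_sup.
Qed.
End Blocks.

Section LocalMaximalThm.
Variable R : realType.

(** [M0] depends on the cut-off N because the time grid must resolve the largest frequency; [C] and
    [kap] do not, so the time grid can be refined freely afterwards. *)
Lemma local_maximal (q d : nat) (s A0 A1 : R) : (0 < q)%N -> (0 < d)%N ->
  q%:R * d%:R / 2 + 1 / 2 < s -> 0 <= A0 -> 0 <= A1 ->
  exists C kap : R, [/\ 0 < C, 0 < kap & forall N, exists M0 : nat, forall (M P side : nat)
   (sh : R -> {ffun 'I_q.+1 -> {ffun 'I_d -> 'I_(N.*2.+1)}} -> R[i])
   (x : {ffun 'I_d -> 'I_P}) (a : {ffun 'I_d -> 'I_P} -> nat)
   (B : {ffun 'I_q.+1 -> {ffun 'I_d -> 'I_(N.*2.+1)}} -> R[i])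
   (beta : {ffun 'I_q.+1 -> {ffun 'I_d -> 'I_(N.*2.+1)}} -> R),
   (M0 <= M)%N -> (0 < side)%N -> (side %| P)%N -> (q.+1 * N.*2 < side)%N ->
   (forall u n, 24^-1 <= u -> cabs (sh u n) <= A0 * (Wt n)%:R `^ (- s)) ->
   (forall u r n K, 0 <= r ->
     cabs (\sum_(k < K.+1) (-1) ^+ k * ('C(K, k))%:R * sh (u + k%:R * r) n) <=
     A1 * (2 * pi * r * (Wt n)%:R) ^+ K) ->
   (forall y, (M <= 24 * a y)%N) -> (forall y, (a y <= M)%N) ->
   (forall n, 0 <= beta n) -> (forall n, cabs (B n) <= beta n * (Wt n)%:R `^ kap) ->
   cavg (cell side) (fun y => nsq (\sum_n B n * sh ((a y)%:R / M%:R) n *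
      cis (phase side (fun j => \sum_i zf R N (n i j)) y))) x <=
   C * \sum_n beta n ^+ 2].
Proof.
move=> q0 d0 hs A00 A10.
have qd : 1 <= (q * d)%:R :> R by rewrite ler1n muln_gt0 q0.
(* A quarter of the slack: 2s = 1 + qd + 4 th. One th is the power Wt^(2 kap), two go to the fibre
   sums, and the last one is 2 dl, shared by the time windows and the sum over blocks. *)
pose th : R := (2 * s - 1 - (q * d)%:R) / 4.
have th0 : 0 < th by rewrite /th natrM; lra.
pose kap : R := th / 2; pose dl : R := th / 2.
have dl0 : 0 < dl by rewrite /dl; lra.
have [S [S0 hS]] : exists S : R, 0 < S /\ forall N v,
  \sum_(n : {ffun 'I_q.+1 -> {ffun 'I_d -> 'I_(N.*2.+1)}} | fsum n == v)
    (Wt n)%:R `^ (- ((q * d)%:R + 2 * th)) <= S.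
  by apply: fiber_bound => //; lra.
pose md : R := (q.+1 * d)%:R.
have [S' [S'0 hS']] : exists S : R, 0 < S /\ forall N,
  \sum_(n : {ffun 'I_q.+1 -> {ffun 'I_d -> 'I_(N.*2.+1)}}) (Wt n)%:R `^ (- (2 * md)) <= S.
  apply: sum_Wt_bound => //; rewrite -/md.
  have : 1 <= md by rewrite ler1n muln_gt0.
  by lra.
have [K hK] : exists K : nat, dl + 2 * kap + 2 * md <= 2 * K%:R * dl.
  pose z := (dl + 2 * kap + 2 * md) / (2 * dl).
  have md0 : 0 <= md by [].
  have z0 : 0 <= z by rewrite /z divr_ge0 // /kap; lra.
  exists (Num.truncn z).+1; have /andP[_ /ltW] := truncn_itv z0.
  by rewrite /z ler_pdivrMr ?mulr_gt0 //; lra.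
have [D [D0 hD]] := near_reproducing R K.
pose EE : R := A1 ^+ 2 * (16 * pi) ^+ (2 * K) * 2 `^ (2 * kap + 2 * md) * S'.
pose C1 : R := (1 - 2 `^ (- dl))^-1 * (D * ((1 + 4 * K%:R) * (A0 ^+ 2 * S) + EE)).
exists (Num.max C1 1), kap; split.
- by rewrite lt_max ltr01 orbT.
- by rewrite /kap; lra.
move=> N.
pose M0r : R := (\max_(n : {ffun 'I_q.+1 -> {ffun 'I_d -> 'I_(N.*2.+1)}}) Wt n)%:R `^ (1 + dl).
exists (Num.truncn M0r).+1.
move=> M P side sh x a B beta M0M side0 sideP Nside h1 h2 aM aM' beta0 hB.
have MR : M0r <= M%:R.
  have /andP[_ /ltW h] := truncn_itv (powR_ge0 (\max_(n : {ffun 'I_q.+1 -> {ffun 'I_d -> 'I_(N.*2.+1)}}) Wt n)%:R (1 + dl)).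
  by apply: le_trans h _; rewrite ler_nat.
have thE : 2 * s - 1 - (q * d)%:R = 4 * th by rewrite /th; lra.
apply: (@le_trans _ _ (C1 * \sum_n beta n ^+ 2)); last first.
  by rewrite ler_wpM2r ?sumr_ge0 ?le_max ?lexx // => n _; rewrite sqr_ge0.
apply: (@blocks_sup R q d N M P side K s A0 A1 th kap dl S S' md D sh x a B beta) => //.
by move=> u r n; apply: h2.
Qed.
End LocalMaximalThm.

(** * Binomial estimates and the kernel cos(pi u)^(2N) *)

Section CentralBinomial.

Lemma bin_le_step n k : (k.*2 < n)%N -> ('C(n, k) <= 'C(n, k.+1))%N.
Proof.
move=> kn; have h := mul_bin_left n k.
rewrite -(leq_pmul2l (ltn0Sn k)) h leq_mul2r; apply/orP; right.
by rewrite -addnn in kn; lia.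
Qed.
Lemma bin_le_half N k : (k <= N)%N -> ('C(N.*2, k) <= 'C(N.*2, N))%N.
Proof.
move=> kN; have H j : (j <= N)%N -> ('C(N.*2, N - j) <= 'C(N.*2, N))%N.
  elim: j => [|j IH] jN; first by rewrite subn0.
  apply: leq_trans (IH (ltnW jN)).
  have -> : (N - j = (N - j.+1).+1)%N by lia.
  by apply: bin_le_step; rewrite ltn_double; lia.
by have := H (N - k)%N (leq_subr _ _); rewrite subKn.
Qed.
Lemma bin_le_central N k : ('C(N.*2, k) <= 'C(N.*2, N))%N.
Proof.
case: (leqP k N) => [|kN]; first exact: bin_le_half.
case: (leqP k N.*2) => [k2|k2]; last by rewrite bin_small.
by rewrite -bin_sub // bin_le_half // -addnn; lia.
Qed.
(** 4^N is the sum of 2N + 1 binomial coefficients, none above the central one. *)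
Lemma central_bin_lower N : (4 ^ N <= N.*2.+1 * 'C(N.*2, N))%N.
Proof.
have -> : (4 ^ N = \sum_(i < N.*2.+1) 'C(N.*2, i))%N.
  have := expnDn 1 1 N.*2; rewrite -mul2n expnM => ->.
  by apply: eq_bigr => i _; rewrite !exp1n !muln1.
rewrite -[X in (_ <= X * _)%N]card_ord -sum_nat_const.
by apply: leq_sum => i _; apply: bin_le_central.
Qed.
End CentralBinomial.

Section Kernel.
Variable R : realType.

Definition kco (N n : nat) : R := ('C(N.*2, n))%:R / ('C(N.*2, N))%:R.
(** This is (2 cos(pi u))^(2N) / C(2N, N): a nonnegative trigonometric polynomial of degree N,
    normalised to have constant coefficient 1. *)
Definition kernel1 (N : nat) (u : R) : R := 4 ^+ N / ('C(N.*2, N))%:R * cos (pi * u) ^+ N.*2.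

Lemma bin_central_gt0 N : 0 < ('C(N.*2, N))%:R :> R.
Proof. by rewrite ltr0n bin_gt0 -addnn leq_addr. Qed.
Lemma kco_ge0 N n : 0 <= kco N n. Proof. by rewrite divr_ge0. Qed.
Lemma kco_le1 N n : kco N n <= 1.
Proof. by rewrite ler_pdivrMr ?bin_central_gt0 // mul1r ler_nat bin_le_central. Qed.
Lemma kco_central N : kco N N = 1.
Proof. by rewrite /kco divff // gt_eqF // bin_central_gt0. Qed.

Lemma kernel1E N u : ((kernel1 N u)%:C)%C =
  \sum_(n < N.*2.+1) ((kco N n)%:C)%C * cis (2 * pi * (zf R N n * u)).
Proof.
have h : ((2 * cos (pi * u))%:C)%C = cis (- (pi * u)) + cis (pi * u).
  by apply: complex_ext; rewrite ?cReD ?cImD /= ?cosN ?sinN; ring.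
have : ((2 * cos (pi * u))%:C)%C ^+ N.*2 =
  \sum_(n < N.*2.+1) (('C(N.*2, n))%:R)%:C%C * cis (2 * pi * (zf R N n * u)).
  rewrite h exprDn; apply: eq_bigr => n _; rewrite -mulr_natr mulrC; congr (_ * _).
    by rewrite rmorph_nat.
  rewrite -!cisMn -cisD; congr cis.
  rewrite -[X in X + _]mulr_natr -[X in _ + X]mulr_natr natrB -1?ltnS // /zf.
  have -> : (N.*2)%:R = N%:R * 2 :> R by rewrite -muln2 natrM.
  by ring.
rewrite -rmorphXn /= => e.
have -> : (kernel1 N u)%:C%C = (('C(N.*2, N))%:R^-1)%:C%C * ((2 * cos (pi * u)) ^+ N.*2)%:C%C.
  rewrite -rmorphM /=; congr (_%:C%C); rewrite /kernel1 exprMn -mul2n [2 ^+ _]exprM.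
  have -> : (2 : R) ^+ 2 = 4 by ring.
  by ring.
rewrite e mulr_sumr; apply: eq_bigr => n _; rewrite mulrA; congr (_ * _).
by rewrite -rmorphM /= /kco mulrC.
Qed.

Lemma cos_even_ge0 N (u : R) : 0 <= cos u ^+ N.*2.
Proof. by rewrite exprn_even_ge0 // odd_double. Qed.
Lemma kernel1_cst_ge0 N : 0 <= 4 ^+ N / ('C(N.*2, N))%:R :> R.
Proof. by rewrite divr_ge0 ?exprn_ge0. Qed.
Lemma kernel1_ge0 N u : 0 <= kernel1 N u.
Proof. by rewrite mulr_ge0 ?kernel1_cst_ge0 ?cos_even_ge0. Qed.
Lemma kernel1_le N u (c : R) : `|cos (pi * u)| <= c ->
  kernel1 N u <= (N.*2.+1)%:R * c ^+ N.*2.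
Proof.
move=> uc; apply: ler_pM; rewrite ?kernel1_cst_ge0 ?cos_even_ge0 //.
- rewrite ler_pdivrMr ?bin_central_gt0 // -natrX -natrM ler_nat; exact: central_bin_lower.
- rewrite -[leLHS]ger0_norm ?cos_even_ge0 // normrX.
  by rewrite lerXn2r ?nnegrE // (le_trans _ uc).
Qed.
Lemma kernel1_le_max N u : kernel1 N u <= (N.*2.+1)%:R.
Proof. by have := kernel1_le N (cos_max (pi * u)); rewrite expr1n mulr1. Qed.

(** The modulus of cos(pi u) has period 1, so u near 1 or -1 is as bad as u near 0; hence the upper
    limit 1 - r. *)
Lemma cos_away (r u : R) : 0 <= r -> r <= 2^-1 -> r <= `|u| -> `|u| <= 1 - r ->
  `|cos (pi * u)| <= cos (pi * r).
Proof.
move=> r0 r2 ru u1; have p0 := @pi_gt0 R.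
have -> : cos (pi * u) = cos (pi * `|u|).
  by rewrite -(cos_norm (pi * u)) normrM (ger0_norm (ltW p0)).
set v := `|u| in ru u1 *; have v0 : 0 <= v by exact: normr_ge0.
have hp (c : R) : 0 <= c -> c <= 1 -> 0 <= pi * c <= pi.
  move=> hc0 hc1; apply/andP; split; first exact: mulr_ge0 (ltW p0) hc0.
  by have := ler_wpM2l (ltW p0) hc1; rewrite mulr1.
have mono (a b : R) : 0 <= a -> a <= b -> b <= 1 -> cos (pi * b) <= cos (pi * a).
  move=> a0 ab b1; rewrite le_eqVlt; have [->|ne] := eqVneq a b; first by rewrite eqxx.
  have b0 := le_trans a0 ab; have a1 := le_trans ab b1.
  apply/orP; right; rewrite ltr_cos ?in_itv /= ?hp //.
  by rewrite ltr_pM2l // lt_neqAle ne.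
rewrite ler_norml; apply/andP; split; last by apply: mono => //; lra.
rewrite lerNl.
have -> : - cos (pi * v) = cos (pi * (1 - v)).
  by rewrite -(cosN (pi * v)) -cosDpi; congr cos; ring.
by apply: mono; lra.
Qed.

Lemma cos_pi_lt1 (r : R) : 0 < r -> r <= 2^-1 -> 0 <= cos (pi * r) < 1.
Proof.
move=> r0 r2; have p0 := @pi_gt0 R; apply/andP; split.
  apply: cos_ge0_pihalf; apply/andP; split.
    by apply: (@le_trans _ _ 0); rewrite ?oppr_le0 ?divr_ge0 ?mulr_ge0 ?ltW.
  by rewrite ler_pM2l.
have h1 : pi * r <= pi by have := ler_wpM2l (ltW p0) (le_trans r2 (_ : _ <= 1)); rewrite mulr1; apply; lra.
have h0 : 0 < pi * r by exact: mulr_gt0.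
have := @ltr_cos R 0 (pi * r); rewrite cos0 !in_itv /= lexx (ltW p0) h1 (ltW h0) => -> //.
Qed.

(** With N = d k the left side is the d-th power of (2dk + 1) c^(2k), so only a linear factor has to
    be beaten. Bernoulli gives c^k <= 1 / (k x) with x = 1/c - 1, and the square of this bound
    suffices. *)
Lemma poly_geom_small (d : nat) (c e : R) : (0 < d)%N -> 0 <= c -> c < 1 -> 0 < e ->
  exists N : nat, ((N.*2.+1)%:R) ^+ d * c ^+ N.*2 <= e.
Proof.
move=> d0 c0 c1 e0.
have [->|cn] := eqVneq c 0.
  exists 1%N; rewrite expr0n mulr0; exact: ltW.
have cp : 0 < c by rewrite lt_neqAle eq_sym cn.
pose x := c^-1 - 1; have x0 : 0 < x by rewrite subr_gt0 invf_gt1.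
pose dl := Num.min e 1; have dl0 : 0 < dl by rewrite lt_min e0 ltr01.
have dd : 0 < (d%:R : R) by rewrite ltr0n.
pose k := (Num.truncn (3 * d%:R / (dl * x ^+ 2))).+1.
have kp : 0 < (k%:R : R) by [].
have hk : 3 * d%:R / (dl * x ^+ 2) <= k%:R.
  have h0 : 0 <= 3 * d%:R / (dl * x ^+ 2).
    apply: divr_ge0; first exact: mulr_ge0.
    exact: mulr_ge0 (ltW dl0) (sqr_ge0 x).
  by have /andP[_ /ltW] := truncn_itv h0.
exists (d * k)%N.
have -> : (d * k).*2 = (k.*2 * d)%N by rewrite -!muln2; lia.
rewrite exprM -exprMn.
suff h : (k.*2 * d).+1%:R * c ^+ k.*2 <= dl.
  apply: (@le_trans _ _ (dl ^+ d)); last first.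
    clear -d0 dl0; case: d d0 => // d _; rewrite exprS.
    have h1 : dl ^+ d <= 1 by rewrite exprn_ile1 ?(ltW dl0) // ge_min lexx orbT.
    by apply: le_trans (ler_wpM2l (ltW dl0) h1) _; rewrite mulr1 ge_min lexx.
  by rewrite lerXn2r ?nnegrE ?(ltW dl0) // mulr_ge0 // exprn_ge0.
have hc : c ^+ k <= (k%:R * x)^-1.
  have hx1 : 0 <= 1 + x by lra.
  have := bernoulli k hx1; have -> : 1 + x = c^-1 by rewrite /x; ring.
  have -> : c^-1 - 1 = x by [].
  move=> hb; rewrite -[c]invrK exprVn lef_pV2 ?posrE ?exprn_gt0 ?invr_gt0 ?mulr_gt0 //.
  by apply: le_trans hb; rewrite lerDr.
rewrite -mul2n [(2 * k)%N]mulnC exprM.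
apply: (@le_trans _ _ ((3 * k%:R * d%:R) * (k%:R * x) ^- 2)).
  apply: ler_pM => //; first by rewrite exprn_ge0 // exprn_ge0.
    have h1 : (1 <= k * d)%N by rewrite muln_gt0.
    have h2 : ((k * 2 * d).+1 <= 3 * (k * d))%N by move: h1; clear; rewrite mulnAC; lia.
    by rewrite -mulrA -[k%:R * d%:R]natrM -[3 * _]natrM ler_nat.
  by rewrite -exprVn lerXn2r ?nnegrE ?exprn_ge0 ?invr_ge0 ?mulr_ge0 // ltW.
have x2 : 0 < dl * x ^+ 2 by exact: mulr_gt0 dl0 (exprn_gt0 2 x0).
rewrite (ler_pdivrMr _ _ x2) in hk.
rewrite ler_pdivrMr; last by rewrite exprn_gt0 // mulr_gt0.
have := ler_wpM2l (ltW kp) hk; rewrite exprMn => H.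
by apply: le_trans (le_trans H _); rewrite le_eqVlt; apply/orP; left; apply/eqP; ring.
Qed.
End Kernel.

(** * Approximation by trigonometric polynomials on a cell *)

Section CellApprox.
Variables (R : realType) (d P N s : nat).
Local Notation X := {ffun 'I_d -> 'I_P}.
Local Notation freq := {ffun 'I_d -> 'I_(N.*2.+1)}.
Hypotheses (s0 : (0 < s)%N) (sP : (s %| P)%N) (Ns : (N.*2 < s)%N).
Variables (A : 'I_d -> R) (h : R).
Hypothesis h0 : 0 < h.

Definition pos (y : X) : 'I_d -> R := fun j => A j + h * (y j)%:R.
(** Displacement in units of the cell side, the variable of the kernel. *)
Definition rel_pos (z : 'I_d -> R) (y : X) (j : 'I_d) : R := (z j - pos y j) / (h * s%:R).
(* The average of f over the cell against the kernel cos(pi u)^(2N), which concentrates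
   near u = 0; expanding the kernel turns it into a trigonometric polynomial. *)
Definition ptrig (f : X -> R[i]) (x : X) (z : 'I_d -> R) : R[i] :=
  \sum_(n : freq) ((\prod_j kco R N (n j))%:C)%C * coef s f n x *
     cis (2 * pi * \sum_j zf R N (n j) * ((z j - A j) / (h * s%:R))).
Definition kern (z : 'I_d -> R) (y : X) : R := \prod_j kernel1 N (rel_pos z y j).

Lemma kern_ge0 z y : 0 <= kern z y.
Proof. by rewrite prodr_ge0 // => j _; apply: kernel1_ge0. Qed.

Lemma ptrigE (f : X -> R[i]) x z :
  ptrig f x z = cavg (cell s) (fun y => f y * ((kern z y)%:C)%C) x.
Proof.
have sR : s%:R != 0 :> R by rewrite pnatr_eq0 -lt0n.
rewrite /ptrig /coef.
under eq_bigr do rewrite mulrAC -cavgZ.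
rewrite -cavg_sum; apply: eq_cavg => y _.
have -> : ((kern z y)%:C)%C = \sum_(n : freq) \prod_j (((kco R N (n j))%:C)%C *
    cis (2 * pi * (zf R N (n j) * rel_pos z y j))).
  rewrite /kern rmorph_prod /=; under eq_bigr do rewrite kernel1E.
  by rewrite bigA_distr_bigA.
rewrite mulr_sumr; apply: eq_bigr => n _.
have -> : \prod_j (((kco R N (n j))%:C)%C * cis (2 * pi * (zf R N (n j) * rel_pos z y j))) =
   ((\prod_j kco R N (n j))%:C)%C * cis (2 * pi * \sum_j zf R N (n j) * rel_pos z y j).
  by rewrite big_split rmorph_prod mulr_sumr cis_sum.
set K := (\prod_j _)%:C%C; set E := cis _.
transitivity (f y * (K * (E * em R s n y))); first by ring.
congr (_ * (_ * _)); rewrite /E /em -cisD; congr cis.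
rewrite /phase -mulrDr -big_split; congr (_ * _); apply: eq_bigr => j _ /=.
by rewrite /rel_pos /pos; field; rewrite sR gt_eqF.
Qed.

(** The mass is exactly 1: averaging over a cell kills every nonzero frequency, because [N.*2 < s],
    and the zero frequency has coefficient 1. *)
Lemma kern_mass x z : cavg (cell s) (kern z) x = 1.
Proof.
apply: complexI; rewrite cavg_real.
have := ptrigE (fun=> 1) x z.
have -> : cavg (cell s) (fun y => 1 * ((kern z y)%:C)%C) x =
   cavg (cell s) (fun y => ((kern z y)%:C)%C) x by apply: eq_cavg => y _; rewrite mul1r.
move=> <-; rewrite /ptrig (bigD1 [ffun=> inord N]) //= [X in _ + X]big1 ?addr0; last first.
  move=> n n0; suff -> : coef s (fun=> 1 : R[i]) n x = 0 by rewrite mulr0 mul0r.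
  by rewrite -(coef_em0 R s0 sP Ns x n0); apply: eq_cavg => y _; rewrite mul1r.
have NN : (inord N : 'I_(N.*2.+1)) = N :> nat by rewrite inordK // ltnS -addnn leq_addr.
have z0 j : zf R N (([ffun=> inord N] : freq) j) = 0 by rewrite ffunE /zf NN subrr.
rewrite big1 => [|j _]; last by rewrite ffunE NN kco_central.
rewrite (_ : \sum_j _ = 0) ?mulr0 ?cis0 ?mulr1; last first.
  by apply: big1 => j _; rewrite z0 mul0r.
rewrite (_ : coef _ _ _ _ = cavg (cell s) (fun=> 1) x); last first.
  apply: eq_cavg => y _; rewrite mul1r /em /phase big1 ?mulr0 ?cis0 // => j _.
  by rewrite z0 oppr0 !mul0r.
by rewrite cavg_const ?mul1r //; apply: char0C.
Qed.

(** Approximate identity: points within relative distance r of z in all coordinates contribute e0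
    times a mass of one. Any other point of the cell has a coordinate at relative distance between r
    and 1 - r, where the kernel is at most (2N+1)^d cos(pi r)^(2N). *)
Lemma ptrig_approx (f : X -> R[i]) (fz : R[i]) x z (e0 Bd r : R) :
  0 < r -> r <= 2^-1 -> 0 <= e0 -> (forall y, cabs (f y) <= Bd) -> cabs fz <= Bd ->
  (forall y j, cell s y = cell s x -> `|rel_pos z y j| <= 1 - r) ->
  (forall y, (forall j, `|rel_pos z y j| <= r) -> cabs (f y - fz) <= e0) ->
  cabs (ptrig f x z - fz) <= e0 + 2 * Bd * ((N.*2.+1)%:R ^+ d * cos (pi * r) ^+ N.*2).
Proof.
move=> r0 r2 e00 fB fzB zin fclose.
have B0 : 0 <= Bd by apply: le_trans fzB; apply: cabs_ge0.
have -> : ptrig f x z - fz = cavg (cell s) (fun y => (f y - fz) * ((kern z y)%:C)%C) x.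
  rewrite ptrigE; transitivity (cavg (cell s) (fun y => f y * ((kern z y)%:C)%C) x -
     fz * cavg (cell s) (fun y => ((kern z y)%:C)%C) x).
    by rewrite -cavg_real kern_mass mulr1.
  by rewrite -cavgZ -cavgB; apply: eq_cavg => y _; rewrite mulrBl.
set Q := (N.*2.+1)%:R ^+ d * _.
have Q0 : 0 <= Q by exact: mulr_ge0 (exprn_ge0 d (ler0n R _)) (cos_even_ge0 _ _).
have tri (g : X -> R[i]) : cabs (cavg (cell s) g x) <= cavg (cell s) (fun y => cabs (g y)) x.
  rewrite /cavg cabsM.
  have -> : cabs ((csize (cell s) x)%:R^-1 : R[i]) = (csize (cell s) x)%:R^-1.
    have -> : ((csize (cell s) x)%:R^-1 : R[i]) = ((csize (cell s) x)%:R^-1)%:C%C.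
      by rewrite fmorphV rmorph_nat.
    by rewrite cabs_real ger0_norm ?invr_ge0.
  by rewrite ler_wpM2r ?invr_ge0 // cabs_sum.
apply: le_trans (tri _) _.
apply: (@le_trans _ _ (cavg (cell s) (fun y => e0 * kern z y + 2 * Bd * Q) x)); last first.
  by rewrite cavgD cavgZ kern_mass mulr1 cavg_const //; apply: char0R.
apply: ler_cavg => y yx; rewrite cabsM cabs_real ger0_norm ?kern_ge0 //.
have [hc|] := boolP [forall j, `|rel_pos z y j| <= r].
  apply: ler_wpDr; first exact: mulr_ge0 (mulr_ge0 (ler0n R 2) B0) Q0.
  by rewrite ler_wpM2r ?kern_ge0 // fclose // => j; exact: (forallP hc j).
rewrite negb_forall => /existsP[j]; rewrite -ltNge => /ltW hj.
apply: ler_wpDl; first by rewrite mulr_ge0 ?kern_ge0.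
apply: ler_pM; rewrite ?cabs_ge0 ?kern_ge0 //.
  by apply: le_trans (cabsB _ _) _; have := fB y; lra.
rewrite /kern (bigD1 j) //= /Q.
have d0 : (0 < d)%N by exact: leq_ltn_trans (leq0n j) (ltn_ord j).
have -> : (N.*2.+1)%:R ^+ d * cos (pi * r) ^+ N.*2 =
   ((N.*2.+1)%:R * cos (pi * r) ^+ N.*2) * (N.*2.+1)%:R ^+ d.-1.
  by rewrite -{1}(prednK d0) exprS; ring.
apply: ler_pM.
- exact: kernel1_ge0.
- by rewrite prodr_ge0 // => i _; exact: kernel1_ge0.
- by apply: kernel1_le; apply: cos_away => //; [exact: ltW|exact: zin].
apply: (@le_trans _ _ (\prod_(i < d | i != j) (N.*2.+1)%:R)).
  by apply: ler_prod => i _; rewrite kernel1_ge0 kernel1_le_max.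
by rewrite prodr_const cardC1 card_ord.
Qed.
End CellApprox.

Local Open Scope classical_set_scope.

(** * Integrals of bounded complex functions against a finite measure *)

Section ComplexIntegral.
Variables (R : realType) (dsp : measure_display) (T : measurableType dsp).
Variable mu : {finite_measure set T -> \bar R}.
Local Notation C := R[i].

Definition bmeas (g : T -> C) : Prop :=
  [/\ measurable_fun setT (fun y => complex.Re (g y)),
      measurable_fun setT (fun y => complex.Im (g y)) &
      exists B : R, forall y, cabs (g y) <= B].

Lemma bmeas_cst c : bmeas (fun=> c).
Proof. by split; [exact: measurable_cst..|exists (cabs c)]. Qed.

Lemma bmeasD f g : bmeas f -> bmeas g -> bmeas (fun y => f y + g y).
Proof.
move=> [fr fi [B fB]] [gr gi [B' gB]]; split.
- by under eq_fun do rewrite cReD; apply: measurable_funD.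
- by under eq_fun do rewrite cImD; apply: measurable_funD.
by exists (B + B') => y; rewrite (le_trans (cabsD _ _)) ?lerD.
Qed.

Lemma bmeasM f g : bmeas f -> bmeas g -> bmeas (fun y => f y * g y).
Proof.
move=> [fr fi [B fB]] [gr gi [B' gB]]; split.
- by under eq_fun do rewrite cReM; apply: measurable_funB; apply: measurable_funM.
- by under eq_fun do rewrite cImM; apply: measurable_funD; apply: measurable_funM.
by exists (B * B') => y; rewrite cabsM ler_pM ?cabs_ge0.
Qed.

Lemma bmeasZ c f : bmeas f -> bmeas (fun y => c * f y).
Proof. by move=> hf; apply: bmeasM => //; apply: bmeas_cst. Qed.

Lemma bmeasB f g : bmeas f -> bmeas g -> bmeas (fun y => f y - g y).
Proof.
move=> hf hg; have := bmeasD hf (bmeasZ (-1) hg).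
by under eq_fun do rewrite mulN1r.
Qed.

Lemma bmeas_sum (I : Type) (r : seq I) (P : pred I) (f : I -> T -> C) :
  (forall i, bmeas (f i)) -> bmeas (fun y => \sum_(i <- r | P i) f i y).
Proof.
move=> hf; elim: r => [|a r IH].
  by under eq_fun do rewrite big_nil; apply: bmeas_cst.
under eq_fun do rewrite big_cons; case: (P a) => //.
exact: bmeasD.
Qed.

Lemma bmeas_prod (I : Type) (r : seq I) (P : pred I) (f : I -> T -> C) :
  (forall i, bmeas (f i)) -> bmeas (fun y => \prod_(i <- r | P i) f i y).
Proof.
move=> hf; elim: r => [|a r IH].
  by under eq_fun do rewrite big_nil; apply: bmeas_cst.
under eq_fun do rewrite big_cons; case: (P a) => //.
exact: bmeasM.
Qed.

Lemma bmeas_cis (f : T -> R) : measurable_fun setT f -> bmeas (fun y => cis (f y)).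
Proof.
move=> mf; split; last by exists 1 => y; rewrite cabs_cis.
  apply: (measurableT_comp _ mf); apply: continuous_measurable_fun; exact: continuous_cos.
apply: (measurableT_comp _ mf); apply: continuous_measurable_fun; exact: continuous_sin.
Qed.

Lemma bmeasX f n : bmeas f -> bmeas (fun y => f y ^+ n).
Proof.
move=> hf; elim: n => [|n IH].
  by under eq_fun do rewrite expr0; apply: bmeas_cst.
by under eq_fun do rewrite exprS; apply: bmeasM.
Qed.

Lemma bounded_integrable (f : T -> R) (B : R) : measurable_fun setT f ->
  (forall y, `|f y| <= B) -> mu.-integrable setT (EFin \o f).
Proof.
move=> mf fB; apply: measurable_bounded_integrable => //; first exact: fin_num_fun_lty.
exists B; split; first exact: num_real.
by move=> M BM y _; apply: le_trans (fB y) (ltW BM).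
Qed.

Lemma bmeas_integrable g : bmeas g ->
  mu.-integrable setT (EFin \o (fun y => complex.Re (g y))) /\
  mu.-integrable setT (EFin \o (fun y => complex.Im (g y))).
Proof.
move=> [gr gi [B gB]]; split; apply: (bounded_integrable (B := B)) => // y.
  exact: le_trans (cabs_Re _) (gB y).
exact: le_trans (cabs_Im _) (gB y).
Qed.

Lemma CintegralD f g : bmeas f -> bmeas g ->
  Cintegral mu (fun y => f y + g y) = Cintegral mu f + Cintegral mu g.
Proof.
move=> /bmeas_integrable[fr fi] /bmeas_integrable[gr gi]; rewrite /Cintegral.
under eq_Rintegral do rewrite cReD.
under [X in (_ +i* X)%C]eq_Rintegral do rewrite cImD.
by rewrite !RintegralD.
Qed.

Lemma CintegralZ c f : bmeas f -> Cintegral mu (fun y => c * f y) = c * Cintegral mu f.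
Proof.
move=> /bmeas_integrable[fr fi]; rewrite /Cintegral.
under eq_Rintegral do rewrite cReM.
under [X in (_ +i* X)%C]eq_Rintegral do rewrite cImM.
have zr (r : R) (u : T -> R) : mu.-integrable setT (EFin \o u) ->
  mu.-integrable setT (EFin \o (fun y => r * u y)) by move=> hu; have := integrableZl measurableT r hu.
rewrite RintegralB //; [|by apply: zr..]; rewrite RintegralD //; [|by apply: zr..].
by rewrite !RintegralZl //; apply: complex_ext; rewrite ?cReM ?cImM.
Qed.

Lemma CintegralB f g : bmeas f -> bmeas g ->
  Cintegral mu (fun y => f y - g y) = Cintegral mu f - Cintegral mu g.
Proof.
move=> hf hg; have := CintegralD hf (bmeasZ (-1) hg).
rewrite CintegralZ // mulN1r => <-; congr (Cintegral mu _).
by apply: funext => y; rewrite mulN1r.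
Qed.

Lemma Cintegral_sum (I : Type) (r : seq I) (f : I -> T -> C) : (forall i, bmeas (f i)) ->
  Cintegral mu (fun y => \sum_(i <- r) f i y) = \sum_(i <- r) Cintegral mu (f i).
Proof.
move=> hf; elim: r => [|a r IH].
  rewrite big_nil; transitivity (Cintegral mu (fun=> 0 * 0)).
    by congr (Cintegral mu _); apply: funext => y; rewrite big_nil mulr0.
  by rewrite (CintegralZ 0 (bmeas_cst 0)) mul0r.
rewrite big_cons -IH -CintegralD //; last exact: bmeas_sum.
by congr (Cintegral mu _); apply: funext => y; rewrite big_cons.
Qed.

Lemma Rintegral_bound_null (N : set T) (f : T -> R) (B : R) : measurable N -> mu N = 0%E ->
  measurable_fun setT f -> (exists B', forall y, `|f y| <= B') ->
  0 <= B -> (forall y, ~ N y -> `|f y| <= B) ->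
  `|Rintegral mu setT f| <= B * fine (mu setT).
Proof.
move=> mN N0 mf [B' fB'] B0 fB.
have fi := bounded_integrable mf fB'.
apply: le_trans (le_normr_Rintegral _ fi) _ => //.
have nfi : mu.-integrable setT (EFin \o (fun y => `|f y|)).
  apply: (bounded_integrable (B := B')) => [|y]; first exact: measurableT_comp.
  by rewrite normr_id.
rewrite /Rintegral (negligible_integral mN measurableT nfi N0) setTD.
have mC : measurable (~` N) by exact: measurableC.
have cst : (\int[mu]_(x in ~` N) (B%:E))%E = (B%:E * mu (~` N))%E by rewrite integral_cst.
have fin1 : (mu (~` N) <= mu setT)%E by rewrite le_measure ?inE.
have fT : (mu setT < +oo)%E by exact: fin_num_fun_lty.
have finT : mu setT \is a fin_num by rewrite ge0_fin_numE.
have le1 : (\int[mu]_(x in ~` N) (`|f x|%R)%:E <= (B * fine (mu setT))%:E)%E.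
  apply: (@le_trans _ _ (\int[mu]_(x in ~` N) (B%:E))%E).
    apply: ge0_le_integral => //.
    by apply/measurable_EFinP/measurable_funTS; exact: measurableT_comp.
  rewrite cst EFinM fineK //; exact: lee_wpmul2l.
have ge0 : (0 <= \int[mu]_(x in ~` N) (`|f x|%R)%:E)%E.
  by apply: integral_ge0 => y _; rewrite lee_fin.
rewrite -lee_fin fineK //.
rewrite ge0_fin_numE //; exact: le_lt_trans le1 (ltry _).
Qed.

(** The factor 2 comes from bounding the modulus by |Re| + |Im|. In the applications the null set is
    the outside of the unit ball. *)
Lemma cabs_Cintegral_le (N : set T) (g : T -> C) (B : R) : measurable N -> mu N = 0%E ->
  bmeas g -> 0 <= B -> (forall y, ~ N y -> cabs (g y) <= B) ->
  cabs (Cintegral mu g) <= 2 * fine (mu setT) * B.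
Proof.
move=> mN N0 [gr gi [B' gB']] B0 gB.
apply: le_trans (cabs_leD _) _ => /=.
have -> : 2 * fine (mu setT) * B = B * fine (mu setT) + B * fine (mu setT) by ring.
apply: lerD; apply: Rintegral_bound_null mN N0 _ _ B0 _ => //.
- by exists B' => y; exact: le_trans (cabs_Re _) (gB' y).
- by move=> y Ny; exact: le_trans (cabs_Re _) (gB y Ny).
- by exists B' => y; exact: le_trans (cabs_Im _) (gB' y).
- by move=> y Ny; exact: le_trans (cabs_Im _) (gB y Ny).
Qed.
End ComplexIntegral.

(** * The Fourier transform of [sigma] along the sampled frequencies *)

Section SigmaTransform.
Variables (R : realType) (m d : nat).
Variable sigma : {finite_measure set (m.-tuple (d.-tuple R)) -> \bar R}.
Hypothesis sigma_ball : sigma [set y | 1 < tnorm y] = 0%E.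
Local Notation Y := (m.-tuple (d.-tuple R)).
Local Notation Mf N := {ffun 'I_m -> {ffun 'I_d -> 'I_(N.*2.+1)}}.

Lemma measurable_coord i j : measurable_fun setT (fun y : Y => tnth (tnth y i) j).
Proof. exact: (measurableT_comp (measurable_tnth j) (measurable_tnth i)). Qed.

Lemma measurable_outside : measurable [set y : Y | 1 < tnorm y].
Proof.
have mN : measurable_fun setT (fun y : Y => \sum_(i < m) \sum_(j < d) tnth (tnth y i) j ^+ 2).
  apply: measurable_sum => i; apply: measurable_sum => j.
  by apply: measurable_funX; apply: measurable_coord.
have -> : [set y : Y | 1 < tnorm y] = setT `&`
    (fun y : Y => \sum_(i < m) \sum_(j < d) tnth (tnth y i) j ^+ 2) @^-1` `]1, +oo[.
  rewrite setTI; apply/seteqP; split => y /=; rewrite in_itv /= andbT /tnorm.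
    by rewrite !ltNge; apply: contraNN => h; rewrite -sqrtr1 ler_wsqrtr.
  by move=> h; rewrite -sqrtr1 ltr_sqrt //; apply: lt_trans h.
by apply: mN => //; exact: measurable_itv.
Qed.

Lemma coord_le1 (y : Y) i j : ~ (1 < tnorm y) -> `|tnth (tnth y i) j| <= 1.
Proof.
move/negP; rewrite -leNgt => h; apply: le_trans h.
rewrite -sqrtr_sqr /tnorm ler_wsqrtr //.
rewrite (bigD1 i) //= (bigD1 j) //= -addrA lerDl addr_ge0 ?sumr_ge0 // => k _.
  by rewrite sqr_ge0.
by rewrite sumr_ge0 // => l _; rewrite sqr_ge0.
Qed.

Definition freq_dot N (n : Mf N) (y : Y) : R :=
  \sum_i \sum_j zf R N (n i j) * tnth (tnth y i) j.
Definition sigma_hat N (u : R) (n : Mf N) : R[i] :=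
  Cintegral sigma (fun y => cis (- (2 * pi * (u * freq_dot n y)))).

Lemma bmeas_freq N (n : Mf N) (u : R) :
  bmeas (fun y : Y => cis (- (2 * pi * (u * freq_dot n y)))).
Proof.
apply: bmeas_cis.
have h : measurable_fun setT (fun y : Y => 2 * pi * (u * freq_dot n y)).
  apply: measurable_funM => //; apply: measurable_funM => //.
  apply: measurable_sum => i; apply: measurable_sum => j.
  by apply: measurable_funM => //; apply: measurable_coord.
exact: (measurable_funN h).
Qed.

Lemma norm_freq_dot N (n : Mf N) (y : Y) : ~ (1 < tnorm y) -> `|freq_dot n y| <= (Wt n)%:R.
Proof.
move=> hy; apply: (@le_trans _ _ (\sum_i \sum_j zab N (n i j))%:R); last first.
  by rewrite ler_nat.
rewrite natr_sum; apply: le_trans (ler_norm_sum _ _ _) _; apply: ler_sum => i _.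
rewrite natr_sum; apply: le_trans (ler_norm_sum _ _ _) _; apply: ler_sum => j _.
rewrite normrM zabE -[leRHS]mulr1 ler_wpM2l //; exact: coord_le1.
Qed.

(** The K-th difference in u of exp(-2 pi i u c) is that exponential times (1 - exp(-2 pi i r c))^K,
    and |c| <= Wt n on the unit ball. *)
Lemma sigma_hat_differences N (n : Mf N) (u r : R) K : 0 <= r ->
  cabs (\sum_(k < K.+1) (-1) ^+ k * ('C(K, k))%:R * sigma_hat (u + k%:R * r) n) <=
  2 * fine (sigma setT) * (2 * pi * r * (Wt n)%:R) ^+ K.
Proof.
move=> r0.
under eq_bigr => k _ do rewrite -(CintegralZ sigma _ (bmeas_freq n _)).
rewrite -Cintegral_sum; last by move=> k; apply: bmeasZ; apply: bmeas_freq.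
have e y : \sum_(k < K.+1) (-1) ^+ k * ('C(K, k))%:R *
     cis (- (2 * pi * ((u + k%:R * r) * freq_dot n y))) =
   cis (- (2 * pi * (u * freq_dot n y))) * (1 - cis (- (2 * pi * (r * freq_dot n y)))) ^+ K
   :> R[i].
  rewrite exprBn mulr_sumr; apply: eq_bigr => k _; rewrite expr1n mulr1 -cisMn.
  have -> : - (2 * pi * ((u + k%:R * r) * freq_dot n y)) =
     - (2 * pi * (u * freq_dot n y)) + (- (2 * pi * (r * freq_dot n y))) *+ k.
    by rewrite -[X in _ = _ + X]mulr_natr; ring.
  by rewrite cisD -[X in _ = _ * X]mulr_natr; ring.
have -> : (fun y => \sum_(k < K.+1) (-1) ^+ k * ('C(K, k))%:R *
     cis (- (2 * pi * ((u + k%:R * r) * freq_dot n y)))) = fun y =>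
   cis (- (2 * pi * (u * freq_dot n y))) * (1 - cis (- (2 * pi * (r * freq_dot n y)))) ^+ K
  by apply: funext => y; exact: e.
have p0 : 0 <= 2 * pi * r * (Wt n)%:R :> R by rewrite !mulr_ge0 ?pi_ge0.
apply: (cabs_Cintegral_le measurable_outside sigma_ball).
- apply: bmeasM; first exact: bmeas_freq.
  by apply: bmeasX; apply: bmeasB; [exact: bmeas_cst|exact: bmeas_freq].
- by rewrite exprn_ge0.
move=> y hy; rewrite cabsM cabs_cis mul1r cabsX lerXn2r ?nnegrE ?cabs_ge0 //.
rewrite -cabsN opprB; apply: le_trans (cis_sub1 _) _.
rewrite normrN -[2 * pi * r * _]mulrA normrM ger0_norm ?mulr_ge0 ?pi_ge0 //.
by rewrite ler_wpM2l ?mulr_ge0 ?pi_ge0 // normrM ger0_norm // ler_wpM2l // norm_freq_dot.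
Qed.

Lemma sigma_hatE N (u : R) (n : Mf N) : sigma_hat u n = fourier_measure sigma
  [tuple [tuple u * zf R N (n i j) | j < d] | i < m].
Proof.
rewrite /sigma_hat /fourier_measure; congr (Cintegral _ _); apply: funext => y.
rewrite /cis cosN sinN.
have -> // : u * freq_dot n y = tdot y [tuple [tuple u * zf R N (n i j) | j < d] | i < m].
rewrite /tdot /freq_dot mulr_sumr; apply: eq_bigr => i _; rewrite mulr_sumr.
by apply: eq_bigr => j _; rewrite !tnth_mktuple; ring.
Qed.

(** For u >= 1/24 every |n_ij| is at most 24 |xi|, so Wt n <= D (1 + |xi|) with D = 24 m d. The
    constant uses |A| because no sign of A is assumed. *)
Lemma sigma_hat_decay (A s : R) : (0 < m)%N -> (0 < d)%N -> 0 < s ->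
  (forall xi, cabs (fourier_measure sigma xi) <= A * powR (1 + tnorm xi) (- s)) ->
  exists A0 : R, 0 <= A0 /\ forall N (u : R) (n : Mf N), 24^-1 <= u ->
    cabs (sigma_hat u n) <= A0 * (Wt n)%:R `^ (- s).
Proof.
move=> m0 d0 s0 hA; pose D : R := 24 * (m * d)%:R.
have D1 : 24 <= D by rewrite /D ler_peMr // ler1n muln_gt0 m0.
have D0 : 0 < D by apply: lt_le_trans D1.
exists (`|A| * D `^ s); split; first by rewrite mulr_ge0 ?powR_ge0.
move=> N u n hu; rewrite sigma_hatE; apply: le_trans (hA _) _.
set xi := [tuple _ | _ < _].
apply: (@le_trans _ _ (`|A| * powR (1 + tnorm xi) (- s))).
  by rewrite ler_wpM2r ?powR_ge0 // ler_norm.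
rewrite -mulrA ler_wpM2l //.
have W0 : 0 < (Wt n)%:R :> R by rewrite ltr0n.
have -> : D `^ s * (Wt n)%:R `^ (- s) = ((Wt n)%:R / D) `^ (- s).
  rewrite [in RHS]powRM ?invr_ge0 ?(ltW D0) //.
  rewrite [in RHS]mulrC; congr (_ * _).
  by rewrite -powR_inv1 ?(ltW D0) // -powRrM mulN1r opprK.
have hx : forall i j, u * (zab N (n i j))%:R <= tnorm xi.
  move=> i j; have u0 : 0 <= u by apply: le_trans hu; rewrite invr_ge0.
  have -> : u * (zab N (n i j))%:R = `|tnth (tnth xi i) j|.
    by rewrite !tnth_mktuple normrM zabE ger0_norm.
  rewrite -sqrtr_sqr /tnorm ler_wsqrtr //.
  rewrite (bigD1 i) //= (bigD1 j) //= -addrA lerDl addr_ge0 ?sumr_ge0 // => k _.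
    by rewrite sqr_ge0.
  by rewrite sumr_ge0 // => l _; rewrite sqr_ge0.
have t0 : 0 <= tnorm xi by exact: sqrtr_ge0.
have hW : (Wt n)%:R / D <= 1 + tnorm xi.
  rewrite (ler_pdivrMr _ _ D0) -natr1 natr_sum.
  have : \sum_i (\sum_j zab N (n i j))%:R <= \sum_(i < m) \sum_(j < d) 24 * tnorm xi.
    apply: ler_sum => i _; rewrite natr_sum; apply: ler_sum => j _.
    have := hx i j; have h0 : 0 <= (zab N (n i j))%:R :> R by [].
    by have := ler_wpM2r h0 hu; lra.
  rewrite !sumr_const !card_ord -mulrnA -[X in _ <= X]mulr_natr.
  by rewrite mulnC => h; have : 24 * tnorm xi * (m * d)%:R = D * tnorm xi;
     [rewrite /D; ring|move=> hD; rewrite hD in h; lra].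
have W'0 : 0 < (Wt n)%:R / D by rewrite divr_gt0.
rewrite !powRN lef_pV2 ?posrE ?powR_gt0 //; last by lra.
by apply: ge0_ler_powR; rewrite ?nnegrE //; lra.
Qed.

Lemma average_ptrig (P N s : nat) (A : 'I_d -> R) (h t : R)
  (f : 'I_m -> {ffun 'I_d -> 'I_P} -> R[i]) (x z : {ffun 'I_d -> 'I_P}) :
  (0 < s)%N -> 0 < h ->
  Cintegral sigma (fun y => \prod_i @ptrig R d P N s A h (f i) x
     (fun j => pos A h z j - t * tnth (tnth y i) j)) =
  \sum_(n : Mf N) (\prod_i (((\prod_j kco R N (n i j))%:C)%C * coef s (f i) (n i) x)) *
     sigma_hat (t / (h * s%:R)) n * cis (phase s (fun j => \sum_i zf R N (n i j)) z).
Proof.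
move=> s0 h0; have sR : s%:R != 0 :> R by rewrite pnatr_eq0 -lt0n.
pose c (n : Mf N) : R[i] := \prod_i (((\prod_j kco R N (n i j))%:C)%C * coef s (f i) (n i) x).
pose E (n : Mf N) := cis (phase s (fun j => \sum_i zf R N (n i j)) z).
transitivity (Cintegral sigma (fun y => \sum_(n : Mf N)
   c n * E n * cis (- (2 * pi * (t / (h * s%:R) * freq_dot n y))))).
  congr (Cintegral _ _); apply: funext => y; rewrite /ptrig bigA_distr_bigA /=.
  apply: eq_bigr => n _; rewrite big_split /= -/(c n) -mulrA; congr (_ * _).
  rewrite -cis_sum /E -cisD; congr cis.
  rewrite /phase /freq_dot.
  transitivity (\sum_i (2 * pi * \sum_j zf R N (n i j) * (z j)%:R / s%:R -
     2 * pi * (t / (h * s%:R) * \sum_j zf R N (n i j) * tnth (tnth y i) j))).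
    apply: eq_bigr => i _; rewrite [t / _ * _]mulr_sumr -mulrBr -sumrB; congr (_ * _).
    apply: eq_bigr => j _; rewrite /pos; field.
    by rewrite sR gt_eqF.
  rewrite sumrB -!mulr_sumr; congr (_ * _ - _).
  rewrite exchange_big; apply: eq_bigr => j _ /=.
  by rewrite !mulr_suml.
rewrite Cintegral_sum; last by move=> n; apply: bmeasZ; apply: bmeas_freq.
apply: eq_bigr => n _; rewrite (CintegralZ sigma _ (bmeas_freq n _)) -/(sigma_hat _ _).
by rewrite mulrAC.
Qed.
End SigmaTransform.

(** * Lipschitz functions: measurability, and the Schwartz case *)

Section Lipschitz.
Variables (R : realType) (d : nat).

Definition sup_lipschitz (f : ('I_d -> R) -> R[i]) (K B : R) : Prop :=
  [/\ 0 <= K, forall z, cabs (f z) <= B &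
      forall z w (e : R), 0 <= e -> (forall j, `|z j - w j| <= e) -> cabs (f z - f w) <= K * e].

Lemma box_measurable (a b : 'I_d -> R) :
  measurable [set x : d.-tuple R | forall j, a j <= tnth x j <= b j].
Proof.
have -> : [set x : d.-tuple R | forall j, a j <= tnth x j <= b j] =
   \bigcap_(j in [set: 'I_d]) (setT `&` ((fun x : d.-tuple R => tnth x j) @^-1` `[a j, b j])).
  apply/seteqP; split => x /= h j.
    by move=> _; split => //=; rewrite in_itv; exact: h.
  by have [_ /=] := h j I; rewrite in_itv.
apply: fin_bigcap_measurable => [|j _]; first exact: finite_finset.
by apply: measurable_tnth => //; exact: measurable_itv.
Qed.

(** The sigma-algebra is generated by the coordinates, so a superlevel set is written as a countable
    union of boxes with rational centres and radii 1/(n+1), kept only when G exceeds c at the centre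
    by more than K times the radius. *)
Lemma lipschitz_measurable (G : d.-tuple R -> R) (K : R) : 0 <= K ->
  (forall x y (e : R), 0 <= e -> (forall j, `|tnth x j - tnth y j| <= e) -> `|G x - G y| <= K * e) ->
  measurable_fun setT G.
Proof.
move=> K0 hG; apply: (measurability _ (RGenOInfty.measurableE R)).
move=> _ [_ [c ->] <-]; rewrite setTI.
pose U := ({ffun 'I_d -> rat} * nat)%type.
pose ctr (u : U) : d.-tuple R := [tuple ratr (u.1 j) | j < d].
pose rad (u : U) : R := u.2.+1%:R^-1.
pose bx (u : U) : set (d.-tuple R) := if c + K * rad u < G (ctr u)
  then [set x | forall j, tnth (ctr u) j - rad u <= tnth x j <= tnth (ctr u) j + rad u]
  else set0.
have -> : G @^-1` `]c, +oo[%classic = \bigcup_u bx u.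
  apply/seteqP; split => x /=; rewrite in_itv /= andbT.
    move=> cx; pose n := Num.truncn (2 * K / (G x - c)).
    have cx0 : 0 < G x - c by rewrite subr_gt0.
    have hn : 2 * K / n.+1%:R < G x - c.
      have h0 : 0 <= 2 * K / (G x - c) by rewrite divr_ge0 ?mulr_ge0 // ltW.
      have /andP[_ h] := truncn_itv h0; rewrite -/n in h.
      by rewrite (ltr_pdivrMr _ _ cx0) in h; rewrite ltr_pdivrMr // [ltRHS]mulrC.
    have hr (j : 'I_d) : exists r : rat, `|tnth x j - ratr r| <= n.+1%:R^-1.
      have lt2 : tnth x j - n.+1%:R^-1 < tnth x j + n.+1%:R^-1 by rewrite ltrBlDr -addrA ltrDl addr_gt0.
      have [r] := rat_in_itvoo lt2; rewrite in_itv /= => /andP[h1 h2].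
      by exists r; rewrite distrC ler_distl (ltW h1) (ltW h2).
    have [r hr'] := choice hr.
    exists (finfun r, n) => //.
    have cl (j : 'I_d) : `|tnth x j - tnth (ctr (finfun r, n)) j| <= n.+1%:R^-1.
      by rewrite tnth_mktuple ffunE.
    have n0 : 0 <= n.+1%:R^-1 :> R by [].
    have hh := hG _ _ _ n0 cl.
    rewrite /bx ifT.
      by move=> j; rewrite -ler_distl; exact: cl.
    have {}hn : 2 * (K * rad (finfun r, n)) < G x - c by move: hn; rewrite -mulrA.
    move: hh; rewrite -/(rad (finfun r, n)) ler_norml => /andP[h1 h2]; lra.
  move=> [u _]; rewrite /bx; case: ifP => // hu /= hx.
  have r0 : 0 <= rad u by rewrite /rad.
  have cl (j : 'I_d) : `|tnth x j - tnth (ctr u) j| <= rad u.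
    by rewrite ler_distl; exact: hx.
  have := hG _ _ _ r0 cl; rewrite ler_norml => /andP[h1 h2]; lra.
apply: countable_bigcupT_measurable; first exact: countableP.
move=> u; rewrite /bx; case: ifP => _; last exact: measurable0.
exact: box_measurable.
Qed.

Lemma sup_lipschitz_bmeas dsp (T : measurableType dsp) (phi : T -> d.-tuple R)
  (f : ('I_d -> R) -> R[i]) (K B t : R) (z : 'I_d -> R) : sup_lipschitz f K B ->
  measurable_fun setT phi -> bmeas (fun y => f (fun j => z j - t * tnth (phi y) j)).
Proof.
move=> [K0 fB fK] mphi.
have hK (x y : d.-tuple R) (e : R) : 0 <= e -> (forall j, `|tnth x j - tnth y j| <= e) ->
   cabs (f (fun j => z j - t * tnth x j) - f (fun j => z j - t * tnth y j)) <= K * `|t| * e.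
  move=> e0 xy; rewrite -mulrA; apply: fK; first exact: mulr_ge0.
  move=> j; have -> : z j - t * tnth x j - (z j - t * tnth y j) = - (t * (tnth x j - tnth y j)) by ring.
  by rewrite normrN normrM ler_wpM2l.
have Kt0 : 0 <= K * `|t| by exact: mulr_ge0.
split; last by exists B.
  apply: (measurableT_comp (f := fun x => complex.Re (f (fun j => z j - t * tnth x j))) _ mphi).
  apply: (lipschitz_measurable Kt0) => x y e e0 xy; apply: le_trans (hK x y e e0 xy).
  by rewrite -cReB; exact: cabs_Re.
apply: (measurableT_comp (f := fun x => complex.Im (f (fun j => z j - t * tnth x j))) _ mphi).
apply: (lipschitz_measurable Kt0) => x y e e0 xy; apply: le_trans (hK x y e e0 xy).
by rewrite -cImB; exact: cabs_Im.
Qed.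

Lemma partial_derivative_bound (f : 'rV[R]_d -> R) (j : 'I_d) (C : R) (v : 'rV[R]_d) (a b : R) :
  (forall x, differentiable f x) -> (forall x, `|pderiv j f x| <= C) ->
  `|f (v + b *: delta_mx 0 j) - f (v + a *: delta_mx 0 j)| <= C * `|b - a|.
Proof.
move=> df fC; wlog ab : a b / a <= b.
  move=> H; case: (leP a b) => [|/ltW] h; first exact: H.
  by rewrite distrC [`|b - a|]distrC; exact: H.
pose phi (t : R) : R := f (v + t *: delta_mx 0 j).
have eqf t : (fun h : R => h^-1 *: ((phi \o shift t) (h *: (1 : R)) - phi t)) =
   (fun h : R => h^-1 *: ((f \o shift (v + t *: delta_mx 0 j)) (h *: delta_mx 0 j) -
      f (v + t *: delta_mx 0 j))).
  apply: funext => h; rewrite /phi /=; congr (_ *: (f _ - _)).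
  by rewrite scalerDl /GRing.scale /= mulr1 addrCA.
have drv (t : R) : is_derive t (1 : R) phi (pderiv j f (v + t *: delta_mx 0 j)).
  apply: DeriveDef; last by rewrite /pderiv /derive eqf.
  rewrite /derivable eqf; have : derivable f (v + t *: delta_mx 0 j) (delta_mx 0 j).
    exact: diff_derivable.
  by [].
have [|c _ ->] := MVT_segment ab (fun t _ => drv t).
  apply: continuous_subspaceT => t; apply: differentiable_continuous.
  by apply/derivable1_diffP; case: (drv t).
by rewrite normrM ler_wpM2r.
Qed.

(** z is joined to w by changing one coordinate at a time, so the mean value theorem is applied
    along the axes only. *)
Lemma schwartz_lipschitz (f : 'rV[R]_d -> R) : is_schwartz f -> exists K B : R,
  [/\ 0 <= K, forall x, `|f x| <= B & forall (z w : 'I_d -> R) (e : R), 0 <= e ->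
   (forall j, `|z j - w j| <= e) -> `|f (\row_j z j) - f (\row_j w j)| <= K * e].
Proof.
move=> hf; have [df /(_ (fun=> 0%N))[B hB]] := hf [::].
have hC (j : 'I_d) : exists C, forall x, `|pderiv j f x| <= C.
  have [_ /(_ (fun=> 0%N))[C hC]] := hf [:: j].
  by exists C => x; have := hC x; rewrite big1 ?mul1r // => i _; rewrite expr0.
have [C hC'] := choice hC.
exists (\sum_j `|C j|), B; split; first by rewrite sumr_ge0.
  by move=> x; have := hB x; rewrite big1 ?mul1r // => i _; rewrite expr0.
move=> z w e e0 zw.
pose v (k : nat) : 'rV[R]_d := \row_j (if (j < k)%N then w j else z j).
have -> : f (\row_j z j) = f (v 0%N) by congr f; apply/rowP => j; rewrite !mxE.
have -> : f (\row_j w j) = f (v d) by congr f; apply/rowP => j; rewrite !mxE ltn_ord.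
have -> : f (v 0%N) - f (v d) = \sum_(k < d) (f (v k) - f (v k.+1)).
  rewrite -(big_mkord xpredT (fun k => f (v k) - f (v k.+1))) /=.
  by rewrite -opprB -(telescope_sumr (fun k => f (v k))) // -sumrN; apply: eq_bigr => k _; rewrite opprB.
apply: le_trans (ler_norm_sum _ _ _) _; rewrite mulr_suml; apply: ler_sum => k _.
have -> : v k.+1 = v k + (w k - z k) *: delta_mx 0 k.
  apply/rowP => j; rewrite !mxE eqxx /= ltnS leq_eqVlt -val_eqE /= eq_sym.
  have [jk|jk] := eqVneq (j : nat) k.
    rewrite (val_inj jk) ltnn /=; first by ring.
  by rewrite mulr0 addr0.
have := partial_derivative_bound (v k) 0 (w k - z k) df (hC' k).
rewrite scale0r addr0 distrC => h; apply: le_trans h _.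
rewrite subr0; apply: ler_pM => //; last by rewrite distrC.
  by apply: le_trans (hC' k 0).
exact: ler_norm.
Qed.

Lemma schwartzC_lipschitz (F : 'rV[R]_d -> R[i]) : is_schwartzC F ->
  exists K B, sup_lipschitz (fun z => F (\row_j z j)) K B.
Proof.
move=> [/schwartz_lipschitz[K [B [K0 fB fK]]] /schwartz_lipschitz[K' [B' [K0' fB' fK']]]].
exists (K + K'), (B + B'); split; first exact: addr_ge0.
  by move=> z; apply: le_trans (cabs_leD _) _; apply: lerD.
move=> z w e e0 zw; apply: le_trans (cabs_leD _) _; rewrite cReB cImB mulrDl.
by apply: lerD; [exact: fK|exact: fK'].
Qed.
End Lipschitz.

(** * Replacing averages by trigonometric averages *)

Section AverageApproximation.
Variables (R : realType) (m d : nat).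
Variable sigma : {finite_measure set (m.-tuple (d.-tuple R)) -> \bar R}.
Hypothesis sigma_ball : sigma [set y | 1 < tnorm y] = 0%E.
Local Notation Y := (m.-tuple (d.-tuple R)).
Local Notation Mf N := {ffun 'I_m -> {ffun 'I_d -> 'I_(N.*2.+1)}}.

Definition average (f : 'I_m -> ('I_d -> R) -> R[i]) (t : R) (z : 'I_d -> R) : R[i] :=
  Cintegral sigma (fun y => \prod_i f i (fun j => z j - t * tnth (tnth y i) j)).

Definition trig_average (P N s : nat) (f : 'I_m -> {ffun 'I_d -> 'I_P} -> R[i]) (u : R)
  (z : {ffun 'I_d -> 'I_P}) : R[i] :=
  \sum_(n : Mf N) (\prod_i (((\prod_j kco R N (n i j))%:C)%C * coef s (f i) (n i) z)) *
     sigma_hat sigma u n * cis (phase s (fun j => \sum_i zf R N (n i j)) z).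

Lemma trig_averageE (P N s : nat) (A : 'I_d -> R) (h t : R)
  (f : 'I_m -> {ffun 'I_d -> 'I_P} -> R[i]) (z : {ffun 'I_d -> 'I_P}) : (0 < s)%N -> 0 < h ->
  trig_average N s f (t / (h * s%:R)) z =
  Cintegral sigma (fun y => \prod_i @ptrig R d P N s A h (f i) z
     (fun j => pos A h z j - t * tnth (tnth y i) j)).
Proof. by move=> s0 h0; rewrite average_ptrig. Qed.

Lemma cabs_prod_sub (I : Type) (r : seq I) (a b : I -> R[i]) (B e : R) : 1 <= B -> 0 <= e ->
  (forall i, cabs (a i) <= B) -> (forall i, cabs (b i) <= B) ->
  (forall i, cabs (a i - b i) <= e) ->
  cabs (\prod_(i <- r) a i - \prod_(i <- r) b i) <= (size r)%:R * B ^+ size r * e.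
Proof.
move=> B1 e0 aB bB ab; have B0 : 0 <= B by apply: le_trans B1.
have pB (c : I -> R[i]) r' : (forall i, cabs (c i) <= B) ->
    cabs (\prod_(i <- r') c i) <= B ^+ size r'.
  move=> cB; elim: r' => [|x r' IH]; first by rewrite big_nil cabs1.
  by rewrite big_cons cabsM /= exprS ler_pM ?cabs_ge0.
elim: r => [|x r IH]; first by rewrite !big_nil subrr cabs0 !mul0r.
rewrite !big_cons /=.
have -> : a x * \prod_(i <- r) a i - b x * \prod_(i <- r) b i =
  (a x - b x) * \prod_(i <- r) a i + b x * (\prod_(i <- r) a i - \prod_(i <- r) b i) by ring.
apply: le_trans (cabsD _ _) _; rewrite !cabsM.
have h1 : cabs (a x - b x) * cabs (\prod_(i <- r) a i) <= e * B ^+ size r.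
  by rewrite ler_pM ?cabs_ge0 // pB.
have h2 : cabs (b x) * cabs (\prod_(i <- r) a i - \prod_(i <- r) b i) <=
   B * ((size r)%:R * B ^+ size r * e) by rewrite ler_pM ?cabs_ge0.
apply: le_trans (lerD h1 h2) _.
have h3 : e * B ^+ size r <= e * B ^+ (size r).+1.
  by rewrite ler_wpM2l // exprS ler_peMl // exprn_ge0.
rewrite -natr1; move: h3; rewrite exprS; lra.
Qed.

Lemma average_bmeas (f : 'I_m -> ('I_d -> R) -> R[i]) (K B t : R) (z : 'I_d -> R) :
  (forall i, sup_lipschitz (f i) K B) ->
  bmeas (fun y : Y => \prod_i f i (fun j => z j - t * tnth (tnth y i) j)).
Proof.
move=> hf; apply: bmeas_prod => i.
exact: (sup_lipschitz_bmeas (phi := fun y : Y => tnth y i) t z (hf i) (measurable_tnth i)).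
Qed.

Lemma average_close (F G : 'I_m -> Y -> R[i]) (B e : R) : 1 <= B -> 0 <= e ->
  (forall i, bmeas (F i)) -> (forall i, bmeas (G i)) ->
  (forall i y, ~ (1 < tnorm y) -> cabs (F i y) <= B) ->
  (forall i y, ~ (1 < tnorm y) -> cabs (G i y) <= B) ->
  (forall i y, ~ (1 < tnorm y) -> cabs (F i y - G i y) <= e) ->
  cabs (Cintegral sigma (fun y => \prod_i F i y) - Cintegral sigma (fun y => \prod_i G i y)) <=
  2 * fine (sigma setT) * (m%:R * B ^+ m * e).
Proof.
move=> B1 e0 mF mG FB GB FG; have B0 : 0 <= B by apply: le_trans B1.
have mpF : bmeas (fun y => \prod_i F i y) by exact: bmeas_prod.
have mpG : bmeas (fun y => \prod_i G i y) by exact: bmeas_prod.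
rewrite -CintegralB //.
apply: (@cabs_Cintegral_le R _ _ sigma _ (fun y => \prod_i F i y - \prod_i G i y) (m%:R * B ^+ m * e) (@measurable_outside R m d) sigma_ball); first exact: bmeasB.
  by rewrite !mulr_ge0 ?exprn_ge0.
move=> y hy.
have := @cabs_prod_sub _ (index_enum 'I_m) (fun i => F i y) (fun i => G i y) B e B1 e0.
have -> : size (index_enum 'I_m) = m by rewrite -[RHS](card_ord m) cardT enumT.
by apply=> i; [exact: FB|exact: GB|exact: FG].
Qed.

(** [z] lies in the middle two thirds of its cell and t y moves it by at most a twelfth of the side.
    Every point of the cell is then at relative distance at most 5/6 + 1/12 <= 1 - r, away from the
    periodic copies of the kernel peak. [e] adds the Lipschitz oscillation over r cell sides to the
    tail of the kernel. *)
Lemma average_trig_close (P N s : nat) (A : 'I_d -> R) (h t r K B e : R)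
  (f : 'I_m -> ('I_d -> R) -> R[i]) (z : {ffun 'I_d -> 'I_P}) :
  (0 < s)%N -> (s %| P)%N -> (N.*2 < s)%N -> 0 < h -> 0 < r -> r <= 12^-1 ->
  0 <= t -> t <= h * s%:R / 12 -> (forall j, (s <= 6 * (z j %% s) <= 5 * s)%N) ->
  (forall i, sup_lipschitz (f i) K B) ->
  e = K * (r * (h * s%:R)) + 2 * B * ((N.*2.+1)%:R ^+ d * cos (pi * r) ^+ N.*2) -> e <= 1 ->
  cabs (average f t (pos A h z) -
    trig_average N s (fun i y => f i (pos A h y)) (t / (h * s%:R)) z) <=
  2 * fine (sigma setT) * (m%:R * (B + 1) ^+ m * e).
Proof.
move=> s0 sP Ns h0 r0 r12 t0 ts zs hf eE e1.
have sR : 0 < s%:R :> R by rewrite ltr0n.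
have hs0 : 0 < h * s%:R by exact: mulr_gt0.
(* For m = 0 both averages integrate the empty product, and there is no index from which to read 0
   <= K. *)
have [m0|] := posnP m.
  have -> : trig_average N s (fun i y => f i (pos A h y)) (t / (h * s%:R)) z =
     average f t (pos A h z).
    rewrite /average (trig_averageE N A t _ z s0 h0).
    by congr (Cintegral _ _); apply: funext => y; apply: eq_bigr => i; have := ltn_ord i; rewrite {2}m0.
  by have -> : m%:R = 0 :> R by [rewrite m0]; rewrite subrr cabs0 !mul0r mulr0.
move=> m0; have K0 : 0 <= K by have [] := hf (Ordinal m0).
have B0 : 0 <= B.
  by have [_ /(_ (fun=> 0)) + _] := hf (Ordinal m0); apply: le_trans; exact: cabs_ge0.
have Q0 : 0 <= (N.*2.+1)%:R ^+ d * cos (pi * r) ^+ N.*2.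
  exact: mulr_ge0 (exprn_ge0 d (ler0n R _)) (cos_even_ge0 _ _).
have e0' : 0 <= K * (r * (h * s%:R)) by rewrite !mulr_ge0 // ltW.
have e0 : 0 <= e by rewrite eE addr_ge0 // mulr_ge0 // mulr_ge0.
rewrite (trig_averageE N A t _ z s0 h0) /average.
have key i y : ~ (1 < tnorm y) ->
   cabs (@ptrig R d P N s A h (fun y => f i (pos A h y)) z
     (fun j => pos A h z j - t * tnth (tnth y i) j) -
     f i (fun j => pos A h z j - t * tnth (tnth y i) j)) <= e.
  move=> hy; have [_ fB fK] := hf i; rewrite eE.
  apply: ptrig_approx => //; first by rewrite (le_trans r12) // lef_pV2 ?posrE // ler_nat.
    move=> y' j y'z; rewrite /rel_pos /pos.
    have y1 := coord_le1 i j hy.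
    have -> : (A j + h * (z j)%:R - t * tnth (tnth y i) j - (A j + h * (y' j)%:R)) / (h * s%:R) =
       ((z j)%:R - (y' j)%:R) / s%:R - t / (h * s%:R) * tnth (tnth y i) j.
      by field; rewrite !gt_eqF.
    have tq : 0 <= t / (h * s%:R) <= 12^-1.
      by rewrite divr_ge0 ?(ltW hs0) //= ler_pdivrMr // mulrC.
    have tv : `|t / (h * s%:R) * tnth (tnth y i) j| <= 12^-1.
      have /andP[q0 q1] := tq; rewrite normrM (ger0_norm q0) -[leRHS]mulr1; exact: ler_pM.
    have zy : `|((z j)%:R - (y' j)%:R) / s%:R : R| <= 5 / 6.
      have /ffunP/(_ j) := y'z; rewrite !ffunE => qE.
      have /andP[z1 z2] := zs j.
      have hz := divn_eq (z j) s; have hy' := divn_eq (y' j) s.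
      have ym : (y' j %% s < s)%N by rewrite ltn_mod.
      have -> : (z j)%:R - (y' j)%:R = (z j %% s)%:R - (y' j %% s)%:R :> R.
        by rewrite {1}hz {1}hy' qE !natrD; ring.
      rewrite normrM normfV (ger0_norm (ltW sR)) ler_pdivrMr //.
      move: ym; rewrite -(ltr_nat R) => ym.
      move: z1 z2; rewrite -!(ler_nat R) !natrM => z1 z2.
      have y0 : 0 <= (y' j %% s)%:R :> R by [].
      by rewrite ler_norml; apply/andP; split; lra.
    by apply: le_trans (ler_normB _ _) _; lra.
  move=> y' hy'; apply: fK; first by rewrite mulr_ge0 // ltW.
  move=> j; rewrite distrC; have := hy' j; rewrite /rel_pos normrM normfV (gtr0_norm hs0).
  by rewrite ler_pdivrMr.
rewrite -cabsN opprB.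
apply: average_close => //; first by rewrite lerDr.
- move=> i; rewrite /ptrig; apply: bmeas_sum => n; apply: bmeasZ; apply: bmeas_cis.
  apply: measurable_funM => //; apply: measurable_sum => j.
  apply: measurable_funM => //; apply: measurable_funM => //.
  apply: measurable_funB => //; apply: measurable_funB => //.
  by apply: measurable_funM => //; exact: measurable_coord.
- move=> i; exact: (sup_lipschitz_bmeas (phi := fun y : Y => tnth y i) t _ (hf i) (measurable_tnth i)).
- move=> i y hy /=; have [_ fB _] := hf i.
  have := le_trans (key i y hy) e1; set a := ptrig _ _ _ _ _ _ _; set b := f i _ => hab.
  rewrite -[a](subrK b); apply: le_trans (cabsD _ _) _.
  by rewrite [B + 1]addrC lerD // fB.
- by move=> i y hy; have [_ fB _] := hf i; apply: le_trans (fB _) _; rewrite lerDl.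
Qed.
End AverageApproximation.

Local Close Scope classical_set_scope.

(** * The maximal inequality for trigonometric averages *)

Section DiscreteMaximal.
Variables (R : realType) (d P q N : nat).
Local Notation X := {ffun 'I_d -> 'I_P}.
Local Notation freq := {ffun 'I_d -> 'I_(N.*2.+1)}.
Local Notation Mf := {ffun 'I_q.+1 -> freq}.

Definition zero_freq : freq := [ffun=> inord N].
Definition zero_mfreq : Mf := [ffun=> zero_freq].

Definition trig_mode (s : nat) (f : 'I_q.+1 -> X -> R[i]) (x : X) (n : Mf) : R[i] :=
  \prod_i (((\prod_j kco R N (n i j))%:C)%C * coef s (f i) (n i) x).
(** [x] selects the cell whose coefficients are used and [z] is the point of evaluation; they are
    kept apart so that the coefficients can be frozen while z runs over the cell. [sh] stands for
    the transform of the measure. *)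
Definition trig_term (s : nat) (f : 'I_q.+1 -> X -> R[i]) (sh : R -> Mf -> R[i]) (u : R)
  (x z : X) (n : Mf) : R[i] :=
  trig_mode s f x n * sh u n * cis (phase s (fun j => \sum_i zf R N (n i j)) z).

Lemma zero_freqE j : zero_freq j = N :> nat.
Proof. by rewrite ffunE inordK // ltnS -addnn leq_addr. Qed.

Lemma wt_zero_freq : wt zero_freq = 1%N.
Proof. by rewrite /wt big1 // => j _; rewrite /zab zero_freqE subnn. Qed.

Lemma Wt_zero_mfreq : Wt zero_mfreq = 1%N.
Proof. by rewrite /Wt big1 // => i _; rewrite big1 // => j _; rewrite ffunE /zab zero_freqE subnn. Qed.

Lemma cabs_kco (n : freq) : cabs ((\prod_j kco R N (n j))%:C)%C <= 1.
Proof.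
rewrite cabs_real ger0_norm ?prodr_ge0 // => [|j _]; last exact: kco_ge0.
rewrite -[leRHS](_ : \prod_(j < d) 1 = 1); last by rewrite big1.
by apply: ler_prod => j _; rewrite kco_ge0 kco_le1.
Qed.

Lemma cabs_trig_mode s f x (n : Mf) : cabs (trig_mode s f x n) <=
  \prod_i cabs (coef s (f i) (n i) x).
Proof.
rewrite /trig_mode cabs_prod; apply: ler_prod => i _; rewrite cabs_ge0 /= cabsM.
by rewrite ler_piMl ?cabs_ge0 // cabs_kco.
Qed.

Lemma coef_cls s (f : X -> R[i]) (n : freq) (x y : X) :
  cell s x = cell s y -> coef s f n x = coef s f n y.
Proof. exact: cavg_cls. Qed.

Lemma coef_zero s (f : X -> R[i]) (x : X) : coef s f zero_freq x = cavg (cell s) f x.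
Proof.
apply: eq_cavg => y _; rewrite /em /phase big1 ?mulr0 ?cis0 ?mulr1 // => j _.
by rewrite /zf zero_freqE subrr oppr0 !mul0r.
Qed.

Lemma cabs_cavg_le (K : eqType) (c : X -> K) (g : X -> R[i]) x :
  cabs (cavg c g x) <= cavg c (fun y => cabs (g y)) x.
Proof.
rewrite /cavg cabsM.
have -> : ((csize c x)%:R^-1 : R[i]) = ((csize c x)%:R^-1)%:C%C.
  by rewrite fmorphV rmorph_nat.
by rewrite cabs_real ger0_norm ?invr_ge0 // ler_wpM2r ?invr_ge0 // cabs_sum.
Qed.

Lemma mfreq_neq0 (n : Mf) : (n != zero_mfreq) = [exists i, n i != zero_freq].
Proof.
apply/idP/existsP => [h|[i hi]].
  apply/existsP; move: h; apply: contraNT; rewrite negb_exists => /forallP h.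
  by apply/eqP/ffunP => i; rewrite ffunE; apply/eqP; have := h i; rewrite negbK.
by apply: contraNneq hi => ->; rewrite ffunE.
Qed.

(** A nonzero tuple has a nonzero entry: a union bound over its position i, after which the other
    entries run freely. *)
Lemma sum_nonzero_prod (a : 'I_q.+1 -> freq -> R) : (forall i u, 0 <= a i u) ->
  \sum_(n : Mf | n != zero_mfreq) \prod_i a i (n i) <=
  \sum_i (\sum_(u | u != zero_freq) a i u) * \prod_(k | k != i) \sum_u a k u.
Proof.
move=> a0.
have p0 (n : Mf) : 0 <= \prod_i a i (n i) by rewrite prodr_ge0.
apply: (@le_trans _ _ (\sum_(n : Mf) \sum_i (if n i != zero_freq then \prod_k a k (n k) else 0))).
  rewrite big_mkcond /=; apply: ler_sum => n _; rewrite mfreq_neq0.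
  have s0 (Q : pred 'I_q.+1) : 0 <= \sum_(i | Q i) (if n i != zero_freq then \prod_k a k (n k) else 0).
    by rewrite sumr_ge0 // => i _; case: ifP.
  case: ifP => [/existsP[i hi]|_]; last exact: s0.
  by rewrite [leRHS](bigD1 i) //= hi lerDl s0.
rewrite exchange_big /=; apply: ler_sum => i _.
pose b (k : 'I_q.+1) (u : freq) : R := if (k == i) && (u == zero_freq) then 0 else a k u.
have -> : \sum_(n : Mf) (if n i != zero_freq then \prod_k a k (n k) else 0) =
   \sum_(n : Mf) \prod_k b k (n k).
  apply: eq_bigr => n _; case: ifP => h; last first.
    by rewrite (bigD1 i) //= /b eqxx /= (negbFE h) mul0r.
  apply: eq_bigr => k _; rewrite /b; case: eqP => //= ->; by rewrite (negbTE h).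
rewrite -bigA_distr_bigA (bigD1 i) //= /b eqxx /=.
rewrite le_eqVlt; apply/orP; left; apply/eqP; congr (_ * _).
  by rewrite [RHS]big_mkcond /=; apply: eq_bigr => u _; case: eqP.
by apply: eq_bigr => k /negbTE ->.
Qed.
End DiscreteMaximal.
Section DiscreteMaximalThm.
Variable R : realType.

(** Zero mode and remainder are both compared with the product of the [U i], where [U i] gathers the
    square function and the squared maximal function of f i; its sum over the grid is at most a
    multiple of the energy of f i plus [dl]. The floor [dl] keeps these bounds positive for
    Hoelder. *)
Lemma discrete_maximal (q d : nat) (s A0 A1 : R) : (0 < q)%N -> (0 < d)%N ->
  q%:R * d%:R / 2 + 1 / 2 < s -> 0 <= A0 -> 0 <= A1 ->
  exists C : R, 0 < C /\ forall (N P G G0 b : nat) (sd : nat -> nat)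
   (sh : R -> {ffun 'I_q.+1 -> {ffun 'I_d -> 'I_(N.*2.+1)}} -> R[i])
   (f : 'I_q.+1 -> {ffun 'I_d -> 'I_P} -> R[i])
   (gen a : {ffun 'I_d -> 'I_P} -> nat) (dl : R),
   (G <= G0)%N -> (forall g, 0 < sd g)%N -> (forall g, sd g %| P)%N ->
   (forall g, sd g.+1 %| sd g)%N -> (forall g, (g < G0)%N -> (sd g.+1).*2 <= sd g)%N ->
   sd G0 = 1%N -> (forall g, (g < G)%N -> (q.+1 * N.*2 < sd g)%N) ->
   (forall u n, 24^-1 <= u -> cabs (sh u n) <= A0 * (Wt n)%:R `^ (- s)) ->
   (forall u r n K, 0 <= r ->
     cabs (\sum_(k < K.+1) (-1) ^+ k * ('C(K, k))%:R * sh (u + k%:R * r) n) <=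
     A1 * (2 * pi * r * (Wt n)%:R) ^+ K) ->
   (0 < b)%N -> (forall y, (gen y < G)%N) -> (forall y, (b <= 24 * a y)%N) ->
   (forall y, (a y <= b)%N) -> 0 < dl ->
   \sum_y nsq (\sum_n trig_term (sd (gen y)) f sh ((a y)%:R / b%:R) y y n) `^ (q.+1%:R^-1) <=
   C * \prod_i (\sum_y nsq (f i y) + dl) `^ (q.+1%:R^-1).
Proof.
move=> q0 d0 hs A00 A10.
have [Cl [kap [Cl0 kap0 hloc]]] := local_maximal q0 d0 hs A00 A10.
pose m : nat := q.+1; pose p : R := m%:R^-1.
have m0 : 0 < m%:R :> R by rewrite ltr0n.
have p0 : 0 < p by rewrite invr_gt0.
(* Chosen so that the product of the m factors wt(n_i)^(e/2) is at most Wt(n)^kap. *)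
pose e : R := Num.min 1 (2 * kap / m%:R).
have e0 : 0 < e by rewrite lt_min ltr01 divr_gt0 ?mulr_gt0.
have e1 : e <= 1 by rewrite ge_min lexx.
have ek : m%:R * (e / 2) <= kap.
  have : e <= 2 * kap / m%:R by rewrite ge_min lexx orbT.
  by rewrite ler_pdivlMr // => h; lra.
have [Cs [Cs0 hsq]] := square_function e0 e1 d0.
pose C1 : R := Cs + 4.
pose K1 : R := (2 * A0 ^+ 2) `^ p + 2 `^ p * (2 * (Cl * m%:R + 1) `^ p) + 1.
have K10 : 0 < K1 by rewrite ltr_wpDl // addr_ge0 ?mulr_ge0 ?powR_ge0.
have C10 : 0 < C1 by rewrite addr_gt0.
have C11 : 1 <= C1 by rewrite /C1; lra.
exists (K1 * \prod_(i < m) C1 `^ p); split.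
  by rewrite mulr_gt0 // prodr_gt0 // => i _; rewrite powR_gt0.
move=> N P G G0 b sd sh f gen a dl GG0 sd0 sdP sdS sd2 sdG0 Nsd h1 h2 b0 genG ab ab' dl0.
pose X : finType := {ffun 'I_d -> 'I_P}.
have [M0 hM0] := hloc N.
(* Multiplying [a] and [b] by M0.+1 leaves the times unchanged and makes the time grid as fine as
   [local_maximal] asks. *)
pose M := (b * M0.+1)%N.
have nested g (x y : X) : cell (sd g.+1) x = cell (sd g.+1) y -> cell (sd g) x = cell (sd g) y.
  exact: cell_refine.
pose zf0 := zero_freq d N; pose zm0 := zero_mfreq d q N.
pose N2 g i (x : X) : R := \sum_(u | u != zf0) nsq (coef (sd g) (f i) u x) * (wt u)%:R `^ (- e).
pose c2 g i (x : X) : R := nsq (coef (sd g) (f i) zf0 x).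
pose mx i (x : X) : R := runmax (fun g => cavg (cell (sd g)) (fun y => cabs (f i y))) G x.
(* [eta] makes v positive, as [domination_powR] requires. Its sum over the generations is absorbed
   by the product of the U i thanks to [eta1], whose sum over the grid is at most [dl]. *)
pose eta1 : R := dl / (#|X|.+1)%:R.
have eta10 : 0 < eta1 by rewrite divr_gt0.
pose eta : R := eta1 ^+ m / (G.+1)%:R.
have eta0 : 0 < eta by rewrite divr_gt0 // exprn_gt0.
pose U i (x : X) : R := \sum_(g < G) N2 g i x + mx i x ^+ 2 + eta1.
have N20 g i x : 0 <= N2 g i x by rewrite sumr_ge0 // => u _; rewrite mulr_ge0 ?nsq_ge0 ?powR_ge0.
have sN20 i x : 0 <= \sum_(g < G) N2 g i x by rewrite sumr_ge0.
have U0 i x : 0 <= U i x.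
  by apply: addr_ge0 (ltW eta10); apply: addr_ge0 (sN20 _ _) (sqr_ge0 _).
have c2mx g i x : (g <= G)%N -> c2 g i x <= mx i x ^+ 2.
  move=> gG; rewrite /c2 coef_zero -sqr_cabs lerXn2r ?nnegrE ?cabs_ge0 //.
    by apply: runmax_ge0 => y; apply: cabs_ge0.
  apply: le_trans (cabs_cavg_le _ _ _) _.
  exact: (le_runmax (fun g => cavg (cell (sd g)) (fun y => cabs (f i y))) x gG).
have c2U g i x : (g <= G)%N -> c2 g i x <= U i x.
  move=> gG; have := c2mx g i x gG; have := sN20 i x; rewrite /U; lra.
have cNU g i x : (g < G)%N -> c2 g i x + N2 g i x <= U i x.
  move=> gG; have hc := c2mx g i x (ltnW gG).
  have hN : N2 g i x <= \sum_(g < G) N2 g i x.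
    by rewrite (bigD1 (Ordinal gG)) //= lerDl sumr_ge0.
  by rewrite /U; lra.
have NU i x : \sum_(g < G) N2 g i x <= U i x.
  by have := sqr_ge0 (mx i x); rewrite /U; lra.
pose v g (x : X) : R := Cl * (\sum_i N2 g i x * \prod_(k < m | k != i) (c2 g k x + N2 g k x)) + eta.
have pr0 g i x : 0 <= \prod_(k < m | k != i) (c2 g k x + N2 g k x).
  by rewrite prodr_ge0 // => k _; rewrite addr_ge0 ?nsq_ge0.
have v0 g x : 0 < v g x.
  rewrite /v ltr_wpDl // mulr_ge0 ?(ltW Cl0) // sumr_ge0 // => i _; exact: mulr_ge0.
pose rest g (x y : X) : R[i] := \sum_(n | n != zm0) trig_term (sd g) f sh ((a y)%:R / b%:R) x y n.
pose w g (y : X) : R := if gen y == g then nsq (rest g y y) else 0.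
have w0 g y : 0 <= w g y by rewrite /w; case: ifP => // _; apply: nsq_ge0.
have Ecls g i (u : {ffun 'I_d -> 'I_(N.*2.+1)}) x y : cell (sd g) x = cell (sd g) y ->
    coef (sd g) (f i) u x = coef (sd g) (f i) u y by exact: coef_cls.
have vcls g x y : cell (sd g) x = cell (sd g) y -> v g x = v g y.
  move=> xy.
  have NE k : N2 g k x = N2 g k y by apply: eq_bigr => u _; rewrite (Ecls _ _ _ _ _ xy).
  suff h : \sum_i N2 g i x * \prod_(k < m | k != i) (c2 g k x + N2 g k x) =
     \sum_i N2 g i y * \prod_(k < m | k != i) (c2 g k y + N2 g k y) by rewrite /v h.
  by apply: eq_bigr => i _; rewrite NE; congr (_ * _); apply: eq_bigr => k _;
     rewrite NE /c2 (Ecls _ _ _ _ _ xy).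
have bR : b%:R != 0 :> R by rewrite pnatr_eq0 -lt0n.
have wv g x : (g < G)%N -> cavg (cell (sd g)) (w g) x <= v g x.
  move=> gG.
  pose B (n : {ffun 'I_m -> {ffun 'I_d -> 'I_(N.*2.+1)}}) : R[i] :=
    if n != zm0 then trig_mode (sd g) f x n else 0.
  pose beta (n : {ffun 'I_m -> {ffun 'I_d -> 'I_(N.*2.+1)}}) : R :=
    if n != zm0 then \prod_i (cabs (coef (sd g) (f i) (n i) x) * (wt (n i))%:R `^ (- (e / 2))) else 0.
  have beta0 n : 0 <= beta n.
    by rewrite /beta; case: ifP => // _; rewrite prodr_ge0 // => i _; rewrite mulr_ge0 ?cabs_ge0 ?powR_ge0.
  have hB n : cabs (B n) <= beta n * (Wt n)%:R `^ kap.
    rewrite /B /beta; case: ifP => _; last by rewrite cabs0 mul0r.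
    apply: le_trans (cabs_trig_mode _ _ _ _) _; rewrite big_split /= -mulrA.
    rewrite ler_peMr //; first by rewrite prodr_ge0 // => i _; exact: cabs_ge0.
    have W1 : 1 <= (Wt n)%:R :> R by rewrite ler1n.
    have h : \prod_(i < m) (wt (n i))%:R `^ (e / 2) <= (Wt n)%:R `^ kap.
      apply: (@le_trans _ _ (\prod_(i < m) (Wt n)%:R `^ (e / 2))).
        apply: ler_prod => i _; rewrite powR_ge0 /=; apply: ge0_ler_powR; rewrite ?nnegrE //.
          by rewrite divr_ge0 // ltW.
        by rewrite ler_nat wt_le_Wt.
      rewrite prodr_const card_ord -powR_mulrn ?powR_ge0 // -powRrM.
      by apply: ler_powR => //; rewrite mulrC.
    apply: le_trans (ler_wpM2l _ h); last by rewrite prodr_ge0 // => i _; rewrite powR_ge0.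
    rewrite -big_split /= big1 // => i _.
    by rewrite -powRD ?addNr ?powRr0 // pnatr_eq0 implybT.
  have Mge : (M0 <= M)%N by rewrite /M (leq_trans (leqnSn _)) // leq_pmull.
  have := hM0 M P (sd g) sh x (fun y => (a y * M0.+1)%N) B beta Mge (sd0 g) (sdP g) (Nsd g gG) h1 h2.
  move=> /(_ _ _ beta0 hB) H.
  have {}H : cavg (cell (sd g)) (fun y => nsq (rest g x y)) x <= Cl * \sum_n beta n ^+ 2.
    have -> : cavg (cell (sd g)) (fun y => nsq (rest g x y)) x =
      cavg (cell (sd g)) (fun y => nsq (\sum_n B n * sh ((a y * M0.+1)%:R / M%:R) n *
      cis (phase (sd g) (fun j => \sum_i zf R N (n i j)) y))) x.
      apply: eq_cavg => y _; rewrite /rest big_mkcond /=; congr nsq; apply: eq_bigr => n _.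
      rewrite /B; case: ifP => _; last by rewrite !mul0r.
      by rewrite /trig_term /M !natrM -mulf_div divff ?mulr1 // pnatr_eq0.
    apply: H => y; last by rewrite leq_mul2r ab' orbT.
    by rewrite /M mulnA leq_mul2r ab orbT.
  (* On the cell of x the coefficients at y are those at x, so [rest g y y] is [rest g x y]. *)
  apply: (@le_trans _ _ (cavg (cell (sd g)) (fun y => nsq (rest g x y)) x)).
    apply: ler_cavg => y yx; rewrite /w; case: ifP => _; last exact: nsq_ge0.
    rewrite le_eqVlt; apply/orP; left; apply/eqP; congr nsq; apply: eq_bigr => n _.
    suff h : trig_mode (sd g) f y n = trig_mode (sd g) f x n by rewrite /trig_term h.
    by apply: eq_bigr => i _; rewrite (Ecls _ _ _ _ _ yx).
  apply: le_trans H _; rewrite /v; apply: ler_wpDr (ltW eta0) _.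
  rewrite ler_wpM2l ?(ltW Cl0) //.
  pose aa (i : 'I_m) (u : {ffun 'I_d -> 'I_(N.*2.+1)}) : R :=
    nsq (coef (sd g) (f i) u x) * (wt u)%:R `^ (- e).
  have aa0 i u : 0 <= aa i u by rewrite mulr_ge0 ?nsq_ge0 ?powR_ge0.
  have -> : \sum_n beta n ^+ 2 = \sum_(n | n != zm0) \prod_i aa i (n i).
    rewrite [RHS]big_mkcond /=; apply: eq_bigr => n _; rewrite /beta; case: ifP => _; last by rewrite expr0n.
    rewrite -prodrXl; apply: eq_bigr => i _; rewrite exprMn sqr_cabs; congr (_ * _).
    rewrite -powR_mulrn ?powR_ge0 // -powRrM; congr (_ `^ _); lra.
  apply: le_trans (sum_nonzero_prod aa0) _.
  rewrite le_eqVlt; apply/orP; left; apply/eqP; apply: eq_bigr => i _; congr (_ * _).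
  apply: eq_bigr => k _; rewrite (bigD1 zf0) //=; congr (_ + _).
  by rewrite /aa wt_zero_freq powR1 mulr1.
have dom := domination_powR nested (ltn0Sn q) vcls v0 w0 wv.
have wE y : \sum_(g < G) w g y = nsq (rest (gen y) y y).
  rewrite (bigD1 (Ordinal (genG y))) //= big1 ?addr0; first by rewrite /w eqxx.
  move=> g; rewrite -val_eqE /= /w eq_sym => /negbTE ->; by [].
have vU x : \sum_(g < G) v g x <= (Cl * m%:R + 1) * \prod_i U i x.
  rewrite big_split /= mulrDl mul1r; apply: lerD; last first.
    rewrite sumr_const card_ord -mulr_natr /eta -mulrA.
    apply: (@le_trans _ _ (eta1 ^+ m)).
      rewrite ler_piMr ?exprn_ge0 ?(ltW eta10) // mulrC ler_pdivrMr // mul1r ler_nat.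
      exact: leqnSn.
    rewrite -[X in eta1 ^+ X](card_ord m) -prodr_const; apply: ler_prod => i _.
    rewrite (ltW eta10) /= /U lerDr; apply: addr_ge0 (sN20 _ _) (sqr_ge0 _).
  rewrite -mulr_sumr -mulrA ler_wpM2l ?(ltW Cl0) // exchange_big /=.
  rewrite -[X in X%:R * _](card_ord m) mulr_natl -sumr_const; apply: ler_sum => i _.
  rewrite [leRHS](bigD1 i) //=.
  (* Only the factor with the nonzero frequency is summed over the generations; the others are
     bounded by U k uniformly in g, their zero modes through the maximal function. *)
  apply: (@le_trans _ _ (\sum_(g < G) N2 g i x * \prod_(k < m | k != i) U k x)).
    apply: ler_sum => g _; rewrite ler_wpM2l //; apply: ler_prod => k _.
    by rewrite addr_ge0 ?nsq_ge0 //= cNU.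
  by rewrite -mulr_suml ler_wpM2r // prodr_ge0.
have sumU i : \sum_x U i x <= C1 * (\sum_y nsq (f i y) + dl).
  rewrite [leLHS]big_split /= [X in X + _]big_split /=.
  have hS := hsq P N G G0 sd (f i) GG0 sd0 sdP sdS sd2 sdG0.
  have Ng g : (g < G)%N -> (N.*2 < sd g)%N.
    by move=> gG; apply: leq_ltn_trans (Nsd g gG); rewrite leq_pmull.
  have {hS}Ng1 := hS Ng.
  have dm := doob_maximal nested G (fun y => cabs_ge0 (f i y)).
  have e2 : \sum_(x : X) eta1 <= dl.
    rewrite sumr_const -mulr_natr /eta1 mulrAC ler_pdivrMr // ler_wpM2l ?(ltW dl0) // ler_nat.
    exact: leqnSn.
  have e3 : \sum_x \sum_(g < G) N2 g i x <= Cs * \sum_x nsq (f i x) by rewrite exchange_big.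
  have e4 : \sum_x mx i x ^+ 2 <= 4 * \sum_x nsq (f i x).
    apply: le_trans dm _; rewrite le_eqVlt; apply/orP; left; apply/eqP; congr (_ * _).
    by apply: eq_bigr => x _; rewrite sqr_cabs.
  have f0 : 0 <= \sum_x nsq (f i x) by rewrite sumr_ge0 // => x _; apply: nsq_ge0.
  have e5 : dl <= C1 * dl by rewrite ler_peMl ?(ltW dl0).
  apply: le_trans (lerD (lerD e3 e4) e2) _; rewrite mulrDr; apply: lerD => //.
  by rewrite -mulrDl.
have S0 i : 0 < C1 * (\sum_y nsq (f i y) + dl).
  by rewrite mulr_gt0 // ltr_wpDl // sumr_ge0 // => x _; apply: nsq_ge0.
have main := sum_prod_powR (ltn0Sn q) U0 S0 sumU.
have pU x : 0 <= \prod_i U i x by rewrite prodr_ge0.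
have prodE x : (\prod_i U i x) `^ p = \prod_i U i x `^ p by rewrite powR_prod.
apply: (@le_trans _ _ (K1 * \sum_x \prod_i U i x `^ p)); last first.
  rewrite -mulrA ler_wpM2l ?(ltW K10) //; apply: le_trans main _.
  rewrite -big_split /=; apply: ler_prod => i _; rewrite powR_ge0 /= powRM ?(ltW C10) //.
  by rewrite addr_ge0 ?(ltW dl0) // sumr_ge0 // => x _; apply: nsq_ge0.
pose zr (y : X) : R[i] := trig_term (sd (gen y)) f sh ((a y)%:R / b%:R) y y zm0.
have TSE y : \sum_n trig_term (sd (gen y)) f sh ((a y)%:R / b%:R) y y n = zr y + rest (gen y) y y.
  by rewrite (bigD1 zm0).
have zrU y : nsq (zr y) <= A0 ^+ 2 * \prod_i U i y.
  rewrite -sqr_cabs /zr /trig_term !cabsM cabs_cis mulr1.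
  have hsh : cabs (sh ((a y)%:R / b%:R) zm0) <= A0.
    have u24 : 24^-1 <= (a y)%:R / b%:R :> R.
      rewrite ler_pdivlMr ?ltr0n // ler_pdivrMl // -natrM ler_nat; exact: ab.
    by have := h1 _ zm0 u24; rewrite Wt_zero_mfreq powR1 mulr1.
  have hz : cabs (trig_mode (sd (gen y)) f y zm0) ^+ 2 <= \prod_i U i y.
    apply: (@le_trans _ _ ((\prod_i cabs (coef (sd (gen y)) (f i) zf0 y)) ^+ 2)).
      rewrite lerXn2r ?nnegrE ?cabs_ge0 ?prodr_ge0 // => [i _|]; first exact: cabs_ge0.
      apply: le_trans (cabs_trig_mode _ _ _ _) _.
      by rewrite le_eqVlt; apply/orP; left; apply/eqP; apply: eq_bigr => i _; rewrite ffunE.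
    rewrite -prodrXl; apply: ler_prod => i _; rewrite sqr_ge0 /= sqr_cabs.
    by apply: c2U; rewrite ltnW.
  rewrite exprMn mulrC; apply: ler_pM; rewrite ?sqr_ge0 //.
  by rewrite lerXn2r ?nnegrE ?cabs_ge0.
have pt y : nsq (zr y + rest (gen y) y y) `^ p <=
    (2 * A0 ^+ 2) `^ p * \prod_i U i y `^ p + 2 `^ p * (\sum_(g < G) w g y) `^ p.
  rewrite wE -prodE -!powRM ?nsq_ge0 ?mulr_ge0 ?sqr_ge0 //.
  apply: le_trans (powR_invnD (ltn0Sn q) _ _); last first.
  - by rewrite mulr_ge0 ?nsq_ge0.
  - by rewrite !mulr_ge0 ?sqr_ge0.
  apply: ge0_ler_powR; rewrite ?nnegrE ?(ltW p0) ?nsq_ge0 //.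
    by rewrite addr_ge0 // ?mulr_ge0 ?nsq_ge0 ?sqr_ge0.
  apply: le_trans (nsqD_le _ _) _; rewrite lerD2r -mulrA ler_wpM2l //.
apply: (@le_trans _ _ ((2 * A0 ^+ 2) `^ p * \sum_y \prod_i U i y `^ p +
   2 `^ p * \sum_y (\sum_(g < G) w g y) `^ p)).
  by rewrite !mulr_sumr -big_split /=; apply: ler_sum => y _; rewrite TSE; exact: pt.
have hv : \sum_y (\sum_(g < G) v g y) `^ p <= (Cl * m%:R + 1) `^ p * \sum_y \prod_i U i y `^ p.
  rewrite mulr_sumr; apply: ler_sum => y _.
  have c0 : 0 <= Cl * m%:R + 1 by rewrite addr_ge0 // mulr_ge0 // ltW.
  rewrite -prodE -powRM //; apply: ge0_ler_powR; rewrite ?nnegrE ?(ltW p0) //.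
    by rewrite sumr_ge0 // => g _; rewrite ltW.
  exact: mulr_ge0.
have W0 : 0 <= \sum_y \prod_i U i y `^ p.
  by rewrite sumr_ge0 // => y _; rewrite prodr_ge0 // => i _; rewrite powR_ge0.
rewrite /K1 [leRHS]mulrDl [X in _ <= X + _]mulrDl mul1r -addrA lerD2l.
apply: (@le_trans _ _ (2 `^ p * (2 * (Cl * m%:R + 1) `^ p) * \sum_y \prod_i U i y `^ p)); last first.
  by rewrite lerDl.
rewrite -!mulrA ler_wpM2l ?powR_ge0 //; apply: le_trans dom _.
by rewrite ler_wpM2l.
Qed.
End DiscreteMaximalThm.

(** * Selected times on a grid and the one-third trick *)

Lemma sum_inj_le (R : realType) (X Y : finType) (e : Y -> X) (F : X -> R) :
  injective e -> (forall x, 0 <= F x) -> \sum_y F (e y) <= \sum_x F x.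
Proof.
move=> inj F0.
have -> : \sum_y F (e y) = \sum_(x in e @: [set: Y]%SET) F x.
  rewrite big_imset /=; last by move=> x y _ _; exact: inj.
  by apply: eq_bigl => y; rewrite inE.
by rewrite [leRHS](bigID (fun x => x \in e @: [set: Y]%SET)) /= lerDl sumr_ge0.
Qed.

(* The one-third trick: a translation by a third of the top cube moves a point
   lying near a face of its dyadic cell to a central position. *)
Lemma one_third (J g i : nat) (s := (3 * 2 ^ (J - g))%N) : (g <= J)%N ->
  ~~ (s <= 6 * (i %% s) <= 5 * s)%N -> (s <= 6 * ((i + 2 ^ J) %% s) <= 5 * s)%N.
Proof.
move=> gJ; set w := (2 ^ (J - g))%N in s *.
have w0 : (0 < w)%N by rewrite expn_gt0.
have s0 : (0 < s)%N by rewrite muln_gt0.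
have JE : (2 ^ J = w * 2 ^ g)%N by rewrite /w -expnD subnK.
(* With s = 3w and 2^J = 2^g w, the translation moves the residue modulo s by c w, where c is 1 or 2
   because 3 does not divide 2^g. *)
pose c := (2 ^ g %% 3)%N.
have c12 : (c == 1)%N || (c == 2)%N.
  have c3 : (c < 3)%N by rewrite ltn_mod.
  have cn0 : c != 0%N.
    by apply/negP => c0; have : (3 %| 2 ^ g)%N by []; rewrite Euclid_dvdX.
  by move: c3 cn0; clear; case: c => [|[|[|]]].
have -> : ((i + 2 ^ J) %% s = (i %% s + c * w) %% s)%N.
  rewrite JE [in LHS](divn_eq (2 ^ g) 3) -/c mulnDr mulnCA [(w * 3)%N]mulnC -/s [(w * c)%N]mulnC.
  by rewrite addnCA modnMDl -[in RHS]modnDml modn_mod modnDml.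
have rs : (i %% s < s)%N by rewrite ltn_mod.
set r := (i %% s)%N in rs *; move: rs; rewrite /s => rs h.
have [r1|r1] := leqP (6 * r) (3 * w).
  rewrite modn_small; last by case/orP: c12 => /eqP ->; lia.
  by case/orP: c12 => /eqP ->; apply/andP; split; lia.
have r2 : (15 * w < 6 * r)%N by move: h r1; clear; lia.
have -> : ((r + c * w) %% (3 * w) = r + c * w - 3 * w)%N.
  have {1}-> : (r + c * w = (r + c * w - 3 * w) + 3 * w)%N by case/orP: c12 => /eqP ->; lia.
  by rewrite modnDr modn_small //; case/orP: c12 => /eqP ->; lia.
by case/orP: c12 => /eqP ->; apply/andP; split; lia.
Qed.

(* Number of steps of the finest grid along a cell of generation g; the last
   generation J.+1 consists of single grid points. *)
Definition side (J g : nat) : nat := if (g <= J)%N then (3 * 2 ^ (J - g))%N else 1%N.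

Lemma side_gt0 J g : (0 < side J g)%N.
Proof. by rewrite /side; case: ifP => // _; rewrite muln_gt0 expn_gt0. Qed.
Lemma side_dvdS J g : (side J g.+1 %| side J g)%N.
Proof.
rewrite /side; case: (ltnP g J) => gJ; last by rewrite dvd1n.
by rewrite (ltnW gJ) dvdn_pmul2l // dvdn_exp2l // leq_sub2l.
Qed.
Lemma side_dvd J g : (side J g %| 3 * 2 ^ J)%N.
Proof.
by rewrite /side; case: ifP => gJ; rewrite ?dvd1n // dvdn_pmul2l // dvdn_exp2l // leq_subr.
Qed.
Lemma side_double J g : (g < J.+1)%N -> ((side J g.+1).*2 <= side J g)%N.
Proof.
rewrite ltnS /side => gJ; rewrite gJ; case: (ltnP g J) => gJ'.
  by rewrite -[X in (_ <= 3 * 2 ^ X)%N](subnSK gJ') expnS -mul2n mulnCA.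
have -> : J = g by apply/eqP; rewrite eqn_leq gJ gJ'.
by rewrite subnn.
Qed.
Lemma side_last J : side J J.+1 = 1%N. Proof. by rewrite /side ltnn. Qed.
Lemma side_large J G g n : (g <= G)%N -> (G + n <= J)%N -> (n < side J g)%N.
Proof.
move=> gG GJ; have gJ : (g <= J)%N by lia.
rewrite /side gJ; have h1 : (n <= J - g)%N by lia.
apply: leq_ltn_trans h1 _; apply: leq_trans (ltn_expl (J - g) (ltnSn 1)) _.
by rewrite leq_pmull.
Qed.

(* The generation whose cell side l satisfies l/24 < t <= l/12, for the time
   t = k L / (12 * 2^G). *)
Definition time_gen (G k : nat) : nat := (G - up_log 2 k)%N.
(** [up_log] rounds k up to a power of two by at most a factor two, whence the window from 1/24 to
    1/12 for t over the cell side. *)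
Lemma time_genP G k (a := (k * 2 ^ time_gen G k)%N) : (0 < k <= 2 ^ G)%N ->
  (12 * 2 ^ G <= 24 * a)%N /\ (a <= 2 ^ G)%N.
Proof.
move=> /andP[k0 kG].
have eG : (up_log 2 k <= G)%N by apply: up_log_min.
have GE : (2 ^ G = 2 ^ up_log 2 k * 2 ^ time_gen G k)%N by rewrite -expnD subnKC.
have k1 : (k <= 2 ^ up_log 2 k)%N by apply: up_logP.
have k2 : (2 ^ up_log 2 k <= 2 * k)%N.
  have [k1'|k1'] := leqP k 1; first by have -> : k = 1%N by lia.
  have /andP[h1 _] := up_log_bounds (ltnSn 1) k1'.
  have u0 : (0 < up_log 2 k)%N by rewrite up_log_gt0.
  by rewrite -(prednK u0) expnS leq_mul2l /= ltnW.
rewrite /a GE; split; last by rewrite leq_mul2r k1 orbT.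
rewrite !mulnA leq_mul2r; apply/orP; right.
by apply: leq_trans (leq_mul (leqnn 12) k2) _; rewrite mulnA.
Qed.

Section GridMaximal.
Variables (R : realType) (q d : nat).
Variable sigma : {finite_measure set (q.+1.-tuple (d.-tuple R)) -> \bar R}.
Hypothesis sigma_ball : sigma [set y | 1 < tnorm y]%classic = 0%E.

(* Lower corners of the 2^d translates of the top cube; all of them contain the
   box [-L/3, L/3)^d. *)
Definition corner (L : R) (al : {ffun 'I_d -> bool}) : 'I_d -> R :=
  fun j => - (L / 3) - (al j)%:R * (L / 3).

(** The selection [sel] is arbitrary and [C] does not see it, which lets it stand for a maximum over
    times. The error [eps], charged once per grid point, pays for replacing the f i by trigonometric
    polynomials. *)
Lemma grid_maximal (s A : R) : (0 < q)%N -> (0 < d)%N -> q%:R * d%:R / 2 + 1 / 2 < s ->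
  (forall xi, cabs (fourier_measure sigma xi) <= A * powR (1 + tnorm xi) (- s)) ->
  exists C : R, 0 < C /\ forall (f : 'I_q.+1 -> ('I_d -> R) -> R[i]) (K B L eps : R) (Gm : nat),
  (forall i, sup_lipschitz (f i) K B) -> 0 < L -> 0 < eps ->
  exists J0 : nat, forall J (sel : {ffun 'I_d -> 'I_((2 ^ J).*2)} -> nat) (dl : R),
  (J0 <= J)%N -> (forall y, (0 < sel y <= 2 ^ Gm)%N) -> 0 < dl ->
  \sum_y nsq (average sigma f ((sel y)%:R * (L / (12 * 2 ^+ Gm)))
     (pos (fun=> - (L / 3)) (L / (3 * 2 ^+ J)) y)) `^ (q.+1%:R^-1) <=
  C * \sum_(al : {ffun 'I_d -> bool}) \prod_i (\sum_(x : {ffun 'I_d -> 'I_(3 * 2 ^ J)})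
     nsq (f i (pos (corner L al) (L / (3 * 2 ^+ J)) x)) + dl) `^ (q.+1%:R^-1) +
  eps * #|{: {ffun 'I_d -> 'I_((2 ^ J).*2)}}|%:R.
Proof.
move=> q0 d0 hs hA; pose m := q.+1; pose p : R := m%:R^-1.
have p0 : 0 <= p by rewrite invr_ge0.
have s0 : 0 < s.
  by apply: le_lt_trans hs; rewrite addr_ge0 // divr_ge0 // mulr_ge0.
have [A0 [A00 hdec]] := sigma_hat_decay (ltn0Sn q) d0 s0 hA.
pose Sm : R := fine (sigma setT).
have Sm0 : 0 <= Sm by exact: fine_ge0.
have Sm20 : 0 <= 2 * Sm by exact: mulr_ge0.
have [C1 [C10 hmax]] := discrete_maximal q0 d0 hs A00 Sm20.
exists (2 `^ p * C1); split; first by rewrite mulr_gt0 // powR_gt0.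
move=> f K B L eps Gm hf L0 eps0.
have K0 : 0 <= K by have [] := hf ord0.
have B0 : 0 <= B by have [_ /(_ (fun=> 0)) + _] := hf ord0; apply: le_trans; exact: cabs_ge0.
pose D : R := 2 * Sm * (m%:R * (B + 1) ^+ m).
have D0 : 0 <= D.
  apply: mulr_ge0 => //; apply: mulr_ge0 => //; apply: exprn_ge0; exact: addr_ge0.
(* Ensures 2 (D e)^2 <= eps^m, which the power 1/m turns into eps. *)
pose e : R := Num.min 1 (eps ^+ m / (2 * D ^+ 2 + 1)).
have D20 : 0 < 2 * D ^+ 2 + 1 by rewrite ltr_wpDl // mulr_ge0 // sqr_ge0.
have e0 : 0 < e by rewrite lt_min ltr01 divr_gt0 // exprn_gt0.
have e1 : e <= 1 by rewrite ge_min lexx.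
have aux (x y : R) : 0 <= y -> y <= 1 -> 2 * (x * y) ^+ 2 <= y * (2 * x ^+ 2).
  clear => y0 y1; have : 0 <= y * (2 * x ^+ 2) * (1 - y).
    apply: mulr_ge0; last by rewrite subr_ge0.
    by apply: mulr_ge0 => //; apply: mulr_ge0 => //; exact: sqr_ge0.
  by rewrite exprMn; lra.
have aux2 (x y z : R) : 0 <= y -> y * (4 * (x + 1)) <= z -> 2 * x * y <= z / 2.
  by clear => y0 yz; lra.
have eeps : 2 * (D * e) ^+ 2 <= eps ^+ m.
  have : e <= eps ^+ m / (2 * D ^+ 2 + 1) by rewrite ge_min lexx orbT.
  rewrite ler_pdivlMr // mulrDr mulr1 => h.
  apply: le_trans (_ : e * (2 * D ^+ 2) <= _); last by apply: le_trans h; rewrite lerDl ltW.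
  exact: aux (ltW e0) e1.
(* [r] makes the Lipschitz part of the approximation error at most e/2; the degree N found below
   does the same for the tail of the kernel. *)
pose r : R := Num.min (12^-1) (e / 2 / (K * L + 1)).
have KL0 : 0 < K * L + 1 by rewrite ltr_wpDl // mulr_ge0 // ltW.
have r0 : 0 < r by rewrite lt_min invr_gt0 ltr0n divr_gt0 // divr_gt0.
have r12 : r <= 12^-1 by rewrite ge_min lexx.
have Kr : K * (r * L) <= e / 2.
  have : r <= e / 2 / (K * L + 1) by rewrite ge_min lexx orbT.
  rewrite ler_pdivlMr // mulrDr mulr1 => h.
  by apply: le_trans h; rewrite mulrCA lerDl ltW.
have r2 : r <= 2^-1 by rewrite (le_trans r12) // lef_pV2 ?posrE // ler_nat.
have /andP[cr0 cr1] := cos_pi_lt1 r0 r2.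
have e40 : 0 < e / (4 * (B + 1)) by rewrite divr_gt0 // mulr_gt0 // ltr_wpDl.
have [N hN] := poly_geom_small d0 cr0 cr1 e40.
have BQ : 2 * B * ((N.*2.+1)%:R ^+ d * cos (pi * r) ^+ N.*2) <= e / 2.
  have B10 : 0 < 4 * (B + 1) by rewrite mulr_gt0 // ltr_wpDl.
  move: hN; rewrite ler_pdivlMr // => hN.
  have Q0 : 0 <= (N.*2.+1)%:R ^+ d * cos (pi * r) ^+ N.*2.
    exact: mulr_ge0 (exprn_ge0 d (ler0n R _)) (cos_even_ge0 _ _).
  exact: aux2 Q0 hN.
(* Cells of generation at most Gm then have side at least 3 * 2^(m * 2N), which exceeds the m * 2N
   needed for the orthogonality of products of m polynomials. *)
exists (Gm + m * N.*2)%N => J sel dl J0J hsel dl0.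
have GJ : (Gm <= J)%N by apply: leq_trans J0J; rewrite leq_addr.
pose h : R := L / (3 * 2 ^+ J).
have h0 : 0 < h by rewrite divr_gt0 // mulr_gt0 // exprn_gt0.
pose P := (3 * 2 ^ J)%N.
pose sd := side J.
have sd0 : forall g, (0 < sd g)%N := side_gt0 J.
have sdS : forall g, (sd g.+1 %| sd g)%N := side_dvdS J.
have sdP : forall g, (sd g %| P)%N := side_dvd J.
have sd2 : forall g, (g < J.+1)%N -> ((sd g.+1).*2 <= sd g)%N := @side_double J.
have sdG0 : sd J.+1 = 1%N := side_last J.
have Nsd g : (g < Gm.+1)%N -> (m * N.*2 < sd g)%N.
  by rewrite ltnS => gG; exact: side_large gG J0J.
pose gn := time_gen Gm.
have gnG k : (gn k < Gm.+1)%N by rewrite ltnS leq_subr.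
pose an (k : nat) := (k * 2 ^ gn k)%N; pose b := (12 * 2 ^ Gm)%N.
have b0 : (0 < b)%N by rewrite muln_gt0 expn_gt0.
have kb k : (0 < k <= 2 ^ Gm)%N -> (b <= 24 * an k)%N /\ (an k <= 2 ^ Gm)%N.
  exact: time_genP.
have anb k : (0 < k <= 2 ^ Gm)%N -> (an k <= b)%N.
  by move=> /kb[_ h1]; apply: leq_trans h1 _; rewrite /b leq_pmull.
have hsd g : (g <= J)%N -> h * (sd g)%:R = L / 2 ^+ g.
  move=> gJ; rewrite /sd /side gJ /h natrM natrX.
  have -> : (2 : R) ^+ J = 2 ^+ (J - g) * 2 ^+ g by rewrite -exprD subnK.
  by field; rewrite !expf_neq0 // pnatr_eq0.
have gnJ k : (gn k <= J)%N by apply: leq_trans GJ; rewrite leq_subr.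
have tE k : (k%:R * (L / (12 * 2 ^+ Gm))) / (h * (sd (gn k))%:R) = (an k)%:R / b%:R.
  rewrite hsd // /an /b !natrM !natrX; field.
  by rewrite !expf_neq0 ?pnatr_eq0 // gt_eqF.
have P0 : (0 < (2 ^ J).*2)%N by rewrite double_gt0 expn_gt0.
have embP (al : bool) (i : 'I_((2 ^ J).*2)) : (i + al * 2 ^ J < P)%N.
  have hi := ltn_ord i; rewrite -[X in (_ < X)%N]addnn in hi.
  apply: (@leq_trans (2 ^ J + 2 ^ J + al * 2 ^ J)%N); first by rewrite ltn_add2r.
  by rewrite /P !mulSn mul0n addn0 addnA leq_add2l; case: al => //=; rewrite ?mul1n ?mul0n.
pose emb (al : {ffun 'I_d -> bool}) (y : {ffun 'I_d -> 'I_((2 ^ J).*2)}) : {ffun 'I_d -> 'I_P} :=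
  [ffun j => Ordinal (embP (al j) (y j))].
(* A left inverse of [emb]. The reduction modulo (2^J).*2 only supplies values off the image, so
   that a time is selected at every point of the translated grid. *)
pose pull (al : {ffun 'I_d -> bool}) (x : {ffun 'I_d -> 'I_P}) : {ffun 'I_d -> 'I_((2 ^ J).*2)} :=
  [ffun j => Ordinal (ltn_pmod (x j - al j * 2 ^ J) P0)].
have pullK al y : pull al (emb al y) = y.
  apply/ffunP => j; apply: val_inj; rewrite !ffunE /= addnK modn_small //.
(* The translate is chosen coordinatewise: a shift exactly where y is too close to a face of its
   cell. *)
pose alp (y : {ffun 'I_d -> 'I_((2 ^ J).*2)}) : {ffun 'I_d -> bool} :=
  let sg := sd (gn (sel y)) in [ffun j => ~~ (sg <= 6 * (y j %% sg) <= 5 * sg)%N].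
have posE al y : pos (fun=> - (L / 3)) h y = pos (corner L al) h (emb al y).
  apply: funext => j; rewrite /pos /corner ffunE /= natrD natrM natrX.
  by rewrite /h; field; rewrite expf_neq0 // pnatr_eq0.
pose Phi al (x : {ffun 'I_d -> 'I_P}) : R :=
  let k := sel (pull al x) in
  nsq (trig_average sigma N (sd (gn k)) (fun i y => f i (pos (corner L al) h y))
    ((an k)%:R / b%:R) x) `^ p.
have Phi0 al x : 0 <= Phi al x by exact: powR_ge0.
have pt y : nsq (average sigma f ((sel y)%:R * (L / (12 * 2 ^+ Gm)))
     (pos (fun=> - (L / 3)) h y)) `^ p <= 2 `^ p * Phi (alp y) (emb (alp y) y) + eps.
  rewrite (posE (alp y)) /Phi pullK -tE.
  set t := _ * _ : R; set k := sel y; set z := emb _ y.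
  have t0 : 0 <= t by rewrite mulr_ge0 // divr_ge0 ?(ltW L0) // mulr_ge0 // exprn_ge0.
  have Ns : (N.*2 < sd (gn k))%N.
    by apply: leq_ltn_trans (Nsd _ (gnG k)); rewrite leq_pmull.
  have ts : t <= h * (sd (gn k))%:R / 12.
    have hsk : 0 < h * (sd (gn k))%:R by rewrite mulr_gt0 // ltr0n.
    rewrite mulrC -ler_pdivrMr // /t tE /b natrM invfM mulrCA.
    rewrite -[leRHS]mulr1 ler_wpM2l ?invr_ge0 // ler_pdivrMr ?ltr0n ?expn_gt0 // mul1r ler_nat.
    by have [_] := kb _ (hsel y).
  have zs j : (sd (gn k) <= 6 * (z j %% sd (gn k)) <= 5 * sd (gn k))%N.
    have zE : z j = (y j + (~~ (sd (gn k) <= 6 * (y j %% sd (gn k)) <= 5 * sd (gn k))) *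
        2 ^ J)%N :> nat by rewrite /z ffunE /= /alp ffunE.
    rewrite zE; have [hz|hz] := boolP (sd (gn k) <= 6 * (y j %% sd (gn k)) <= 5 * sd (gn k))%N.
      by rewrite mul0n addn0.
    by move: hz; rewrite mul1n /sd /side gnJ; exact: one_third.
  pose e' := K * (r * (h * (sd (gn k))%:R)) +
      2 * B * ((N.*2.+1)%:R ^+ d * cos (pi * r) ^+ N.*2).
  have e'e : e' <= e.
    have : K * (r * (h * (sd (gn k))%:R)) <= K * (r * L).
      rewrite ler_wpM2l // ler_wpM2l ?(ltW r0) // hsd // ler_pdivrMr ?exprn_gt0 //.
      by rewrite ler_peMr ?(ltW L0) // exprn_ege1 // ler1n.
    by rewrite /e' => h1; rewrite (_ : e = e / 2 + e / 2) ?lerD // ?(le_trans h1) //; exact: splitr.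
  have cl := average_trig_close sigma_ball (corner L (alp y)) (sd0 _) (sdP _) Ns h0 r0 r12 t0 ts zs hf (erefl e')
    (le_trans e'e e1).
  move: cl; set a1 := average _ _ _ _; set a2 := trig_average _ _ _ _ _ _ => cl.
  have {}cl : cabs (a1 - a2) <= D * e.
    rewrite mulrA in cl; apply: le_trans cl _; exact: ler_wpM2l D0 _ _ e'e.
  have h2 : nsq a1 <= 2 * nsq a2 + eps ^+ m.
    rewrite -[a1](subrK a2) addrC; apply: le_trans (nsqD_le _ _) _; rewrite lerD2l.
    apply: le_trans eeps; rewrite ler_wpM2l // -sqr_cabs lerXn2r ?nnegrE ?cabs_ge0 //.
    by rewrite mulr_ge0 // ltW.
  have n20 : 0 <= 2 * nsq a2 by rewrite mulr_ge0 ?nsq_ge0.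
  have em0 : 0 <= eps ^+ m by rewrite exprn_ge0 // ltW.
  apply: (@le_trans _ _ ((2 * nsq a2 + eps ^+ m) `^ p)).
    by apply: ge0_ler_powR; rewrite ?nnegrE ?nsq_ge0 // addr_ge0.
  apply: le_trans (powR_invnD (ltn0Sn q) n20 em0) _; rewrite powRM ?nsq_ge0 //.
  by rewrite lerD2l -powR_mulrn ?(ltW eps0) // -powRrM /p mulfV ?pnatr_eq0 // powRr1 // ltW.
apply: (@le_trans _ _ (\sum_y (2 `^ p * Phi (alp y) (emb (alp y) y) + eps))).
  by apply: ler_sum => y _; exact: pt.
rewrite big_split /= sumr_const mulr_natr; apply: lerD => //.
rewrite -mulr_sumr -mulrA ler_wpM2l ?powR_ge0 //.
(* The translate depends on y; summing over all 2^d of them removes this dependence. *)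
apply: (@le_trans _ _ (\sum_al \sum_x Phi al x)).
  apply: (@le_trans _ _ (\sum_al \sum_y Phi al (emb al y))); last first.
    apply: ler_sum => al _; apply: sum_inj_le => // x y h1.
    by rewrite -(pullK al x) h1 pullK.
  rewrite exchange_big /=; apply: ler_sum => y _.
  by rewrite (bigD1 (alp y)) //= lerDl sumr_ge0.
rewrite mulr_sumr; apply: ler_sum => al _.
have := hmax N P Gm.+1 J.+1 b sd (@sigma_hat R q.+1 d sigma N)
  (fun i x => f i (pos (corner L al) h x)) (fun x => gn (sel (pull al x)))
  (fun x => an (sel (pull al x))) dl GJ sd0 sdP sdS sd2 sdG0 Nsd (@hdec N) _ b0 _ _ _ dl0.
apply.
- move=> u v n k v0; exact: sigma_hat_differences.
- by move=> x; exact: gnG.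
- by move=> x; have [] := kb _ (hsel (pull al x)).
- by move=> x; exact: anb.
Qed.
End GridMaximal.

Local Open Scope classical_set_scope.

(** * Integrals, cubes and Riemann sums *)

Section Nonnegative.
Context (R : realType) (dsp : measure_display) (T : measurableType dsp).
Variable mu : {measure set T -> \bar R}.

(** The integral of a nonnegative function is a supremum over the simple functions below it, so it
    is monotone without measurability. The maximal operator is estimated in this way. *)
Lemma integral_le_nonmeasurable (f g : T -> \bar R) :
  (forall x, (0 <= f x)%E) -> (forall x, (f x <= g x)%E) ->
  (\int[mu]_x f x <= \int[mu]_x g x)%E.
Proof.
move=> f0 fg; have g0 x : (0 <= g x)%E by exact: le_trans (f0 x) (fg x).
rewrite !ge0_integralTE //; apply: le_ereal_sup => _ [h hf <-].
by exists h => // x; apply: le_trans (hf x) (fg x).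
Qed.
End Nonnegative.

Section Cubes.
Variables (R : realType) (d : nat).
Variable lam : {measure set (d.-tuple R) -> \bar R}.
Hypothesis lamP : is_lebesgue_measure lam.

Definition cube (a : 'I_d -> R) (l : R) : set (d.-tuple R) :=
  [set x | forall j, a j <= tnth x j <= a j + l].

Lemma measurable_cube a l : measurable (cube a l).
Proof. exact: box_measurable. Qed.

Lemma lam_cube a l : 0 <= l -> lam (cube a l) = (l ^+ d)%:E.
Proof.
move=> l0; have := lamP (a := [tuple a j | j < d]) (b := [tuple a j + l | j < d]).
have -> : [set x : d.-tuple R | forall j, tnth [tuple a j | j < d] j <= tnth x j <=
   tnth [tuple a j + l | j < d] j] = cube a l.
  by apply/seteqP; split => x h j; have := h j; rewrite !tnth_mktuple.
move=> ->; last by move=> j; rewrite !tnth_mktuple lerDl.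
congr (_%:E); rewrite -[X in _ ^+ X](card_ord d) -prodr_const; apply: eq_bigr => j _.
by rewrite !tnth_mktuple; ring.
Qed.

Definition step (Y : finType) (c : Y -> 'I_d -> R) (l : R) (v : Y -> R) (x : d.-tuple R) : R :=
  \sum_y v y * \1_(cube (c y) l) x.


Lemma step_ge0 (Y : finType) (c : Y -> 'I_d -> R) (l : R) (v : Y -> R) x :
  (forall y, 0 <= v y) -> 0 <= step c l v x.
Proof. by move=> v0; rewrite sumr_ge0 // => y _; rewrite mulr_ge0. Qed.

Lemma integral_step (Y : finType) (c : Y -> 'I_d -> R) (l : R) (v : Y -> R) :
  0 <= l -> (forall y, 0 <= v y) ->
  (\int[lam]_x (step c l v x)%:E = (\sum_y v y * l ^+ d)%:E)%E.
Proof.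
move=> l0 v0; rewrite /step.
under eq_integral do rewrite -sumEFin.
have mi y : measurable_fun [set: d.-tuple R] (fun x => (\1_(cube (c y) l) x : R)).
  by apply: measurable_indic; exact: measurable_cube.
rewrite ge0_integral_sum //.
- rewrite -sumEFin; apply: eq_bigr => y _.
  under eq_integral do rewrite EFinM.
  rewrite ge0_integralZl_EFin //; last exact/measurable_EFinP.
  by rewrite integral_indic ?setIT ?lam_cube //; exact: measurable_cube.
- by move=> y; apply/measurable_EFinP; apply: measurable_funM.
- by move=> y x _; rewrite lee_fin mulr_ge0.
Qed.

Lemma upper_riemann (Y : finType) (c : Y -> 'I_d -> R) (l : R) (v : Y -> R)
  (phi : d.-tuple R -> R) : 0 <= l -> (forall y, 0 <= v y) -> (forall x, 0 <= phi x) ->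
  (forall x, phi x != 0 -> exists y, cube (c y) l x /\ phi x <= v y) ->
  (\int[lam]_x (phi x)%:E <= (\sum_y v y * l ^+ d)%:E)%E.
Proof.
move=> l0 v0 phi0 h; rewrite -(integral_step c l0 v0).
apply: integral_le_nonmeasurable => x; rewrite lee_fin //.
have [->|/h [y [cy vy]]] := eqVneq (phi x) 0; first exact: step_ge0.
rewrite /step (bigD1 y) //= indicE mem_set // mulr1 -[leLHS]addr0 lerD // sumr_ge0 // => z _.
by rewrite mulr_ge0.
Qed.

(** Disjointness ensures that at most one term of the step function is nonzero at each point;
    overlapping cubes would count mass twice. *)
Lemma lower_riemann (Y : finType) (c : Y -> 'I_d -> R) (l : R) (v : Y -> R)
  (g : d.-tuple R -> R) (D : set (d.-tuple R)) (e : R) : 0 <= l -> (forall y, 0 <= v y) ->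
  measurable D -> measurable_fun setT g -> (forall x, 0 <= g x) -> 0 <= e ->
  (forall y z x, cube (c y) l x -> cube (c z) l x -> y = z) ->
  (forall y x, cube (c y) l x -> D x /\ v y <= g x + e) ->
  ((\sum_y v y * l ^+ d)%:E <= \int[lam]_(x in D) (g x)%:E + e%:E * lam D)%E.
Proof.
move=> l0 v0 mD mg g0 e0 disj h; rewrite -(integral_step c l0 v0).
apply: (@le_trans _ _ (\int[lam]_(x in D) (g x + e)%:E)%E).
  rewrite [leRHS]integral_mkcond; apply: integral_le_nonmeasurable => x.
    by rewrite lee_fin step_ge0.
  have s0 : (forall y, ~ cube (c y) l x) -> step c l v x = 0.
    by move=> hn; apply: big1 => y _; rewrite indicE memNset ?mulr0.
  have [[y cy]|ny] := pselect (exists y, cube (c y) l x); last first.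
    rewrite s0; last by move=> y cy; apply: ny; exists y.
    by rewrite patchE; case: ifP => // _; rewrite lee_fin addr_ge0.
  have [Dx vg] := h y x cy; rewrite patchE mem_set // lee_fin.
  rewrite /step (bigD1 y) //= indicE mem_set // mulr1 big1 ?addr0 // => z zy.
  by rewrite indicE memNset ?mulr0 // => cz; move: zy; rewrite (disj y z x cy cz) eqxx.
under eq_integral do rewrite EFinD.
rewrite ge0_integralD //.
- by rewrite integral_cst.
- by move=> x _; rewrite lee_fin.
- by apply/measurable_EFinP; exact: measurable_funTS.
Qed.
End Cubes.

(** * Passage to the limit and regularity of the averages *)

Section PowerLimits.
Variable R : realType.

Lemma prod_add_le (I : Type) (r : seq I) (a : I -> R) : (forall i, 0 <= a i) ->
  exists K : R, 0 <= K /\ forall t, 0 <= t -> t <= 1 ->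
    \prod_(i <- r) (a i + t) <= \prod_(i <- r) a i + K * t.
Proof.
move=> a0; elim: r => [|x r [K [K0 IH]]].
  by exists 0; split => // t _ _; rewrite !big_nil mul0r addr0.
have P0 : 0 <= \prod_(i <- r) a i by rewrite prodr_ge0.
have aK : 0 <= a x * K by exact: mulr_ge0.
exists (a x * K + \prod_(i <- r) a i + K); split; first by rewrite !addr_ge0.
move=> t t0 t1; rewrite !big_cons.
have := ler_wpM2l (addr_ge0 (a0 x) t0) (IH t t0 t1) => h; apply: le_trans h _.
have : K * t * t <= K * t by rewrite ler_piMr // mulr_ge0.
by move: (\prod_(i <- r) a i) P0 => P P0; lra.
Qed.

(** The limit e -> 0 with an explicit e: the product changes at most linearly in c e, and
    subadditivity of t^(1/m) turns an error w^m into w. *)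
Lemma limit_bound (m : nat) (x C c : R) (a : 'I_m -> R) : (0 < m)%N ->
  0 <= C -> 0 <= c -> (forall i, 0 <= a i) ->
  (forall e, 0 < e -> e <= 1 -> x <= C * \prod_i (a i + c * e) `^ (m%:R^-1) + c * e) ->
  x <= C * \prod_i a i `^ (m%:R^-1).
Proof.
move=> m0 C0 c0 a0 hx; have [K [K0 hK]] := prod_add_le (index_enum 'I_m) a0.
have mR : m%:R != 0 :> R by rewrite pnatr_eq0 -lt0n.
have p0 : 0 <= m%:R^-1 :> R by rewrite invr_ge0.
apply/ler_addgt0Pr => eta eta0.
pose w : R := eta / 2 / (C + 1).
have w0 : 0 < w by rewrite !divr_gt0 // ltr_wpDl.
pose b : R := K * c + c + 1.
have b0 : 0 < b by rewrite ltr_wpDl // addr_ge0 // mulr_ge0.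
pose e : R := Num.min (Num.min 1 (eta / 2)) (w ^+ m) / b.
have e0 : 0 < e by rewrite divr_gt0 // !lt_min ltr01 divr_gt0 //= exprn_gt0.
have eb : e * b = Num.min (Num.min 1 (eta / 2)) (w ^+ m) by rewrite divfK // gt_eqF.
have hb z : 0 <= z -> z <= b -> z * e <= e * b.
  by move=> z0 zb; rewrite mulrC ler_wpM2l // ltW.
have Kc0 : 0 <= K * c by exact: mulr_ge0.
have b1 : e * b <= 1 by rewrite eb !ge_min lexx.
have b2 : e * b <= eta / 2 by rewrite eb !ge_min lexx orbT.
have b3 : e * b <= w ^+ m by rewrite eb !ge_min lexx !orbT.
have e1 : e <= 1.
  by apply: le_trans b1; rewrite -[leLHS]mul1r hb // /b; lra.
have ce : c * e <= e * b by apply: hb => //; rewrite /b; lra.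
apply: le_trans (hx e e0 e1) _.
have ce0 : 0 <= c * e by rewrite mulr_ge0 // ltW.
have ai0 i : 0 <= a i + c * e by rewrite addr_ge0.
rewrite -!powR_prod //.
have P0 : 0 <= \prod_i a i by rewrite prodr_ge0.
have h1 : \prod_i (a i + c * e) <= \prod_i a i + w ^+ m.
  apply: le_trans (hK _ ce0 (le_trans ce b1)) _; rewrite lerD2l mulrA.
  by apply: le_trans b3; apply: hb => //; rewrite /b; lra.
have wm0 : 0 <= w ^+ m by rewrite exprn_ge0 // ltW.
have h2 : (\prod_i (a i + c * e)) `^ (m%:R^-1) <= (\prod_i a i) `^ (m%:R^-1) + w.
  apply: le_trans (ge0_ler_powR p0 _ _ h1) _; rewrite ?nnegrE ?prodr_ge0 ?addr_ge0 //.
  apply: le_trans (powR_invnD m0 P0 wm0) _.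
  by rewrite lerD2l -powR_mulrn ?(ltW w0) // -powRrM mulfV // powRr1 // ltW.
have h3 := ler_wpM2l C0 h2.
have h4 : C * w <= eta / 2.
  by rewrite /w mulrA ler_pdivrMr ?ltr_wpDl // mulrC ler_wpM2l ?(ltW (divr_gt0 eta0 _)) // lerDl.
by have := le_trans ce b2; rewrite mulrDr in h3; lra.
Qed.
End PowerLimits.
Lemma powR_invn_close (R : realType) (m : nat) (x y e : R) : (0 < m)%N -> 0 <= x -> 0 <= y ->
  0 <= e -> x <= y + e ^+ m -> x `^ (m%:R^-1) <= y `^ (m%:R^-1) + e.
Proof.
move=> m0 x0 y0 e0 h; have em0 : 0 <= e ^+ m by exact: exprn_ge0.
have p0 : 0 <= m%:R^-1 :> R by rewrite invr_ge0.
apply: (@le_trans _ _ ((y + e ^+ m) `^ (m%:R^-1))).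
  by apply: ge0_ler_powR; rewrite ?nnegrE // addr_ge0.
apply: le_trans (powR_invnD m0 y0 em0) _.
by rewrite lerD2l -powR_mulrn // -powRrM mulfV ?pnatr_eq0 -?lt0n // powRr1.
Qed.

Lemma ex_argmax (R : realType) (n : nat) (F : 'I_n -> R) : (0 < n)%N ->
  exists k, forall i, F i <= F k.
Proof.
move=> n0; exists [arg max_(k > Ordinal n0) F k]%O.
by case: arg_maxP => // k _ h i; exact: h.
Qed.

Section AverageRegularity.
Variables (R : realType) (m d : nat).
Variable sigma : {finite_measure set (m.-tuple (d.-tuple R)) -> \bar R}.
Hypothesis sigma_ball : sigma [set y | 1 < tnorm y] = 0%E.
Variables (f : 'I_m -> ('I_d -> R) -> R[i]) (K B : R).
Hypothesis hf : forall i, sup_lipschitz (f i) K B.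

Lemma nsq_close (a b : R[i]) (M e : R) : cabs a <= M -> cabs b <= M -> cabs (a - b) <= e ->
  nsq a <= nsq b + 2 * M * e.
Proof.
move=> aM bM ab; rewrite -!sqr_cabs.
have h : cabs a <= cabs b + e.
  by rewrite -[a](subrK b) addrC; apply: le_trans (cabsD _ _) _; rewrite lerD2l.
have e0 : 0 <= e by apply: le_trans ab; apply: cabs_ge0.
have a0 := cabs_ge0 a; have b0 := cabs_ge0 b.
have [ba|ba] := leP (cabs a) (cabs b).
  have : cabs a ^+ 2 <= cabs b ^+ 2 by rewrite lerXn2r.
  have : 0 <= 2 * M * e by rewrite mulr_ge0 // mulr_ge0 // (le_trans a0).
  lra.
have h1 : cabs a - cabs b <= e by lra.
have h2 : 0 <= cabs a - cabs b by lra.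
have : (cabs a - cabs b) * (cabs a + cabs b) <= e * (2 * M).
  by apply: ler_pM => //; lra.
lra.
Qed.

(** As y lies in the unit ball, a change of (t, z) moves each coordinate of z - t y by at most |z_j
    - z'_j| + |t - t'|. *)
Lemma nsq_average_lipschitz : exists E : R, 0 <= E /\ forall (t t' : R) (z z' : 'I_d -> R) e,
  0 <= e -> (forall j, `|z j - z' j| + `|t - t'| <= e) ->
  nsq (average sigma f t z) <= nsq (average sigma f t' z') + E * e.
Proof.
have [m0|] := posnP m.
  exists 0; split => // t t' z z' e _ _; rewrite mul0r addr0 le_eqVlt; apply/orP; left; apply/eqP.
  congr (nsq (Cintegral _ _)); apply: funext => y; apply: eq_bigr => i.
  by have := ltn_ord i; rewrite {2}m0.
move=> m0; have K0 : 0 <= K by have [] := hf (Ordinal m0).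
have B0 : 0 <= B.
  by have [_ /(_ (fun=> 0)) + _] := hf (Ordinal m0); apply: le_trans; exact: cabs_ge0.
have B10 : 0 <= B + 1 by exact: addr_ge0.
have B11 : 1 <= B + 1 by rewrite lerDr.
have fB1 i z : cabs (f i z) <= B + 1 by have [_ fB _] := hf i; rewrite (le_trans (fB z)) ?lerDl.
pose S2 := 2 * fine (sigma setT).
have S20 : 0 <= S2 by rewrite mulr_ge0 // fine_ge0.
pose M := S2 * (B + 1) ^+ m.
have M0 : 0 <= M by apply: mulr_ge0 => //; apply: exprn_ge0.
have bav t z : cabs (average sigma f t z) <= M.
  apply: (@cabs_Cintegral_le R _ _ sigma _ (fun y => \prod_i f i (fun j => z j - t * tnth (tnth y i) j))
     ((B + 1) ^+ m) (@measurable_outside R m d) sigma_ball).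
  - exact: average_bmeas hf.
  - exact: exprn_ge0.
  move=> y _; rewrite cabs_prod -[X in _ ^+ X](card_ord m) -prodr_const.
  by apply: ler_prod => i _; rewrite cabs_ge0 fB1.
pose E := 2 * M * (S2 * (m%:R * (B + 1) ^+ m * K)).
exists E; split.
  apply: mulr_ge0; first exact: mulr_ge0.
  by apply: mulr_ge0 => //; apply: mulr_ge0 => //; apply: mulr_ge0 => //; apply: exprn_ge0.
move=> t t' z z' e e0 zz.
have := @nsq_close (average sigma f t z) (average sigma f t' z') M
  (S2 * (m%:R * (B + 1) ^+ m * (K * e))) (bav _ _) (bav _ _).
have -> : 2 * M * (S2 * (m%:R * (B + 1) ^+ m * (K * e))) = E * e by rewrite /E; ring.
apply; apply: average_close => //.
- exact: mulr_ge0.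
- by move=> i; exact: (sup_lipschitz_bmeas (phi := fun y => tnth y i) t _ (hf i) (measurable_tnth i)).
- by move=> i; exact: (sup_lipschitz_bmeas (phi := fun y => tnth y i) t' _ (hf i) (measurable_tnth i)).
move=> i y hy; have [_ _ fK] := hf i; apply: fK => // j.
have y1 := coord_le1 i j hy.
have -> : z j - t * tnth (tnth y i) j - (z' j - t' * tnth (tnth y i) j) =
   (z j - z' j) - (t - t') * tnth (tnth y i) j by ring.
apply: le_trans (ler_normB _ _) _; apply: le_trans (zz j); rewrite lerD2l normrM.
by rewrite ler_piMr.
Qed.
End AverageRegularity.

(** * From grid sums to integrals over a box *)

Section LocalIntegral.
Variable R : realType.

Lemma grid_cover (n : nat) (h u : R) : (0 < n)%N -> 0 < h -> 0 <= u -> u <= h * n%:R ->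
  exists i : 'I_n, h * i%:R <= u <= h * i%:R + h.
Proof.
move=> n0 h0 u0 un; pose k := Num.truncn (u / h).
have uh0 : 0 <= u / h by rewrite divr_ge0 // ltW.
have /andP[k1 k2] := truncn_itv uh0; rewrite -/k in k1 k2.
rewrite (ler_pdivlMr _ _ h0) mulrC in k1; rewrite (ltr_pdivrMr _ _ h0) -natr1 mulrDl mul1r [k%:R * h]mulrC in k2.
have [kn|nk] := ltnP k n; first by exists (Ordinal kn); rewrite /= k1 ltW.
have n1 : (n.-1 < n)%N by rewrite prednK.
exists (Ordinal n1) => /=.
have e : h * n.-1%:R + h = h * n%:R by rewrite -[in RHS](prednK n0) -natr1; ring.
rewrite e un andbT; apply: le_trans k1; rewrite ler_wpM2l ?(ltW h0) // ler_nat.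
by apply: leq_trans nk; rewrite leq_pred.
Qed.

Lemma small_mesh (L eta : R) (J0 : nat) : 0 < L -> 0 < eta ->
  exists J : nat, (J0 <= J)%N /\ L / (3 * 2 ^+ J) <= eta.
Proof.
move=> L0 eta0; pose J := (J0 + (Num.truncn (L / eta)).+1)%N; exists J; split.
  exact: leq_addr.
have h0 : 0 <= L / eta by rewrite divr_ge0 // ltW.
have /andP[_ h] := truncn_itv h0.
have hJ : L / eta <= 3 * 2 ^+ J.
  apply: le_trans (ltW h) _; rewrite -natrX -natrM ler_nat.
  apply: leq_trans (_ : J <= _)%N; first exact: leq_addl.
  by apply: leq_trans (ltnW (ltn_expl J (ltnSn 1))) _; rewrite leq_pmull.
have p0 : 0 < 3 * 2 ^+ J :> R by rewrite mulr_gt0 // exprn_gt0.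
by rewrite ler_pdivrMr // mulrC -ler_pdivrMr.
Qed.

Variables (q d : nat).
Variable sigma : {finite_measure set (q.+1.-tuple (d.-tuple R)) -> \bar R}.
Hypothesis sigma_ball : sigma [set y | 1 < tnorm y] = 0%E.
Variable lam : {measure set (d.-tuple R) -> \bar R}.
Hypothesis lamP : is_lebesgue_measure lam.

Definition local_sup (f : 'I_q.+1 -> ('I_d -> R) -> R[i]) (L : R) (Gm : nat) (x : d.-tuple R) : R :=
  \1_(cube (fun=> - (L / 3)) (2 * L / 3)) x * \big[Num.max/0]_(k < 2 ^ Gm)
    nsq (average sigma f (k.+1%:R * (L / (12 * 2 ^+ Gm))) (tnth x)) `^ (q.+1%:R^-1).

Lemma bigmax_ge0 n (F : 'I_n -> R) : 0 <= \big[Num.max/0]_(k < n) F k.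
Proof. exact: bigmax_ge_id. Qed.

Lemma local_sup_ge0 f L Gm x : 0 <= local_sup f L Gm x.
Proof. by rewrite mulr_ge0 // bigmax_ge0. Qed.

Lemma measurable_bigmax (I : Type) (r : seq I) (F : I -> d.-tuple R -> R) :
  (forall k, measurable_fun setT (F k)) ->
  measurable_fun setT (fun x => \big[Num.max/0]_(k <- r) F k x).
Proof.
move=> mF; elim: r => [|k r IH].
  by under eq_fun do rewrite big_nil; exact: measurable_cst.
by under eq_fun do rewrite big_cons; exact: measurable_maxr.
Qed.

Lemma measurable_nsq_average f K B t : (forall i, sup_lipschitz (f i) K B) ->
  measurable_fun setT (fun x : d.-tuple R => nsq (average sigma f t (tnth x))).
Proof.
move=> hf; have [E [E0 hE]] := nsq_average_lipschitz sigma_ball hf.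
apply: (lipschitz_measurable E0) => x y e e0 xy.
have H (u v : d.-tuple R) : (forall j, `|tnth u j - tnth v j| <= e) ->
    nsq (average sigma f t (tnth u)) <= nsq (average sigma f t (tnth v)) + E * e.
  by move=> uv; apply: hE => // j; rewrite subrr normr0 addr0.
have h1 := H x y xy; have h2 : nsq (average sigma f t (tnth y)) <=
   nsq (average sigma f t (tnth x)) + E * e by apply: H => j; rewrite distrC.
by rewrite ler_norml; apply/andP; split; lra.
Qed.

Lemma measurable_local_sup f K B L Gm : (forall i, sup_lipschitz (f i) K B) ->
  measurable_fun setT (local_sup f L Gm).
Proof.
move=> hf; apply: measurable_funM.
  by apply: measurable_indic; exact: measurable_cube.
apply: measurable_bigmax => k.
apply: (measurableT_comp (measurable_powR _)).
exact: measurable_nsq_average hf.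
Qed.

(** Closed cubes of side h would share faces. Halving the side makes those at distinct grid points
    disjoint, at the price of a factor 2^d in the lower sums. *)
Lemma cube_half_disjoint (P : nat) (A : 'I_d -> R) (h : R) (y z : {ffun 'I_d -> 'I_P}) x :
  0 < h -> cube (pos A h y) (h / 2) x -> cube (pos A h z) (h / 2) x -> y = z.
Proof.
move=> h0 cy cz; apply/ffunP => j; apply: val_inj.
have lt1 (a b : nat) (w : R) : A j + h * a%:R <= w -> w <= A j + h * b%:R + h / 2 -> (a <= b)%N.
  move=> h1 h2; rewrite leqNgt -ltnS; apply/negP; rewrite ltnS => ba.
  have : h * (b.+1)%:R <= h * a%:R by rewrite ler_wpM2l ?(ltW h0) // ler_nat.
  by rewrite -natr1 mulrDr; lra.
have /andP[y1 y2] := cy j; have /andP[z1 z2] := cz j.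
by apply/eqP; rewrite eqn_leq (lt1 _ _ _ y1 z2) (lt1 _ _ _ z1 y2).
Qed.

Lemma cube_dist (a : 'I_d -> R) l (x : d.-tuple R) j : 0 <= l -> cube a l x ->
  `|tnth x j - a j| <= l.
Proof. by move=> l0 h; have /andP[h1 h2] := h j; rewrite ler_norml; apply/andP; split; lra. Qed.

Lemma corner_cube_sub (J : nat) (L : R) (h := L / (3 * 2 ^+ J)) (al : {ffun 'I_d -> bool})
  (y : {ffun 'I_d -> 'I_(3 * 2 ^ J)}) (x : d.-tuple R) : 0 < L ->
  cube (pos (corner L al) h y) (h / 2) x -> cube (fun=> - (2 * L / 3)) (4 * L / 3) x.
Proof.
move=> L0 cy j; have h0 : 0 < h by rewrite divr_gt0 // mulr_gt0 // exprn_gt0.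
have /andP[y1 y2] := cy j; rewrite /pos /corner in y1 y2.
have y3 : 0 <= h * (y j)%:R by rewrite mulr_ge0 // ltW.
have y4 : h * (y j)%:R + h <= L.
  have -> : L = h * (3 * 2 ^ J)%:R.
    by rewrite natrM natrX /h; field; rewrite expf_neq0 // pnatr_eq0.
  have -> : h * (y j)%:R + h = h * (y j).+1%:R by rewrite -natr1 mulrDr mulr1.
  by rewrite ler_wpM2l ?(ltW h0) // ler_nat; exact: ltn_ord.
have L30 : 0 <= L / 3 by rewrite divr_ge0 // ltW.
have al01 : 0 <= (al j)%:R * (L / 3) <= L / 3.
  by case: (al j); rewrite ?mul1r ?mul0r lexx L30.
by have /andP[al0 al1] := al01; apply/andP; split; lra.
Qed.

Lemma box_grid_cover (J : nat) (L : R) (h := L / (3 * 2 ^+ J)) (x : d.-tuple R) : 0 < L ->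
  cube (fun=> - (L / 3)) (2 * L / 3) x ->
  exists y : {ffun 'I_d -> 'I_((2 ^ J).*2)}, cube (pos (fun=> - (L / 3)) h y) h x.
Proof.
move=> L0 xD; have h0 : 0 < h by rewrite divr_gt0 // mulr_gt0 // exprn_gt0.
have P0 : (0 < (2 ^ J).*2)%N by rewrite double_gt0 expn_gt0.
have hP : h * ((2 ^ J).*2)%:R = 2 * L / 3.
  by rewrite -muln2 natrM natrX /h; field; rewrite expf_neq0 // pnatr_eq0.
have hj (j : 'I_d) : exists i : 'I_((2 ^ J).*2), h * i%:R <= tnth x j + L / 3 <= h * i%:R + h.
  have /andP[x1 x2] := xD j; apply: grid_cover => //; first by lra.
  by rewrite hP; lra.
have [yf hy] := choice hj; exists (finfun yf).
by move=> j; rewrite /pos ffunE; have /andP[y1 y2] := hy j; apply/andP; split; lra.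
Qed.

(** [I i] is the integral over a bounded box; being finite, it allows the limit of fine meshes to be
    taken in the reals. *)
Lemma local_integral_bound (s A : R) : (0 < q)%N -> (0 < d)%N ->
  q%:R * d%:R / 2 + 1 / 2 < s ->
  (forall xi, cabs (fourier_measure sigma xi) <= A * powR (1 + tnorm xi) (- s)) ->
  exists C : R, 0 < C /\ forall (f : 'I_q.+1 -> ('I_d -> R) -> R[i]) (K B L : R) (Gm : nat),
  (forall i, sup_lipschitz (f i) K B) -> 0 < L ->
  exists I : 'I_q.+1 -> R,
    (forall i, 0 <= I i) /\
    (forall i, ((I i)%:E <= \int[lam]_x (nsq (f i (tnth x)))%:E)%E) /\
    (\int[lam]_x (local_sup f L Gm x)%:E <= (C * \prod_i I i `^ (q.+1%:R^-1))%:E)%E.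
Proof.
move=> q0 d0 hs hA; have [C1 [C10 hgrid]] := grid_maximal sigma_ball q0 d0 hs hA.
pose m := q.+1; pose p : R := m%:R^-1.
have p0 : 0 <= p by rewrite invr_ge0.
pose N2 : R := #|{: {ffun 'I_d -> bool}}|%:R.
pose CC := C1 * N2.
have N20 : 0 < N2 by rewrite ltr0n; apply/card_gt0P; exists [ffun=> true].
have CC0 : 0 < CC by exact: mulr_gt0.
exists (CC * \prod_(i < m) (2 ^+ d) `^ p); split.
  by rewrite mulr_gt0 // prodr_gt0 // => i _; rewrite powR_gt0 // exprn_gt0.
move=> f K B L Gm hf L0.
have K0 : 0 <= K by have [] := hf ord0.
have B0 : 0 <= B by have [_ /(_ (fun=> 0)) + _] := hf ord0; apply: le_trans; exact: cabs_ge0.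
have [E [E0 hE]] := nsq_average_lipschitz sigma_ball hf.
pose g i (x : d.-tuple R) : R := nsq (f i (tnth x)).
have fB i z : cabs (f i z) <= B by have [_ ] := hf i.
have gB i x : g i x <= B ^+ 2 by rewrite /g -sqr_cabs lerXn2r ?nnegrE ?cabs_ge0.
have g0 i x : 0 <= g i x by exact: nsq_ge0.
have glip i (z w : 'I_d -> R) (e : R) : 0 <= e -> (forall j, `|z j - w j| <= e) ->
   nsq (f i z) <= nsq (f i w) + 2 * B * K * e.
  move=> e0 zw; rewrite -mulrA; apply: nsq_close => //.
  by have [_ _ fK] := hf i; exact: fK.
have mg i : measurable_fun setT (g i).
  have BK0 : 0 <= 2 * B * K by rewrite !mulr_ge0.
  apply: (lipschitz_measurable BK0) => x y e e0 xy.
  have h1 := glip i _ _ e e0 xy.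
  have h2 : g i y <= g i x + 2 * B * K * e by apply: glip => // j; rewrite distrC.
  by rewrite ler_norml; apply/andP; split; rewrite /g in h2 *; lra.
(* Contains all translates of the top cube, whose lower corners have coordinates -L/3 or -2L/3 and
   whose side is L. *)
pose D : set (d.-tuple R) := cube (fun=> - (2 * L / 3)) (4 * L / 3).
have mD : measurable D by exact: measurable_cube.
pose V : R := (4 * L / 3) ^+ d.
have V0 : 0 <= V by rewrite exprn_ge0 // divr_ge0 // mulr_ge0 // ltW.
have lamD : lam D = V%:E by apply: lam_cube => //; rewrite divr_ge0 // mulr_ge0 // ltW.
pose I i := fine (\int[lam]_(x in D) (g i x)%:E)%E.
have int0 i : (0 <= \int[lam]_(x in D) (g i x)%:E)%E.
  by apply: integral_ge0 => x _; rewrite lee_fin.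
have IE i : (\int[lam]_(x in D) (g i x)%:E)%E = (I i)%:E.
  rewrite /I fineK // ge0_fin_numE //.
  apply: (@le_lt_trans _ _ (\int[lam]_(x in D) (B ^+ 2)%:E)%E).
    apply: ge0_le_integral; [exact: mD|by move=> x _; rewrite lee_fin|
      |exact: measurable_cst|by move=> x _; rewrite lee_fin].
    by apply/measurable_EFinP; exact: measurable_funTS.
  by rewrite integral_cst // lamD -EFinM ltry.
have I0 i : 0 <= I i by rewrite fine_ge0.
exists I; split => //; split.
  move=> i; rewrite -IE; apply: ge0_subset_integral => //; first exact/measurable_EFinP.
  by move=> x _; rewrite lee_fin.
pose V0' : R := (2 * L / 3) ^+ d.
have V0'0 : 0 <= V0' by rewrite exprn_ge0 // divr_ge0 // mulr_ge0 // ltW.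
pose c : R := 2 ^+ d * V + 1 + 2 * V0'.
have c2 : 0 <= 2 ^+ d * V by rewrite mulr_ge0 // exprn_ge0.
have c0 : 0 <= c by rewrite /c addr_ge0 ?mulr_ge0 // addr_ge0.
pose a i := 2 ^+ d * I i.
have a0 i : 0 <= a i by rewrite mulr_ge0 // exprn_ge0.
have key e : 0 < e -> e <= 1 ->
  (\int[lam]_x (local_sup f L Gm x)%:E <= (CC * \prod_i (a i + c * e) `^ p + c * e)%:E)%E.
  move=> e0 e1.
  have [J0 hJ0] := hgrid f K B L e Gm hf L0 e0.
  (* Within a grid cell of this mesh, the squared averages vary by at most e^m, hence their powers
     1/m by at most e, and the squares of the f i by at most e. *)
  pose eta : R := Num.min (e ^+ m / (E + 1)) (e / (2 * B * K + 1)).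
  have E10 : 0 < E + 1 by rewrite ltr_wpDl.
  have BK10 : 0 < 2 * B * K + 1 by rewrite ltr_wpDl // !mulr_ge0.
  have eta0 : 0 < eta by rewrite lt_min !divr_gt0 // exprn_gt0.
  have [J [J0J hJ]] := small_mesh J0 L0 eta0.
  pose h := L / (3 * 2 ^+ J); rewrite -/h in hJ.
  have h0 : 0 < h by rewrite divr_gt0 // mulr_gt0 // exprn_gt0.
  have Eh : E * h <= e ^+ m.
    have : h <= e ^+ m / (E + 1) by apply: le_trans hJ _; rewrite ge_min lexx.
    rewrite ler_pdivlMr // mulrDr mulr1 => h1.
    by apply: le_trans h1; rewrite mulrC lerDl ltW.
  have BKh : 2 * B * K * h <= e.
    have : h <= e / (2 * B * K + 1) by apply: le_trans hJ _; rewrite ge_min lexx orbT.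
    rewrite ler_pdivlMr // mulrDr mulr1 => h1.
    by apply: le_trans h1; rewrite mulrC lerDl ltW.
  pose Y : finType := {ffun 'I_d -> 'I_((2 ^ J).*2)}.
  pose tau : R := L / (12 * 2 ^+ Gm).
  pose ps (y : Y) := pos (fun=> - (L / 3)) h y.
  pose av k (z : 'I_d -> R) : R := nsq (average sigma f (k.+1%:R * tau) z) `^ p.
  have av0 k z : 0 <= av k z by exact: powR_ge0.
  have G0 : (0 < 2 ^ Gm)%N by rewrite expn_gt0.
  (* The linearisation: each grid point selects a time at which its maximum is attained. *)
  have [best bestP] := choice (fun y : Y => ex_argmax (fun k : 'I_(2 ^ Gm) => av k (ps y)) G0).
  pose v (y : Y) := av (best y) (ps y) + e.
  have v0 y : 0 <= v y by rewrite addr_ge0 // ltW.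
  have em0 : 0 <= e ^+ m by rewrite exprn_ge0 // ltW.
  have avl k (z w : 'I_d -> R) : (forall j, `|z j - w j| <= h) -> av k z <= av k w + e.
    move=> zw; rewrite /av.
    have h1 : nsq (average sigma f (k.+1%:R * tau) z) <= nsq (average sigma f (k.+1%:R * tau) w) + e ^+ m.
      apply: le_trans (hE _ (k.+1%:R * tau) z w h (ltW h0) _) _; last by rewrite lerD2l.
      by move=> j; rewrite subrr normr0 addr0.
    exact: powR_invn_close (ltn0Sn q) (nsq_ge0 _) (nsq_ge0 _) (ltW e0) h1.
  have hP : h * ((2 ^ J).*2)%:R = 2 * L / 3.
    by rewrite -muln2 natrM natrX /h; field; rewrite expf_neq0 // pnatr_eq0.
  have up : (\int[lam]_x (local_sup f L Gm x)%:E <= (\sum_y v y * h ^+ d)%:E)%E.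
    apply: (upper_riemann lamP (c := ps) (ltW h0) v0 (local_sup_ge0 f L Gm)) => x.
    rewrite /local_sup indicE; case: (boolP (x \in _)) => [|_]; last by rewrite mul0r eqxx.
    rewrite inE => xD _; rewrite mul1r.
    have [y cy] := box_grid_cover J L0 xD; exists y.
    split => //; apply: bigmax_le; first exact: v0.
    move=> k _; apply: le_trans (avl k (tnth x) (ps y) _) _; last by rewrite lerD2r.
    by move=> j; exact: cube_dist (ltW h0) cy.
  have hd0 : 0 < h ^+ d by rewrite exprn_gt0.
  (* After multiplication by the cell volume h^d this floor becomes e. *)
  pose dl := e / h ^+ d; have dl0 : 0 < dl by rewrite divr_gt0.
  have hsel (y : Y) : (0 < (best y).+1 <= 2 ^ Gm)%N by rewrite ltn_ord.
  have := hJ0 J (fun y => (best y).+1) dl J0J hsel dl0; rewrite -/h -/tau -/p.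
  set TT := \sum_y _; set S := \sum_al _; move=> hTT.
  have TTE : \sum_y v y * h ^+ d = h ^+ d * TT + e * V0'.
    rewrite -mulr_suml mulrC big_split /= mulrDr; congr (_ + _).
    rewrite sumr_const -mulr_natr mulrCA; congr (_ * _).
    rewrite card_ffun !card_ord natrX -exprMn hP //.
  have YE : h ^+ d * (e * #|{: {ffun 'I_d -> 'I_((2 ^ J).*2)}}|%:R) = e * V0'.
    by rewrite mulrCA card_ffun !card_ord natrX -exprMn hP.
  have SE : h ^+ d * S <= N2 * \prod_i (a i + c * e) `^ p.
    rewrite mulr_sumr /N2 mulr_natl -sumr_const; apply: ler_sum => al _.
    have -> : h ^+ d = \prod_(i < m) (h ^+ d) `^ p.
      rewrite prodr_const card_ord -[RHS]powR_mulrn ?powR_ge0 // -powRrM.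
      by rewrite /p mulVf ?pnatr_eq0 // powRr1 // ltW.
    rewrite -big_split /=; apply: ler_prod => i _.
    rewrite mulr_ge0 ?powR_ge0 //=.
    have S0 : 0 <= \sum_(x : {ffun 'I_d -> 'I_(3 * 2 ^ J)}) nsq (f i (pos (corner L al) h x)).
      by rewrite sumr_ge0 // => x _; exact: nsq_ge0.
    rewrite -powRM ?(ltW hd0) //; last by rewrite addr_ge0 // ltW.
    apply: ge0_ler_powR => //; rewrite ?nnegrE.
    - by apply: mulr_ge0; [exact: ltW|rewrite addr_ge0 // ltW].
    - by rewrite addr_ge0 // mulr_ge0 // ltW.
    rewrite mulrDr /dl mulrCA mulfV ?mulr1 ?gt_eqF //.
    have h20 : 0 <= h / 2 by rewrite divr_ge0 // ltW.
    have lo := @lower_riemann R d lam lamP {ffun 'I_d -> 'I_(3 * 2 ^ J)} (pos (corner L al) h)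
      (h / 2) (fun x => nsq (f i (pos (corner L al) h x))) (g i) D e h20 (fun x => nsq_ge0 _)
      mD (mg i) (g0 i) (ltW e0) _ _.
    rewrite IE lamD -EFinM -EFinD lee_fin in lo.
    have {lo} : \sum_(x : {ffun 'I_d -> 'I_(3 * 2 ^ J)}) nsq (f i (pos (corner L al) h x)) *
       (h / 2) ^+ d <= I i + e * V.
      apply: lo; first by move=> y z x; exact: cube_half_disjoint.
      move=> y x cy; split; first exact: corner_cube_sub L0 cy.
      apply: le_trans (glip i _ (tnth x) h (ltW h0) _) _; last by rewrite lerD2l.
      move=> j; rewrite distrC; apply: le_trans (cube_dist j h20 cy) _.
      by rewrite ler_pdivrMr // ler_peMr ?(ltW h0) // ler1n.
    rewrite -mulr_suml expr_div_n mulrA ler_pdivrMr ?exprn_gt0 // => lo.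
    rewrite [leLHS](_ : _ = (\sum_(x : {ffun 'I_d -> 'I_(3 * 2 ^ J)})
      nsq (f i (pos (corner L al) h x))) * h ^+ d + e); last by rewrite mulrC.
    have e3 : 0 <= 2 * V0' * e by rewrite mulr_ge0 ?(ltW e0) // mulr_ge0.
    rewrite /a /c; lra.
  apply: le_trans up _; rewrite TTE lee_fin.
  have := ler_wpM2l (ltW hd0) hTT; rewrite mulrDr YE mulrCA => h1.
  have h2 := ler_wpM2l (ltW C10) SE; rewrite mulrA in h2.
  have e3 : 0 <= (2 ^+ d * V + 1) * e by rewrite mulr_ge0 ?(ltW e0) // addr_ge0.
  by apply: le_trans (lerD h1 (lexx _)) _; rewrite /CC /c; lra.
(* The bound with e = 1 shows that the integral is finite, so [limit_bound] applies to its real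
   value. *)
have fin : (\int[lam]_x (local_sup f L Gm x)%:E)%E \is a fin_num.
  rewrite ge0_fin_numE; last by apply: integral_ge0 => x _; rewrite lee_fin local_sup_ge0.
  by apply: le_lt_trans (key 1 ltr01 (lexx 1)) _; rewrite ltry.
rewrite -(fineK fin) lee_fin.
have -> : CC * \prod_(i < m) (2 ^+ d) `^ p * \prod_i I i `^ p = CC * \prod_i a i `^ p.
  rewrite -mulrA -big_split /=; congr (_ * _); apply: eq_bigr => i _.
  by rewrite /a powRM // exprn_ge0.
apply: (limit_bound (ltn0Sn q) (ltW CC0) c0 a0) => e e0 e1.
by have := key e e0 e1; rewrite -(fineK fin) lee_fin.
Qed.
End LocalIntegral.

Section Extended.
Variable R : realType.

Lemma lee_prod_EFin (I : Type) (r : seq I) (a : I -> R) (b : I -> \bar R) :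
  (forall i, 0 <= a i) -> (forall i, ((a i)%:E <= b i)%E) ->
  ((\prod_(i <- r) a i)%:E <= \prod_(i <- r) b i)%E.
Proof.
move=> a0 ab; elim: r => [|i r IH]; first by rewrite !big_nil.
by rewrite !big_cons EFinM; apply: lee_pmul => //; rewrite lee_fin // prodr_ge0.
Qed.

Lemma ge0_prode (I : Type) (r : seq I) (b : I -> \bar R) : (forall i, (0 <= b i)%E) ->
  (0 <= \prod_(i <- r) b i)%E.
Proof. by move=> b0; elim: r => [|k r IH]; rewrite ?big_nil ?big_cons ?lee01 ?mule_ge0. Qed.

Lemma poweR_prod (I : Type) (r : seq I) (b : I -> \bar R) (p : R) :
  (forall i, (0 <= b i)%E) ->
  ((\prod_(i <- r) b i) `^ p = \prod_(i <- r) (b i `^ p))%E.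
Proof.
move=> b0; elim: r => [|i r IH]; first by rewrite !big_nil poweR_EFin powR1.
by rewrite !big_cons poweRM ?ge0_prode // IH.
Qed.

Lemma nsq_powR (m : nat) (z : R[i]) : nsq z `^ (m%:R^-1) = cabs z `^ (2 / m%:R).
Proof. by rewrite -sqr_cabs -powR_mulrn ?cabs_ge0 // -powRrM. Qed.
End Extended.

(** * Exhaustion of space and time, and the conclusion *)

Section DyadicExhaustion.
Variables (R : realType) (q d : nat).
Variable sigma : {finite_measure set (q.+1.-tuple (d.-tuple R)) -> \bar R}.
Hypothesis sigma_ball : sigma [set y | 1 < tnorm y] = 0%E.
Variables (f : 'I_q.+1 -> ('I_d -> R) -> R[i]) (K B : R).
Hypothesis hf : forall i, sup_lipschitz (f i) K B.
Local Notation p := (q.+1%:R^-1 : R).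

(** The parameters refine everything together: the times are the multiples of 2^(-n) up to 2^n, and
    the box is [-4 * 2^n, 4 * 2^n]^d. *)
Definition dyadic_sup (n : nat) : d.-tuple R -> R := local_sup sigma f (12 * 2 ^+ n) n.*2.

Lemma dyadic_time n : 12 * 2 ^+ n / (12 * 2 ^+ n.*2) = (2 ^+ n)^-1 :> R.
Proof.
have n0 : (2 : R) ^+ n != 0 by rewrite expf_neq0 // pnatr_eq0.
by rewrite -addnn exprD; field.
Qed.

Lemma dyadic_sup_mono n x : dyadic_sup n x <= dyadic_sup n.+1 x.
Proof.
rewrite /dyadic_sup /local_sup; apply: ler_pM => //; first exact: bigmax_ge0.
  have sub : x \in cube (fun=> - (12 * 2 ^+ n / 3)) (2 * (12 * 2 ^+ n) / 3) ->
      x \in cube (fun=> - (12 * 2 ^+ n.+1 / 3)) (2 * (12 * 2 ^+ n.+1) / 3).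
    have w0 : 0 < 2 ^+ n :> R by rewrite exprn_gt0.
    rewrite !inE => h j; have /andP[h1 h2] := h j; rewrite exprS.
    by apply/andP; split; lra.
  by rewrite !indicE; case: (boolP (x \in _)) => [/sub ->|_].
apply: bigmax_le => [|k _]; first exact: bigmax_ge0.
(* Index k stands for the time k.+1 / 2^n = 2 k.+1 / 2^(n+1), which has index 2 k.+1 - 1 at the next
   level. *)
have hk : (k.+1.*2.-1 < 2 ^ n.+1.*2)%N.
  have := ltn_ord k; rewrite doubleS !expnS.
  by move: (nat_of_ord k) => a; move: (2 ^ n.*2)%N => b; lia.
have := le_bigmax 0 (fun k : 'I_(2 ^ n.+1.*2) =>
  nsq (average sigma f (k.+1%:R * (12 * 2 ^+ n.+1 / (12 * 2 ^+ n.+1.*2))) (tnth x)) `^ p) (Ordinal hk).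
have e2 : (Ordinal hk).+1 = (2 * k.+1)%N by rewrite mul2n.
have te : (Ordinal hk).+1%:R * (2 ^+ n.+1)^-1 = k.+1%:R * (2 ^+ n)^-1 :> R.
  by rewrite e2 natrM exprS; field; rewrite expf_neq0 // pnatr_eq0.
by apply: le_trans; rewrite !dyadic_time te.
Qed.

Lemma dyadic_sup_approx (x : d.-tuple R) (t eta : R) : 0 < t -> 0 < eta ->
  exists n, nsq (average sigma f t (tnth x)) `^ p <= dyadic_sup n x + eta.
Proof.
move=> t0 eta0; have [E [E0 hE]] := nsq_average_lipschitz sigma_ball hf.
have em0 : 0 < eta ^+ q.+1 by rewrite exprn_gt0.
(* 2^n >= M puts x in the box and t in the range of times, and makes the mesh 2^(-n) fine enough for
   the Lipschitz constant E. *)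
pose M : R := E / eta ^+ q.+1 + \sum_j `|tnth x j| + t + 1.
have s0 : 0 <= \sum_j `|tnth x j| by rewrite sumr_ge0.
have Ee0 : 0 <= E / eta ^+ q.+1 by rewrite divr_ge0 // ltW.
have M0 : 0 <= M by rewrite /M; lra.
pose n := (Num.truncn M).+1; exists n.
have hn : M <= 2 ^+ n.
  have /andP[_ h] := truncn_itv M0; apply: le_trans (ltW h) _.
  by rewrite -natrX ler_nat ltnW // ltn_expl.
have w0 : 0 < 2 ^+ n :> R by rewrite exprn_gt0.
have En : E * (2 ^+ n)^-1 <= eta ^+ q.+1.
  rewrite ler_pdivrMr // mulrC -ler_pdivrMr //; apply: le_trans hn.
  by rewrite /M; lra.
have xn j : `|tnth x j| <= 2 ^+ n.
  have : `|tnth x j| <= \sum_j `|tnth x j| by rewrite (bigD1 j) //= lerDl sumr_ge0.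
  by move: hn; rewrite /M; lra.
have tn0 : 0 <= t * 2 ^+ n by rewrite mulr_ge0 // ltW.
pose k := Num.truncn (t * 2 ^+ n); have /andP[k1 k2] := truncn_itv tn0; rewrite -/k in k1 k2.
have w1 : 1 <= 2 ^+ n :> R by rewrite exprn_ege1 // ler1n.
have hk : (k < 2 ^ n.*2)%N.
  rewrite -(ltr_nat R) natrX -addnn exprD; apply: le_lt_trans k1 _.
  rewrite ltr_pM2r //; move: hn; rewrite /M; lra.
have xcube : x \in cube (fun=> - (12 * 2 ^+ n / 3)) (2 * (12 * 2 ^+ n) / 3).
  rewrite inE => j; have := xn j; rewrite ler_norml => /andP[h1 h2].
  by apply/andP; split; lra.
rewrite /dyadic_sup /local_sup indicE xcube mul1r.
pose av (t : R) := nsq (average sigma f t (tnth x)).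
have tk : `|t - k.+1%:R * (2 ^+ n)^-1| <= (2 ^+ n)^-1.
  have -> : t - k.+1%:R * (2 ^+ n)^-1 = (t * 2 ^+ n - k.+1%:R) * (2 ^+ n)^-1.
    by field; rewrite gt_eqF.
  rewrite normrM [X in _ * X]ger0_norm ?invr_ge0 ?(ltW w0) //.
  have kE : k.+1%:R = k%:R + 1 :> R by rewrite natr1.
  rewrite kE in k2; rewrite ler_piMl ?invr_ge0 ?(ltW w0) // ler_norml kE.
  by apply/andP; split; lra.
have h1 : av t <= av (k.+1%:R * (2 ^+ n)^-1) + eta ^+ q.+1.
  apply: le_trans (hE t (k.+1%:R * (2 ^+ n)^-1) (tnth x) (tnth x) (2 ^+ n)^-1 _ _) _.
  - by rewrite invr_ge0 ltW.
  - by move=> j; rewrite subrr normr0 add0r.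
  - by rewrite lerD2l.
apply: le_trans (powR_invn_close (ltn0Sn q) (nsq_ge0 _) (nsq_ge0 _) (ltW eta0) h1) _.
rewrite lerD2r; have := le_bigmax 0 (fun k : 'I_(2 ^ n.*2) =>
  nsq (average sigma f (k.+1%:R * (12 * 2 ^+ n / (12 * 2 ^+ n.*2))) (tnth x)) `^ p) (Ordinal hk).
by rewrite dyadic_time.
Qed.
End DyadicExhaustion.

Section MaximalOperator.
Variables (R : realType) (q d : nat).
Variable sigma : {finite_measure set (q.+1.-tuple (d.-tuple R)) -> \bar R}.
Hypothesis sigma_ball : sigma [set y | 1 < tnorm y] = 0%E.
Variable F : 'I_q.+1 -> 'rV[R]_d -> R[i].
Let f (i : 'I_q.+1) (z : 'I_d -> R) : R[i] := F i (\row_j z j).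
Variables (K B : R).
Hypothesis hf : forall i, sup_lipschitz (f i) K B.

Lemma max_opE x : max_op sigma F x =
  ereal_sup [set (cabs (average sigma f t (tnth x)))%:E | t in [set t : R | 0 < t]].
Proof.
congr ereal_sup; apply: eq_imagel => t _; congr (cabs (Cintegral _ _))%:E.
apply: funext => y; apply: eq_bigr => i _; congr F.
by apply/rowP => j; rewrite !mxE.
Qed.

Lemma max_op_ge0 x : (0 <= max_op sigma F x)%E.
Proof.
rewrite max_opE; apply: (@le_trans _ _ (cabs (average sigma f 1 (tnth x)))%:E).
  by rewrite lee_fin cabs_ge0.
by apply: ereal_sup_ubound; exists 1 => //=.
Qed.

(** Every t > 0 is reached up to [eta] by some [dyadic_sup n]. If the limit is infinite there is
    nothing to prove; otherwise the bound for each t is inverted before the supremum is taken. *)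
Lemma max_op_le_sup x :
  (`|max_op sigma F x| `^ (2 / q.+1%:R) <= limn (fun n => (dyadic_sup sigma f n x)%:E))%E.
Proof.
have e0 : 0 < 2 / q.+1%:R :> R by rewrite divr_gt0.
have nd : nondecreasing_seq (fun n => (dyadic_sup sigma f n x)%:E).
  by apply/nondecreasing_seqP => n; rewrite lee_fin; exact: dyadic_sup_mono.
rewrite (cvg_lim _ (ereal_nondecreasing_cvgn nd)) //.
set b := ereal_sup _.
have bn n : ((dyadic_sup sigma f n x)%:E <= b)%E by apply: ereal_sup_ubound; exists n.
have bt t : 0 < t -> ((cabs (average sigma f t (tnth x)) `^ (2 / q.+1%:R))%:E <= b)%E.
  move=> t0; apply/lee_addgt0Pr => eta eta0; rewrite -nsq_powR.
  have [n hn] := dyadic_sup_approx sigma_ball hf x t0 eta0.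
  by apply: (@le_trans _ _ (dyadic_sup sigma f n x + eta)%:E); rewrite ?lee_fin // EFinD leeD2r.
rewrite gee0_abs ?max_op_ge0 //.
have b0 : (0 <= b)%E.
  by apply: le_trans (bn 0%N); rewrite lee_fin; exact: local_sup_ge0.
move: b b0 bt {bn} => [r| |] //; last by move=> _ _; exact: leey.
rewrite lee_fin => r0 bt.
have Mr : (max_op sigma F x <= (r `^ (2 / q.+1%:R)^-1)%:E)%E.
  rewrite max_opE; apply: ge_ereal_sup => _ [t /= t0 <-]; rewrite lee_fin.
  have := bt t t0; rewrite lee_fin => h.
  have -> : cabs (average sigma f t (tnth x)) =
     (cabs (average sigma f t (tnth x)) `^ (2 / q.+1%:R)) `^ (2 / q.+1%:R)^-1.
    by rewrite -powRrM mulfV ?gt_eqF // powRr1 // cabs_ge0.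
  by apply: ge0_ler_powR; rewrite ?nnegrE ?powR_ge0 ?invr_ge0 // ltW.
have -> : r%:E = ((r `^ (2 / q.+1%:R)^-1)%:E `^ (2 / q.+1%:R))%E.
  by rewrite poweR_EFin -powRrM mulVf ?gt_eqF // powRr1.
apply: gt0_ler_poweR; rewrite ?in_itv /= ?leey ?andbT ?(ltW e0) ?max_op_ge0 //.
by rewrite lee_fin powR_ge0.
Qed.
End MaximalOperator.

Theorem theorem1p3 (R : realType) (m d : nat) (s : R)
  (sigma : {finite_measure set (m.-tuple (d.-tuple R)) -> \bar R})
  (lam : {measure set (d.-tuple R) -> \bar R}) :
  (2 <= m)%N -> (1 <= d)%N ->
  (m.-1)%:R * d%:R / 2 + 1 / 2 < s ->
  sigma [set y | 1 < tnorm y] = 0%E ->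
  (exists A : R, forall xi : m.-tuple (d.-tuple R),
      cabs (fourier_measure sigma xi) <= A * powR (1 + tnorm xi) (- s)) ->
  is_lebesgue_measure lam ->
  exists C : R, forall F : 'I_m -> 'rV[R]_d -> R[i],
    (forall i, is_schwartzC (F i)) ->
    (eLnorm lam (2 / m%:R) (max_op sigma F) <=
     C%:E * \prod_(i < m) eLnorm lam 2 (fun x => (cabs (F i (tuple_rV x)))%:E))%E.
Proof.
case: m sigma => [|q] // sigma; rewrite ltnS => q0 d0 hs ball [A hA] lamP.
have [C [C0 hC]] := local_integral_bound ball lamP q0 d0 hs hA.
have mR : q.+1%:R != 0 :> R by rewrite pnatr_eq0.
(* The norm is the power m/2 of the integral, so the constant is raised to m/2. *)
exists (C `^ (2 / q.+1%:R)^-1) => F hF.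
pose f (i : 'I_q.+1) (z : 'I_d -> R) : R[i] := F i (\row_j z j).
have [K hK] := choice (fun i => schwartzC_lipschitz (hF i)).
have [B hB] := choice hK.
(* A single pair of constants for all factors: the sums over the indices dominate each of them. *)
have hf i : sup_lipschitz (f i) (\sum_k `|K k|) (\sum_k `|B k|).
  have [K0 fB fK] := hB i; split.
  - by rewrite sumr_ge0.
  - move=> z; apply: le_trans (fB z) _; apply: le_trans (ler_norm _) _.
    by rewrite (bigD1 i) //= lerDl sumr_ge0.
  move=> z w e e0 zw; apply: le_trans (fK z w e e0 zw) _; rewrite ler_wpM2r //.
  by apply: le_trans (ler_norm _) _; rewrite (bigD1 i) //= lerDl sumr_ge0.
pose N i : \bar R := (\int[lam]_x (nsq (f i (tnth x)))%:E)%E.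
have N0 i : (0 <= N i)%E by apply: integral_ge0 => x _; rewrite lee_fin nsq_ge0.
pose p : R := q.+1%:R^-1.
have pN0 i : (0 <= N i `^ p)%E by exact: poweR_ge0.
have prodN0 : (0 <= \prod_(i < q.+1) (N i `^ p))%E.
  exact: ge0_prode.
have bound n : (\int[lam]_x (dyadic_sup sigma f n x)%:E <= C%:E * \prod_i (N i `^ p))%E.
  have L0 : 0 < 12 * 2 ^+ n :> R by rewrite mulr_gt0 // exprn_gt0.
  have [I [I0 [IN hI]]] := hC f _ _ (12 * 2 ^+ n) n.*2 hf L0.
  apply: le_trans hI _; rewrite EFinM lee_wpmul2l ?lee_fin ?(ltW C0) //.
  apply: lee_prod_EFin => i; first exact: powR_ge0.
  rewrite -poweR_EFin; apply: gt0_ler_poweR; rewrite ?in_itv /= ?leey ?andbT ?invr_ge0 //.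
  - by rewrite lee_fin.
  - exact: IN.
have main : (\int[lam]_x (`|max_op sigma F x| `^ (2 / q.+1%:R)) <= C%:E * \prod_i (N i `^ p))%E.
  (* Measurability is asked of the functions [dyadic_sup] only, through monotone convergence; the
     maximal operator is merely compared with their limit. *)
  apply: (@le_trans _ _ (\int[lam]_x limn (fun n => (dyadic_sup sigma f n x)%:E))%E).
    apply: integral_le_nonmeasurable => x; first exact: poweR_ge0.
    exact: (max_op_le_sup ball hf).
  have nd x : nondecreasing_seq (fun n => (dyadic_sup sigma f n x)%:E).
    by apply/nondecreasing_seqP => n; rewrite lee_fin; exact: dyadic_sup_mono.
  rewrite (@monotone_convergence _ _ _ lam setT measurableT (fun n x => (dyadic_sup sigma f n x)%:E)).
  - apply: lime_le; last by apply: nearW => n; exact: bound.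
    apply: ereal_nondecreasing_is_cvgn; apply/nondecreasing_seqP => n.
    apply: integral_le_nonmeasurable => x; rewrite lee_fin; first exact: local_sup_ge0.
    exact: dyadic_sup_mono.
  - by move=> n; apply/measurable_EFinP; exact: (measurable_local_sup ball _ _ hf).
  - by move=> n x _; rewrite lee_fin; exact: local_sup_ge0.
  - by move=> x _; exact: nd.
have r0 : 0 <= (2 / q.+1%:R : R)^-1 by rewrite invr_ge0 divr_ge0.
have CN0 : (0 <= C%:E * \prod_i (N i `^ p))%E by rewrite mule_ge0 // lee_fin ltW.
rewrite /eLnorm.
apply: (@le_trans _ _ ((C%:E * \prod_i (N i `^ p)) `^ (2 / q.+1%:R)^-1)%E).
  apply: gt0_ler_poweR; rewrite ?in_itv /= ?leey ?andbT //.
  by apply: integral_ge0 => x _; exact: poweR_ge0.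
rewrite poweRM ?lee_fin ?(ltW C0) // poweR_EFin poweR_prod //.
rewrite le_eqVlt; apply/orP; left; apply/eqP; congr (_ * _)%E; apply: eq_bigr => i _.
rewrite -poweRrM; have -> : p * (2 / q.+1%:R)^-1 = 2^-1 by rewrite /p; field.
congr (_ `^ _)%E; apply: eq_integral => x _.
rewrite gee0_abs ?lee_fin ?cabs_ge0 // poweR_EFin powR_mulrn ?cabs_ge0 // sqr_cabs.
by congr (nsq (F i _))%:E; apply/rowP => j; rewrite !mxE.
Qed.
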